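(* For every $C_0\ge1$ there exists $C\ge1$, depending only on $C_0$, such that the following holds. Let $n\ge8$, $p\in\{1,2\}$, let $x^*$ be an arbitrary minimizer of $f(x)=\mathbb{E}_\xi[F(x,\xi)]$ on $\mathbb{R}^n$, let $\Theta_p$ satisfy $V[x_0](x^* )\le\Theta_p$, and assume $0<\Delta\le L_2\Theta_pn\rho_n^2/2$. Define $$N(\Delta)=\min\Big\{\tfrac{L_2\Theta_1}{n\Delta},\sqrt{\tfrac{L_2\Theta_1}{n\Delta}}\Big\}\ \text{ if } p=1,\qquad N(\Delta)=\min\Big\{\tfrac{L_2\Theta_2}{\Delta},\sqrt{\tfrac{nL_2\Theta_2}{\Delta}}\Big\}\ \text{ if } p=2,$$ and, for both values of $p$, $$t(\Delta)=\sqrt{\tfrac{\Delta}{L_2}},\qquad m(\Delta)=\min\Big\{\tfrac{\sigma^2}{nL_2\Delta},\tfrac{\sigma^2}{\sqrt{nL_2^3\Theta_p\Delta}}\Big\},\qquad \varepsilon(\Delta)=\max\Big\{n\Delta,\sqrt{nL_2\Theta_p\Delta}\Big\}.$$ Let RDFDS (defined in the context) be run from $x_0$ with positive integers $N,m$ and a smoothing parameter $t>0$ such that each of the ratios $N/N(\Delta)$, $m/m(\Delta)$, $t/t(\Delta)$ (with $m(\Delta)>0$) lies in $[C_0^{-1}(\ln n)^{-C_0},\,C_0(\ln n)^{C_0}]$. Then its output satisfies $$\mathbb{E}[f(\bar x_N)]-f(x^* )\le C(\ln n)^C\,\varepsilon(\Delta).$$ Moreover, the overall number of oracle calls is $Nm$,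 which is at most $C(\ln n)^C$ times $$\min\Big\{\tfrac{\sigma^2\Theta_1}{n^2\Delta^2},\tfrac{\sigma^2}{nL_2\Delta}\Big\}\ \text{ for } p=1,\qquad \min\Big\{\tfrac{\sigma^2\Theta_2}{n\Delta^2},\tfrac{\sigma^2}{L_2\Delta}\Big\}\ \text{ for } p=2.$$
   Context: Problem. $\xi$ is a random vector with distribution $P$ on $\mathcal{X}$; $f(x)=\mathbb{E}_\xi[F(x,\xi)]$ is a closed convex function on $\mathbb{R}^n$ having a minimizer ($F(\cdot,\xi)$ itself need not be convex). Almost surely in $\xi$, $F(\cdot,\xi)$ has a gradient $g(x,\xi)$ with $\|g(x,\xi)-g(y,\xi)\|_2\le L(\xi)\|x-y\|_2$ for all $x,y$. The constant $L_2>0$ satisfies $\sqrt{\mathbb{E}_\xi L(\xi)^2}\le L_2$; consequently $\mathbb{E}_\xi g(x,\xi)=\nabla f(x)$ and $\nabla f$ is $L_2$-Lipschitz in $\|\cdot\|_2$. For all $x$, $\mathbb{E}_\xi\|g(x,\xi)-\nabla f(x)\|_2^2\le\sigma^2$. Oracle. Given a pair of points $(x,y)$, an oracle call returns $(\widetilde f(x,\xi),\widetilde f(y,\xi))$ for one sample $\xi\sim P$ (the same for both points), where $\widetilde f(x,\xi)=F(x,\xi)+\eta(x,\xi)$ and $|\eta(x,\xi)|\le\Delta$ for all $x\in\mathbb{R}^n$, a.s. in $\xi$. All functions are measurable, so that expectations make sense. The noise level $\Delta$ is known but cannot be controlled. Proximal setup. $q$ is given by $\frac1p+\frac1q=1$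 ($q=\infty$ for $p=1$, $q=2$ for $p=2$). The prox-function is $d(x)=\frac12\|x\|_2^2$ for $p=2$, and $d(x)=\frac12\,\exp(1)\,n^{(\kappa-1)(2-\kappa)/\kappa}\ln n\,\|x\|_\kappa^2$ with $\kappa=1+\frac1{\ln n}$ for $p=1$; it is $1$-strongly convex w.r.t. $\|\cdot\|_p$. $V[z](x)=d(x)-d(z)-\langle\nabla d(z),x-z\rangle$ is the Bregman divergence. $\rho_n=\min\{q-1,\,16\ln n-8\}\,n^{2/q-1}$, i.e. $\rho_n=(16\ln n-8)/n$ for $p=1$ and $\rho_n=1$ for $p=2$ (when $n\ge 8$). Gradient approximation. For $e$ in the unit Euclidean sphere and samples $\xi_1,\dots,\xi_m$, $\widetilde\nabla^m f^t(x)=\frac1m\sum_{i=1}^m\frac{\widetilde f(x+te,\xi_i)-\widetilde f(x,\xi_i)}{t}\,e$. RDFDS. Input $x_0\in\mathbb{R}^n$, $N,m\ge1$, $t>0$, stepsize $\alpha=\frac{1}{48n\rho_nL_2}$. For $k=0,\dots,N-1$: draw $e_{k+1}$ uniformly from the unit Euclidean sphere of $\mathbb{R}^n$ and $m$ independent copies $\xi_1^{k+1},\dots,\xi_m^{k+1}$ of $\xi$, all independent of each other and of previous iterations; compute $\widetilde\nabla^m f^t(x_k)$ with $e=e_{k+1}$ and $\xi_i=\xi_i^{k+1}$; set $x_{k+1}=\arg\min_{x\in\mathbb{R}^n}\{\alpha n\langle\widetilde\nabla^m f^t(x_k),x-x_k\rangle+V[x_k](x)\}$. Output $\bar x_N=\frac1N\sum_{k=0}^{N-1}x_k$.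 $\mathbb{E}$ is the expectation over all randomness of the algorithm. *)

(* Defs.v *)
From HB Require Import structures.
From mathcomp Require Import all_boot all_order all_algebra.
From mathcomp Require Import all_classical all_reals all_analysis.

Set Implicit Arguments.
Unset Strict Implicit.
Unset Printing Implicit Defensive.

Import Order.TTheory GRing.Theory Num.Theory.
Import numFieldNormedType.Exports.

Local Open Scope classical_set_scope.
Local Open Scope ring_scope.

(* R^n is 'rV[R]_n.  The library norm `|x| of a row vector is the sup norm; it
   only serves here to provide the topology and Frechet differentiability.  The
   sigma-algebra generated by the coordinates is the Borel one. *)
Section measurable_rV.
Context {d : measure_display} {T : measurableType d} (n : nat).

Definition rV_coord (j : 'I_n) (x : 'rV[T]_n) : T := x ord0 j.

Let rV_set0 : g_sigma_preimage rV_coord set0.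
Proof. exact: sigma_algebra0. Qed.

Let rV_setC A : g_sigma_preimage rV_coord A -> g_sigma_preimage rV_coord (~` A).
Proof. exact: sigma_algebraC. Qed.

Let rV_bigcup (F : (set 'rV[T]_n)^nat) :
  (forall i, g_sigma_preimage rV_coord (F i)) ->
  g_sigma_preimage rV_coord (\bigcup_i (F i)).
Proof. exact: sigma_algebra_bigcup. Qed.

HB.instance Definition _ := @isMeasurable.Build (measure_tuple_display d)
  'rV[T]_n (g_sigma_preimage rV_coord) rV_set0 rV_setC rV_bigcup.

End measurable_rV.

Section euclidean.
Context {R : realType} {n : nat}.
Implicit Types x y v : 'rV[R]_n.

Definition dotv x y : R := \sum_(j < n) x ord0 j * y ord0 j.

Definition l2norm x : R := Num.sqrt (\sum_(j < n) x ord0 j ^+ 2).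

Definition lnorm (a : R) x : R := (\sum_(j < n) `|x ord0 j| `^ a) `^ a^-1.

Definition grad (h : 'rV[R]_n -> R) x : 'rV[R]_n :=
  \row_(j < n) 'D_(delta_mx ord0 j) h x.

Definition has_gradient (h : 'rV[R]_n -> R) x v : Prop :=
  differentiable h x /\ grad h x = v.

Definition is_minimizer (h : 'rV[R]_n -> R) x : Prop := forall y, h x <= h y.

Definition closed_convex (h : 'rV[R]_n -> R) : Prop :=
  closed [set z : 'rV[R]_n * R | h z.1 <= z.2] /\
  convex_function [set: convex_lmodType 'rV[R]_n] h.

(* The uniform distribution on the unit Euclidean sphere is the unique
   probability measure carried by the sphere and invariant under the orthogonal
   group. *)
Definition uniform_on_sphere (mu : set 'rV[R]_n -> \bar R) : Prop :=
  mu [set x | l2norm x = 1] = 1%E /\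
  forall (Q : 'M[R]_n) (A : set 'rV[R]_n), Q *m Q^T = 1%:M -> measurable A ->
    mu [set x | A (x *m Q)] = mu A.

End euclidean.

Section independence.
Context {d : measure_display} {T : measurableType d} {R : realType}.

Definition generated_by d' (T' : measurableType d') (X : T -> T') :
  set (set T) := preimage_set_system setT X measurable.

Definition mutually_independent (Pr : probability T R) (I : finType)
    (G : I -> set (set T)) : Prop :=
  forall (J : {set I}) (A : I -> set T), (forall i, i \in J -> G i (A i)) ->
    Pr (\bigcap_(i in [set` J]) A i) = (\prod_(i in J) Pr (A i))%E.

End independence.

Section prox.
Context {R : realType} (n p : nat).

Definition prox_kappa : R := 1 + (ln n%:R)^-1.

(* Only meant for p = 1 and p = 2. *)
Definition prox (x : 'rV[R]_n) : R :=
  if p == 2%N then 2^-1 * l2norm x ^+ 2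
  else 2^-1 * expR 1
       * n%:R `^ ((prox_kappa - 1) * (2 - prox_kappa) / prox_kappa)
       * ln n%:R * lnorm prox_kappa x ^+ 2.

Definition bregman (z x : 'rV[R]_n) : R :=
  prox x - prox z - dotv (grad prox z) (x - z).

(* q is +oo when p = 1, and then q^-1 = 0. *)
Definition conj_exp : \bar R := hoelder_conjugate p%:R%:E.

Definition rho : R :=
  fine (mine (conj_exp - 1) (16 * ln n%:R - 8)%:E)%E
  * n%:R `^ (2 * fine (conj_exp^-1)%E - 1).

End prox.

Section problem.
Context {R : realType} {n : nat} {d : measure_display} {X : measurableType d}.
Variable P : probability X R.
Implicit Types (F : 'rV[R]_n -> X -> R) (g : 'rV[R]_n -> X -> 'rV[R]_n).

Definition objective F (x : 'rV[R]_n) : R := fine 'E_P[F x].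

Record stochastic_problem F g (L : X -> R) (L2 sigma : R) : Prop := {
  sp_measF : measurable_fun [set: 'rV[R]_n * X] (fun z => F z.1 z.2) ;
  sp_measg : measurable_fun [set: 'rV[R]_n * X] (fun z => g z.1 z.2) ;
  sp_measL : measurable_fun [set: X] L ;
  sp_int : forall x, P.-integrable setT (EFin \o F x) ;
  sp_convex : closed_convex (objective F) ;
  sp_grad : {ae P, forall u, forall x, has_gradient (F ^~ u) x (g x u)} ;
  sp_lip : {ae P, forall u, forall x y,
              l2norm (g x u - g y u) <= L u * l2norm (x - y)} ;
  sp_L2_gt0 : 0 < L2 ;
  sp_L2 : (sqrte 'E_P[fun u => (L u ^+ 2)%R] <= L2%:E)%E ;
  sp_var : forall x,
    ('E_P[fun u => (l2norm (g x u - grad (objective F) x) ^+ 2)%R]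
       <= (sigma ^+ 2)%:E)%E }.

Record bounded_noise (eta : 'rV[R]_n -> X -> R) (Delta : R) : Prop := {
  bn_meas : measurable_fun [set: 'rV[R]_n * X] (fun z => eta z.1 z.2) ;
  bn_bound : {ae P, forall u, forall x, `|eta x u| <= Delta} }.

End problem.

Section rdfds.
Context {R : realType} {n : nat} {d : measure_display} {X : measurableType d}.
Variables F eta : 'rV[R]_n -> X -> R.

Definition noisy (x : 'rV[R]_n) (u : X) : R := F x u + eta x u.

Definition oracle (xy : 'rV[R]_n * 'rV[R]_n) (u : X) : R * R :=
  (noisy xy.1 u, noisy xy.2 u).

Definition grad_approx (m : nat) (t : R) (x e : 'rV[R]_n) (us : 'I_m -> X) :
    'rV[R]_n :=
  m%:R^-1 *: \sum_(i < m)
    (let r := oracle (x + t *: e, x) (us i) in ((r.1 - r.2) / t) *: e).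

Definition stepsize (p : nat) (L2 : R) : R := (48 * n%:R * rho n p * L2)^-1.

(* [x] is the sequence of iterates produced from the draws e_{k+1} = es k and
   xi_i^{k+1} = us k i; only x 0, ..., x N are constrained. *)
Definition rdfds_run (p : nat) (L2 : R) (N m : nat) (t : R) (x0 : 'rV[R]_n)
    (es : 'I_N -> 'rV[R]_n) (us : 'I_N -> 'I_m -> X) (x : nat -> 'rV[R]_n) :
    Prop :=
  x 0%N = x0 /\
  forall k : 'I_N,
    is_minimizer
      (fun y => stepsize p L2 * n%:R
                  * dotv (grad_approx t (x k) (es k) (us k)) (y - x k)
                + bregman p (x k) y)
      (x k.+1).

Definition rdfds_output (N : nat) (x : nat -> 'rV[R]_n) : 'rV[R]_n :=
  N%:R^-1 *: \sum_(k < N) x k.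

(* The oracle calls made by a run, each with its pair of points and sample. *)
Definition rdfds_calls (N m : nat) (t : R) (es : 'I_N -> 'rV[R]_n)
    (us : 'I_N -> 'I_m -> X) (x : nat -> 'rV[R]_n) :
    seq (('rV[R]_n * 'rV[R]_n) * X) :=
  [seq ((x k + t *: es k, x k), us k i) | k : 'I_N <- enum 'I_N, i : 'I_m <- enum 'I_m].

End rdfds.

Section randomness.
Context {R : realType} {n : nat} {d : measure_display} {X : measurableType d}.
Context {d' : measure_display} {Omega : measurableType d'}.

Definition rdfds_draws (P : probability X R) (Pr : probability Omega R)
    (N m : nat) (e : 'I_N -> {RV Pr >-> 'rV[R]_n})
    (xi : 'I_N -> 'I_m -> {RV Pr >-> X}) : Prop :=
  [/\ forall k, uniform_on_sphere (distribution Pr (e k)),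
      forall k i A, measurable A -> distribution Pr (xi k i) A = P A
    & mutually_independent Pr (fun j : 'I_N + 'I_N * 'I_m =>
        match j with
        | inl k => generated_by (e k)
        | inr ki => generated_by (xi ki.1 ki.2)
        end)].

End randomness.

Section parameters.
Context {R : realType}.
Variables (n p : nat) (L2 Theta sigma Delta : R).

Definition N_Delta : R :=
  if p == 2%N then
    Num.min (L2 * Theta / Delta) (Num.sqrt (n%:R * L2 * Theta / Delta))
  else Num.min (L2 * Theta / (n%:R * Delta))
         (Num.sqrt (L2 * Theta / (n%:R * Delta))).

Definition t_Delta : R := Num.sqrt (Delta / L2).

Definition m_Delta : R :=
  Num.min (sigma ^+ 2 / (n%:R * L2 * Delta))
    (sigma ^+ 2 / Num.sqrt (n%:R * L2 ^+ 3 * Theta * Delta)).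

Definition eps_Delta : R :=
  Num.max (n%:R * Delta) (Num.sqrt (n%:R * L2 * Theta * Delta)).

Definition calls_Delta : R :=
  if p == 2%N then
    Num.min (sigma ^+ 2 * Theta / (n%:R * Delta ^+ 2))
      (sigma ^+ 2 / (L2 * Delta))
  else Num.min (sigma ^+ 2 * Theta / (n%:R ^+ 2 * Delta ^+ 2))
         (sigma ^+ 2 / (n%:R * L2 * Delta)).

(* a / b lies in [C0^-1 (ln n)^-C0, C0 (ln n)^C0]. *)
Definition ratio_polylog (C0 a b : R) : Prop :=
  C0^-1 * ln n%:R `^ (- C0) <= a / b <= C0 * ln n%:R `^ C0.

End parameters.

(* Main.v *)
(* Mirror descent in the dual space. Write [V] for the divergence of the
   prox-function, [xs] for the minimizer and [h] for the conjugate
   prox-function; [h] is smooth with respect to the dual norm, with constant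
   [9 (b - 1) / c], so one step changes [E V(x_k, xs)] by [- alpha E (f x_k -
   f xs)] plus an error in the squared dual norm of the estimator. The
   estimator is a multiple of [e], namely [<grad f x_k, e> + <noise, e> +
   (finite-difference error)] times [e]. Given the past, the first two terms
   contribute by rotation invariance [E <s, e> <v, e> = <s, v> / n] and [E
   <s, e>^2 |e|_b^2 <= const * rho / n * |s|^2]. The gradient part is
   absorbed because [|grad f x|^2 <= 2 L2 (f x - f xs)]; the noise part gains
   [1 / m] since the samples are independent and centred; the
   finite-difference error, of mean square at most [t^2 L2^2 / 2 + 8 Delta^2
   / t^2], is paired with [x_k - xs] by Young's inequality, which costs a
   factor [1 + 1 / (2 N)] per step. Summing over [k] gives an explicit bound,
   into which [N(Delta) = Q / eps] and [m(Delta) = sigma^2 / (L2 eps)] are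
   substituted, with [Q = L2 Theta] for [p = 1] and [Q = n L2 Theta] for [p =
   2]. *)

(* Two obstacles shape the proof. The first is conditioning. Conditional expectations are replaced
   by Fubini: [Omega] carries the sigma-algebra generated by some of the draws, and a further draw Z
   is independent of it, so the pair (w, Z w) has a product law. Each estimate chooses which draw
   comes last: the direction, to use moments of the sphere, or one sample, to use that its noise is
   centred. The second is the product <s, e>^2 |e|_b^2, whose factors are dependent. On the sphere
   (b - 1) / c |e|_b^2 is majorised by a polynomial invariant under sign changes and permutations of
   the coordinates. Against such a weight the second-moment matrix of e is exactly a multiple of the
   identity, so only the mean of the weight remains to be bounded, by rho. The stepsize then turns
   the gradient part of the squared term into 36 alpha^2 n rho L2 = 3 alpha / 4 times the gap, which
   leaves alpha / 4. Smoothness of the conjugate comes from tangent-line inequalities and Hoelder,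
   without second derivatives; it also gives strong convexity of the prox-function, hence the closed
   form of a step. *)
Require Import Defs.
From HB Require Import structures.
From mathcomp Require Import all_boot all_order all_algebra perm.
From mathcomp Require Import all_classical all_reals all_analysis measurable_realfun.
From mathcomp Require Import ring lra.

Set Implicit Arguments.
Unset Strict Implicit.
Unset Printing Implicit Defensive.

Import Order.TTheory GRing.Theory Num.Theory.
Import numFieldNormedType.Exports.

Local Open Scope classical_set_scope.
Local Open Scope ring_scope.

(** * Powers and sums of powers *)

(* Finite sums defeat the syntactic comparison of atoms inside [lra]. *)
Ltac hide f := set f in *; match goal with z := f |- _ => clearbody z end.
Ltac hide_sums := repeat match goal with
  | |- context [lnorm ?a ?x] => hide (lnorm a x)
  | H : context [lnorm ?a ?x] |- _ => hide (lnorm a x)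
  | |- context [dotv ?a ?x] => hide (dotv a x)
  | H : context [dotv ?a ?x] |- _ => hide (dotv a x)
  | |- context [l2norm ?x] => hide (l2norm x)
  | H : context [l2norm ?x] |- _ => hide (l2norm x)
  | H : @eq 'rV[_]_ _ _ |- _ => clear H
  end.
Ltac slra := hide_sums; lra.

Ltac nneg := repeat first [done | exact: sqr_ge0 | exact: ltW
  | apply: addr_ge0 | apply: divr_ge0 | apply: mulr_ge0 | apply: exprn_ge0].

Section young.
Context {R : realType}.
Implicit Types a b x y r s : R.

Lemma young_powR s a b : 0 <= s <= 1 -> 0 <= a -> 0 <= b ->
  a `^ s * b `^ (1 - s) <= s * a + (1 - s) * b.
Proof.
move=> /andP[s0 s1] a0 b0.
have [->|sn0] := eqVneq s 0; first by rewrite powRr0 subr0 powRr1//; lra.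
have [->|sn1] := eqVneq s 1; first by rewrite subrr powRr0 powRr1//; lra.
have s_gt0 : 0 < s by rewrite lt_neqAle eq_sym sn0.
have s_lt1 : 0 < 1 - s by rewrite subr_gt0 lt_neqAle sn1.
have := @conjugate_powR R (a `^ s) (b `^ (1 - s)) s^-1 (1 - s)^-1
  (powR_ge0 _ _) (powR_ge0 _ _).
rewrite !invr_gt0 => /(_ s_gt0 s_lt1); rewrite !invrK subrKC => /(_ erefl).
by rewrite -!powRrM !mulfV ?gt_eqF// !powRr1// [a * s]mulrC [b * _]mulrC.
Qed.

(** The weighted mean inequality multiplied by a^(s-1); no derivative is taken. *)
Lemma powR_concave_tangent s a b : 0 <= s <= 1 -> 0 < a -> 0 <= b ->
  b `^ s <= a `^ s + s * a `^ (s - 1) * (b - a).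
Proof.
move=> s01 a0 b0; have := young_powR s01 b0 (ltW a0) => h.
have p0 : 0 < a `^ (s - 1) by rewrite powR_gt0.
have e1 : a `^ (1 - s) * a `^ (s - 1) = 1.
  rewrite -powRD ?(gt_eqF a0) ?implybT//.
  by rewrite (_ : 1 - s + (s - 1) = 0) ?powRr0//; ring.
have e2 : a * a `^ (s - 1) = a `^ s.
  rewrite -[X in X * _ = _](powRr1 (ltW a0)) -powRD ?(gt_eqF a0) ?implybT//.
  by rewrite subrKC.
have := ler_wpM2r (ltW p0) h; rewrite -(mulrA (b `^ s)) e1 mulr1 => /le_trans; apply.
rewrite -e2; lra.
Qed.

(** The weighted mean inequality with weight 1/r, applied to b^r and a^r. Here a = 0 is allowed, as
    zero coordinates require. *)
Lemma powR_convex_tangent r a b : 1 <= r -> 0 <= a -> 0 <= b ->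
  a `^ r + r * a `^ (r - 1) * (b - a) <= b `^ r.
Proof.
move=> r1 a0 b0; have r0 : 0 < r by lra.
have i0 : 0 < r^-1 by rewrite invr_gt0.
have i1 : r^-1 <= 1 by rewrite invf_le1.
have s01 : 0 <= r^-1 <= 1 by rewrite ltW.
have := young_powR s01 (powR_ge0 b r) (powR_ge0 a r).
rewrite -!powRrM mulfV ?gt_eqF// powRr1// mulrBr mulr1 mulfV ?gt_eqF// => h.
have e : a * a `^ (r - 1) = a `^ r by exact: mulr_powRB1.
have := ler_wpM2l (ltW r0) h; rewrite mulrDr !mulrA mulfV ?gt_eqF// mul1r.
have -> : r * (1 - r^-1) = r - 1 by rewrite mulrBr mulr1 mulfV ?gt_eqF.
rewrite -e; lra.
Qed.

(** After both sums are normalised to one, Hoelder is the weighted mean inequality term by term. A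
    vanishing sum kills every term, since 0^s = 0 for s > 0. *)
Lemma sum_hoelder (I : finType) s (a b : I -> R) : 0 < s <= 1 ->
  (forall i, 0 <= a i) -> (forall i, 0 <= b i) ->
  \sum_i a i `^ s * b i `^ (1 - s) <=
  (\sum_i a i) `^ s * (\sum_i b i) `^ (1 - s).
Proof.
move=> /andP[s0 s1] a0 b0.
have A0 : 0 <= \sum_i a i by exact: sumr_ge0.
have B0 : 0 <= \sum_i b i by exact: sumr_ge0.
have [->|sn1] := eqVneq s 1.
  rewrite subrr powRr0 powRr1// mulr1.
  by apply: ler_sum => i _; rewrite powRr0 powRr1// mulr1.
have s_lt1 : 0 < 1 - s by rewrite subr_gt0 lt_neqAle sn1.
have [Ae|An] := eqVneq (\sum_i a i) 0.
  rewrite big1 ?mulr_ge0 ?powR_ge0// => i _.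
  have -> : a i = 0 by move/psumr_eq0P : Ae; apply.
  by rewrite powR0 ?gt_eqF// mul0r.
have [Be|Bn] := eqVneq (\sum_i b i) 0.
  rewrite big1 ?mulr_ge0 ?powR_ge0// => i _.
  have -> : b i = 0 by move/psumr_eq0P : Be; apply.
  by rewrite [X in _ * X]powR0 ?gt_eqF// mulr0.
set A := \sum_i a i in A0 An *; set B := \sum_i b i in B0 Bn *.
have Agt0 : 0 < A by rewrite lt_neqAle eq_sym An.
have Bgt0 : 0 < B by rewrite lt_neqAle eq_sym Bn.
have H i : a i `^ s * b i `^ (1 - s) <=
    A `^ s * B `^ (1 - s) * (s * (a i / A) + (1 - s) * (b i / B)).
  have {1}-> : a i = A * (a i / A) by rewrite mulrC divfK.
  have {1}-> : b i = B * (b i / B) by rewrite mulrC divfK.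
  have aA : 0 <= a i / A by rewrite divr_ge0.
  have bB : 0 <= b i / B by rewrite divr_ge0.
  rewrite (powRM s A0 aA) (powRM _ B0 bB) mulrACA ler_wpM2l ?mulr_ge0 ?powR_ge0//.
  by rewrite young_powR// (ltW s0).
apply: (le_trans (ler_sum _ (fun i _ => H i))).
rewrite -mulr_sumr big_split/= -!mulr_sumr -!mulr_suml -/A -/B !mulfV//.
by rewrite !mulr1 subrKC mulr1.
Qed.

(* [|x|^(a-1) sgn x], the derivative of [|x|^a / a] *)
Definition spow a x := Num.sg x * `|x| `^ (a - 1).

Lemma spow_mul a x : 0 < a -> spow a x * x = `|x| `^ a.
Proof.
by move=> a0; rewrite /spow mulrAC -normrEsg mulr_powRB1.
Qed.

Lemma norm_spow a x : 1 < a -> `|spow a x| = `|x| `^ (a - 1).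
Proof.
move=> a1; rewrite /spow normrM normr_sg; have [->|_] := eqVneq x 0.
  by rewrite normr0 powR0 ?normr0 ?mulr0// gt_eqF//; lra.
by rewrite mul1r ger0_norm// powR_ge0.
Qed.

Lemma norm_powR_tangent a x y : 1 <= a ->
  `|x| `^ a + a * spow a x * (y - x) <= `|y| `^ a.
Proof.
move=> a1; have a0 : 0 < a by lra.
have := powR_convex_tangent a1 (normr_ge0 x) (normr_ge0 y).
apply: le_trans; rewrite lerD2l -[leLHS]mulrA -[leRHS]mulrA ler_wpM2l ?(ltW a0)//.
rewrite !mulrBr spow_mul// [X in _ <= _ - X]mulrC mulr_powRB1// lerB//.
rewrite /spow mulrAC mulrC ler_wpM2l ?powR_ge0//.
have /le_trans := ler_norm (Num.sg x * y); apply; rewrite normrM normr_sg.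
by case: (x != 0); rewrite ?mul1r ?mul0r.
Qed.

Lemma powR_le_mono r x y : 0 <= r -> 0 <= x -> x <= y -> x `^ r <= y `^ r.
Proof.
move=> r0 x0 xy; apply: ge0_ler_powR => //; rewrite ?nnegrE//.
exact: le_trans xy.
Qed.

(** Superadditivity serves the case of [spow_lipschitz] in which the two points lie on opposite
    sides of 0. *)
Lemma powRD1 r x y : 1 <= r -> 0 <= x -> 0 <= y ->
  x `^ r + y `^ r <= (x + y) `^ r.
Proof.
move=> r1 x0 y0; have r0 : 0 < r by lra.
rewrite -(mulr_powRB1 x0 r0) -(mulr_powRB1 y0 r0).
rewrite -(mulr_powRB1 (addr_ge0 x0 y0) r0) mulrDl.
by apply: lerD; rewrite ler_wpM2l// powR_le_mono//; lra.
Qed.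

(** A mean-value estimate. For points of equal sign it is the tangent inequality for the exponent a
    - 1; for opposite signs the difference is a sum of powers, bounded by superadditivity. Oddness
    of [spow] reduces to x >= 0. *)
Lemma spow_lipschitz a x y : 2 <= a ->
  `|spow a (x + y) - spow a x|
    <= (a - 1) * (`|x| + `|y|) `^ (a - 2) * `|y|.
Proof.
move=> a2; have a11 : 1 <= a - 1 by lra.
have same (u v : R) : 0 <= v -> v <= u -> u <= `|x| + `|y| ->
    `|u `^ (a - 1) - v `^ (a - 1)|
      <= (a - 1) * (`|x| + `|y|) `^ (a - 2) * (u - v).
  move=> v0 vu us; have u0 : 0 <= u by exact: le_trans vu.
  rewrite ger0_norm; last by rewrite subr_ge0 powR_le_mono//; lra.
  have := powR_convex_tangent a11 u0 v0.
  rewrite (_ : a - 1 - 1 = a - 2); last by ring.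
  move=> h; apply: (@le_trans _ _ ((a - 1) * u `^ (a - 2) * (u - v))).
    by lra.
  by rewrite ler_wpM2r ?subr_ge0// ler_wpM2l ?powR_le_mono//; lra.
have opp (u v : R) : 0 <= u -> 0 <= v -> u + v <= `|x| + `|y| ->
    u `^ (a - 1) + v `^ (a - 1)
      <= (a - 1) * (`|x| + `|y|) `^ (a - 2) * (u + v).
  move=> u0 v0 uvs; apply: (le_trans (powRD1 a11 u0 v0)).
  have uv0 : 0 <= u + v by exact: addr_ge0.
  rewrite -mulr_powRB1//; last by lra.
  rewrite (_ : a - 1 - 1 = a - 2); last by ring.
  rewrite mulrC ler_wpM2r// -[leLHS]mul1r.
  by rewrite ler_pM ?powR_ge0// powR_le_mono//; lra.
have pow0 : (0 : R) `^ (a - 1) = 0 by rewrite powR0// gt_eqF//; lra.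
have nxy : `|x + y| <= `|x| + `|y| by exact: ler_normD.
rewrite /spow.
wlog x0 : x y same opp nxy / 0 <= x => [H|].
  have [x0|x0] := leP 0 x; first exact: H.
  have := H (- x) (- y); rewrite -opprD !sgrN !normrN !mulNr -opprD normrN.
  by apply => //; lra.
have sgpow (u : R) : 0 <= u -> Num.sg u * `|u| `^ (a - 1) = u `^ (a - 1).
  rewrite le_eqVlt => /predU1P[<-|u0]; first by rewrite normr0 pow0 mulr0.
  by rewrite gtr0_sg// gtr0_norm// mul1r.
have [xy0|xy0] := leP 0 (x + y).
  rewrite !sgpow//; have [y0|y0] := leP 0 y.
    rewrite [X in _ * X](_ : _ = (x + y) - x); last by rewrite ger0_norm//; ring.
    by apply: same => //; rewrite ?lerDl// -[x + y]ger0_norm.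
  rewrite distrC [X in _ * X](_ : _ = x - (x + y)); last first.
    by rewrite ltr0_norm//; ring.
  by apply: same => //; rewrite ?gerDl ?(ltW y0)// (ger0_norm x0) lerDl.
have y0 : y < 0 by lra.
rewrite ltr0_sg// mulN1r sgpow// -opprD normrN ger0_norm; last first.
  by rewrite addr_ge0 ?powR_ge0.
rewrite [X in _ * X](_ : _ = `|x + y| + x); last first.
  by rewrite !ltr0_norm//; ring.
by apply: opp => //; rewrite (ltr0_norm xy0) (ltr0_norm y0) (ger0_norm x0); lra.
Qed.

(** Convexity at x + y, evaluated at x, bounds |x + y|^a with the derivative taken at x + y;
    [spow_lipschitz] moves it back to x. The remainder is a product of powers so that Hoelder can be
    applied after summation over coordinates. *)
Lemma norm_powR_upper a x y : 2 <= a ->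
  `|x + y| `^ a <= `|x| `^ a + a * spow a x * y
                   + a * (a - 1) * (y ^+ 2 * (`|x| + `|y|) `^ (a - 2)).
Proof.
move=> a2; have a1 : 1 <= a by lra.
have := norm_powR_tangent (x + y) x a1.
rewrite (_ : x - (x + y) = - y) ?mulrN; last by ring. move=> h.
have := spow_lipschitz x y a2 => l.
have : (spow a (x + y) - spow a x) * y
    <= (a - 1) * (y ^+ 2 * (`|x| + `|y|) `^ (a - 2)).
  rewrite (le_trans (ler_norm _))// normrM -real_normK ?num_real//.
  by apply: (le_trans (ler_wpM2r (normr_ge0 y) l)); lra.
move=> /(ler_wpM2l (_ : 0 <= a)); rewrite (le_trans _ a1)// => /(_ erefl).
by move: h; set z := (_ `^ (a - 2)); lra.
Qed.

End young.

(** * Hoelder and Minkowski inequalities, and the duality maps of the l_a norms *)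

Section lnorm_theory.
Context {R : realType} {n : nat}.
Implicit Types (x y z v h : 'rV[R]_n) (a b c : R).

Definition lsum a x : R := \sum_(j < n) `|x ord0 j| `^ a.

Lemma lsum_ge0 a x : 0 <= lsum a x.
Proof. by apply: sumr_ge0 => j _; exact: powR_ge0. Qed.

Lemma lnorm_ge0 a x : 0 <= lnorm a x.
Proof. exact: powR_ge0. Qed.

Lemma lnorm_pow a x : 0 < a -> lnorm a x `^ a = lsum a x.
Proof. by move=> a0; rewrite -powRrM mulVf ?gt_eqF// powRr1// lsum_ge0. Qed.

Lemma lnorm_eq0 a x : 0 < a -> lnorm a x = 0 -> x = 0.
Proof.
move=> a0 N0; have : lsum a x = 0 by rewrite -lnorm_pow// N0 powR0// gt_eqF.
move=> /psumr_eq0P H; apply/rowP => j; rewrite mxE; apply/eqP; rewrite -normr_eq0; apply/eqP.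
apply: (@powR_eq0_eq0 _ _ a); apply: H => // i _; exact: powR_ge0.
Qed.

Lemma lnorm0 a : 0 < a -> lnorm a (0 : 'rV[R]_n) = 0.
Proof.
move=> a0; rewrite /lnorm big1 => [|j _].
  by rewrite powR0// invr_eq0 gt_eqF.
by rewrite mxE normr0 powR0// gt_eqF.
Qed.

Lemma lnormZ a (k : R) x : 0 < a -> lnorm a (k *: x) = `|k| * lnorm a x.
Proof.
move=> a0; rewrite /lnorm; under eq_bigr do rewrite mxE normrM powRM//.
rewrite -mulr_sumr powRM ?powR_ge0//; last exact: lsum_ge0.
by rewrite -powRrM mulfV ?gt_eqF// powRr1.
Qed.

Lemma lnormN a x : lnorm a (- x) = lnorm a x.
Proof.
by rewrite /lnorm; congr powR; apply: eq_bigr => j _; rewrite mxE normrN.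
Qed.

Lemma hoelder_conj_gt1 a b : 1 < a -> a^-1 + b^-1 = 1 -> 1 < b.
Proof.
move=> a1 ab; have ia : a^-1 < 1 by rewrite invf_lt1//; lra.
have ib0 : 0 < b^-1 by lra.
have b0 : 0 < b by rewrite -invr_gt0.
have ia0 : 0 < a^-1 by rewrite invr_gt0; lra.
by rewrite -invf_lt1//; lra.
Qed.

Lemma hoelder_conjM a b : 1 < a -> a^-1 + b^-1 = 1 -> a * b = a + b.
Proof.
move=> a1 ab; have b1 := hoelder_conj_gt1 a1 ab.
have a0 : a != 0 by rewrite gt_eqF//; lra.
have b0 : b != 0 by rewrite gt_eqF//; lra.
by have := congr1 ( *%R (a * b)) ab; rewrite mulr1 => <-; field; apply/andP.
Qed.

Lemma dotv_le_lnorm a b x y : 1 < a -> a^-1 + b^-1 = 1 ->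
  dotv x y <= lnorm a x * lnorm b y.
Proof.
move=> a1 ab; have b1 := hoelder_conj_gt1 a1 ab.
have ia : 0 < a^-1 <= 1 by rewrite invr_gt0 invf_le1; lra.
have -> : lnorm a x * lnorm b y = lsum a x `^ a^-1 * lsum b y `^ (1 - a^-1).
  by rewrite -ab addrAC subrr add0r.
apply: (le_trans _ (sum_hoelder ia (fun=> powR_ge0 _ _) (fun=> powR_ge0 _ _))).
apply: ler_sum => j _; rewrite -!powRrM mulfV ?gt_eqF//; last by lra.
have -> : 1 - a^-1 = b^-1 by rewrite -ab addrAC subrr add0r.
rewrite mulfV ?gt_eqF//; last by lra.
by rewrite !powRr1// -normrM ler_norm.
Qed.

(** Minkowski for a vector dominated entrywise, because [lnorm_sqr_smooth] needs it for the vector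
    of |y_j| + |h_j| as well as for a sum. Split w^a as w times w^(a-1) and apply Hoelder. *)
Lemma lnorm_triangle a (x y w : 'rV[R]_n) : 1 <= a ->
  (forall j, 0 <= w ord0 j <= `|x ord0 j| + `|y ord0 j|) ->
  lnorm a w <= lnorm a x + lnorm a y.
Proof.
move=> a1 wxy; have a0 : 0 < a by lra.
have ia : 0 < a^-1 <= 1 by rewrite invr_gt0 invf_le1; lra.
have [N0|Nn0] := eqVneq (lnorm a w) 0; first by rewrite N0 addr_ge0// lnorm_ge0.
have Ngt0 : 0 < lnorm a w by rewrite lt_neqAle eq_sym Nn0 lnorm_ge0.
have H (u : 'rV[R]_n) : \sum_j `|u ord0 j| * `|w ord0 j| `^ (a - 1)
    <= lnorm a u * lnorm a w `^ (a - 1).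
  have -> : lnorm a u * lnorm a w `^ (a - 1)
      = lsum a u `^ a^-1 * lsum a w `^ (1 - a^-1).
    rewrite -[in RHS](lnorm_pow w a0) -(powRrM (lnorm a w)); congr (_ * _ `^ _).
    by rewrite mulrBr mulfV ?gt_eqF// mulr1.
  apply: (le_trans _ (sum_hoelder ia (fun=> powR_ge0 _ _) (fun=> powR_ge0 _ _))).
  apply: ler_sum => j _; rewrite -!powRrM mulfV ?gt_eqF// mulrBr mulr1.
  by rewrite mulfV ?gt_eqF// powRr1.
have : lnorm a w `^ a <= (lnorm a x + lnorm a y) * lnorm a w `^ (a - 1).
  rewrite lnorm_pow// mulrDl; apply: le_trans (lerD (H x) (H y)).
  rewrite -big_split/=; apply: ler_sum => j _.
  rewrite -mulr_powRB1// -mulrDl ler_wpM2r ?powR_ge0//.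
  by have /andP[w0 wj] := wxy j; rewrite ger0_norm.
by rewrite -mulr_powRB1// ?(ltW Ngt0)// ler_pM2r// powR_gt0.
Qed.

Lemma lnormD a x y : 1 <= a -> lnorm a (x + y) <= lnorm a x + lnorm a y.
Proof.
move=> a1; pose w : 'rV[R]_n := \row_j `|(x + y) ord0 j|.
have -> : lnorm a (x + y) = lnorm a w.
  by rewrite /lnorm; congr powR; apply: eq_bigr => j _; rewrite [w _ _]mxE normr_id.
by apply: lnorm_triangle => // j; rewrite !mxE normr_ge0 ler_normD.
Qed.

(* the gradient of [lnorm a ^+ 2 / 2] *)
Definition dual_map a x : 'rV[R]_n :=
  \row_j (lnorm a x `^ (2 - a) * spow a (x ord0 j)).

Lemma dual_map0 a : dual_map a 0 = 0.
Proof. by apply/rowP => j; rewrite !mxE /spow sgr0 mul0r mulr0. Qed.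

Lemma dotvC x y : dotv x y = dotv y x.
Proof. by apply: eq_bigr => j _; rewrite mulrC. Qed.

Lemma dotvDl x y z : dotv (x + y) z = dotv x z + dotv y z.
Proof. by rewrite -big_split; apply: eq_bigr => j _; rewrite mxE mulrDl. Qed.

Lemma dotvZl c x y : dotv (c *: x) y = c * dotv x y.
Proof. by rewrite mulr_sumr; apply: eq_bigr => j _; rewrite mxE mulrA. Qed.

Lemma dotvNl x y : dotv (- x) y = - dotv x y.
Proof. by rewrite -scaleN1r dotvZl mulN1r. Qed.

Lemma dotvDr x y z : dotv x (y + z) = dotv x y + dotv x z.
Proof. by rewrite !(dotvC x) dotvDl. Qed.

Lemma dotvZr c x y : dotv x (c *: y) = c * dotv x y.
Proof. by rewrite !(dotvC x) dotvZl. Qed.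

Lemma dotvNr x y : dotv x (- y) = - dotv x y.
Proof. by rewrite !(dotvC x) dotvNl. Qed.

Definition dotvE := (dotvDl, dotvDr, dotvNl, dotvNr, dotvZl, dotvZr).

Lemma dotv_dual_map a x : 1 < a -> dotv (dual_map a x) x = lnorm a x ^+ 2.
Proof.
move=> a1; have a0 : 0 < a by lra.
transitivity (lnorm a x `^ (2 - a) * lsum a x).
  by rewrite mulr_sumr; apply: eq_bigr => j _; rewrite mxE -mulrA spow_mul.
rewrite -lnorm_pow//; have [->|Nn0] := eqVneq (lnorm a x) 0.
  by rewrite (powR0 (x := a)) ?gt_eqF// mulr0 expr0n.
by rewrite -powRD ?Nn0 ?implybT// subrK powR_mulrn// lnorm_ge0.
Qed.

Lemma lnorm_dual_map a b x : 1 < a -> a^-1 + b^-1 = 1 ->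
  lnorm b (dual_map a x) = lnorm a x.
Proof.
move=> a1 ab; have b1 := hoelder_conj_gt1 a1 ab; have abM := hoelder_conjM a1 ab.
have [N0|Nn0] := eqVneq (lnorm a x) 0.
  have x0 : x = 0 by apply: (@lnorm_eq0 a) => //; lra.
  by rewrite N0 x0 dual_map0 lnorm0//; lra.
have H : lsum b (dual_map a x) = lnorm a x `^ b.
  have -> : b = (2 - a) * b + a by rewrite mulrBl abM; ring.
  rewrite powRD ?Nn0 ?implybT// [in LHS](_ : (2 - a) * b + a = b); last first.
    by rewrite mulrBl abM; ring.
  rewrite lnorm_pow; last by lra.
  rewrite mulr_sumr; apply: eq_bigr => j _.
  rewrite mxE normrM norm_spow// powRM// [`|_ `^ (2 - a)|]ger0_norm ?powR_ge0//.
  rewrite -!powRrM; congr (_ * _ `^ _).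
  by rewrite mulrBl abM mul1r addrK.
rewrite /lnorm -/(lsum b _) H -powRrM mulfV ?powRr1 ?lnorm_ge0// gt_eqF//; lra.
Qed.

(** The duality map preserves the norm, and ab = a + b makes the exponents cancel: (a-1)(b-1) = 1 on
    a coordinate, 2 - b + (2-a)(b-1) = 0 on the norm. *)
Lemma dual_mapK a b : 1 < a -> a^-1 + b^-1 = 1 ->
  cancel (dual_map a) (dual_map b).
Proof.
move=> a1 ab x; have b1 := hoelder_conj_gt1 a1 ab; have abM := hoelder_conjM a1 ab.
apply/rowP => j; rewrite mxE (lnorm_dual_map _ a1 ab).
have [N0|Nn0] := eqVneq (lnorm a x) 0.
  have x0 : x = 0 by apply: (@lnorm_eq0 a) => //; lra.
  by rewrite x0 !dual_map0 mxE /spow sgr0 mul0r mulr0.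
have Ngt0 : 0 < lnorm a x by rewrite lt_neqAle eq_sym Nn0 lnorm_ge0.
rewrite [spow b _]/spow mxE.
rewrite sgrM (gtr0_sg (powR_gt0 (2 - a) Ngt0)) mul1r.
rewrite normrM norm_spow// [`|_ `^ (2 - a)|]ger0_norm ?powR_ge0//.
rewrite powRM ?powR_ge0// -(powRrM (lnorm a x)) -(powRrM `|x ord0 j|).
rewrite (_ : (a - 1) * (b - 1) = 1); last by move: abM; lra.
rewrite mulrCA (mulrA (lnorm a x `^ (2 - b))) -powRD ?Nn0 ?implybT//.
rewrite (_ : 2 - b + (2 - a) * (b - 1) = 0); last first.
  by move: abM; lra.
rewrite powRr0 mul1r powRr1//.
rewrite sgrM sgr_id.
have [->|xn0] := eqVneq (x ord0 j) 0; first by rewrite normr0 mulr0.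
by rewrite (gtr0_sg (powR_gt0 _ _)) ?normr_gt0// mulr1 -numEsg.
Qed.

Lemma dual_mapZ a c x : 1 < a -> 0 < c -> dual_map a (c *: x) = c *: dual_map a x.
Proof.
move=> a1 c0; apply/rowP => j; rewrite !mxE /spow lnormZ; last by lra.
rewrite sgrM normrM gtr0_sg// gtr0_norm// mul1r !powRM ?lnorm_ge0// ?ltW//.
rewrite mulrACA [X in _ = X]mulrCA mulrA.
have {3}-> : c = c `^ (2 - a) * c `^ (a - 1); last by ring.
rewrite -powRD ?(gt_eqF c0) ?implybT// (_ : 2 - a + (a - 1) = 1) ?powRr1 ?ltW//.
by ring.
Qed.

End lnorm_theory.

(** * Smoothness of the squared l_b norm for b >= 2 *)

Section smoothness.
Context {R : realType} {n : nat}.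
Implicit Types (x y z v h : 'rV[R]_n) (a b c : R).

Lemma l2normE x : l2norm x ^+ 2 = dotv x x.
Proof. by rewrite sqr_sqrtr ?sumr_ge0// => j _; exact: sqr_ge0. Qed.

Lemma l2norm_ge0 x : 0 <= l2norm x.
Proof. exact: sqrtr_ge0. Qed.

Lemma norm_le_l2norm x j : `|x ord0 j| <= l2norm x.
Proof.
rewrite -[leLHS]sqrtr_sqr ler_wsqrtr// (bigD1 j)//= lerDl sumr_ge0// => i _.
exact: sqr_ge0.
Qed.

Lemma ler_sqr_ge0 (u w : R) : 0 <= u -> u <= w -> u ^+ 2 <= w ^+ 2.
Proof. by move=> u0 uw; rewrite lerXn2r// nnegrE// (le_trans u0). Qed.

(** The eighth power of e^(1/8) <= 8/7, which follows from e^(-1/8) >= 7/8. *)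
Lemma expR_le3 : expR 1 <= 3 :> R.
Proof.
have h2 : expR (8^-1) <= 8 / 7 :> R.
  have h : 1 + - 8^-1 <= (expR (8^-1))^-1 :> R by rewrite -expRN expR_ge1Dx.
  have e0 := expR_gt0 (8^-1 : R).
  by move: h; rewrite -[leRHS]div1r ler_pdivlMr//; lra.
have -> : expR 1 = expR (8^-1) ^+ 8 :> R by rewrite -expRM_natl mulfV.
apply: (@le_trans _ _ ((8/7) ^+ 8)); last by lra.
by rewrite lerXn2r// ?nnegrE ?expR_ge0//; lra.
Qed.

Opaque lnorm.

(* The small-increment case uses concavity of [s `^ (2 / b)]; when the increment
   exceeds [lnorm b y / b] the triangle inequality already suffices. *)
Lemma lnorm_sqr_smooth b y h : 2 <= b ->
  2^-1 * lnorm b (y + h) ^+ 2 <=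
  2^-1 * lnorm b y ^+ 2 + dotv (dual_map b y) h
  + 9 / 2 * (b - 1) * lnorm b h ^+ 2.
Proof.
move=> b2; have [b0 b1 b20] : [/\ 0 < b, 1 < b & 0 <= b - 2] by split; slra.
have tri : lnorm b (y + h) <= lnorm b y + lnorm b h by rewrite lnormD// ltW.
have := lnorm_ge0 b h; have := lnorm_ge0 b y; move: tri.
set N := lnorm b y; set M := lnorm b h => tri N0 M0.
have eN : lnorm b y = N := erefl. have eM : lnorm b h = M := erefl.
clearbody N M.
have [Nz|Nn0] := eqVneq N 0.
  have y0 : y = 0 by exact: (lnorm_eq0 b0 (etrans eN Nz)).
  rewrite Nz y0 dual_map0 add0r eM.
  have -> : dotv 0 h = 0 by rewrite -(scale0r h) dotvZl mul0r.
  have h1 : 0 <= (b - 2) * M ^+ 2 by exact: mulr_ge0 b20 (sqr_ge0 M).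
  by have h2 := sqr_ge0 M; rewrite expr0n/=; clear -h1 h2; slra.
have Ngt0 : 0 < N by rewrite lt_neqAle eq_sym Nn0 N0.
pose a := (1 - b^-1)^-1.
have ib1 : b^-1 < 1 by rewrite invf_lt1.
have a1 : 1 < a by rewrite /a -[X in X < _]invr1 ltf_pV2 ?posrE//; [have : 0 < b^-1 by rewrite invr_gt0|]; slra.
have ab : b^-1 + a^-1 = 1 by rewrite /a invrK; slra.
have dle : - (N * M) <= dotv (dual_map b y) h.
  rewrite lerNl -dotvNr -eN -eM -(lnormN b h) -(lnorm_dual_map y b1 ab).
  by apply: dotv_le_lnorm => //; rewrite addrC.
(* The constant 9/2 is fixed by the large increments: there 2 N M + M^2 / 2 <= (2 b + 1/2) M^2,
   which equals 9/2 (b - 1) M^2 at b = 2. The small increments give 3 (b - 1) M^2. *)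
have [MN|MN] := ltP (N / b) M.
  rewrite ltr_pdivrMr// in MN.
  have h3 : lnorm b (y + h) ^+ 2 <= (N + M) ^+ 2.
    exact: ler_sqr_ge0 (lnorm_ge0 _ _) tri.
  have h2 : N * M <= M * b * M by exact: (ler_wpM2r M0 (ltW MN)).
  have h1 : 0 <= (b - 2) * M ^+ 2 by exact: mulr_ge0 b20 (sqr_ge0 M).
  clear -dle h1 h2 h3. slra.
set D := dotv _ _ in dle *.
have key : lsum b (y + h) <= N `^ b + b * N `^ (b - 2) * D
   + b * (b - 1) * (M ^+ 2 * (N + M) `^ (b - 2)).
  have Hj j : `|(y + h) ord0 j| `^ b <= `|y ord0 j| `^ b
     + b * spow b (y ord0 j) * h ord0 j + b * (b - 1) * (h ord0 j ^+ 2
       * (`|y ord0 j| + `|h ord0 j|) `^ (b - 2)).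
    by rewrite mxE; exact: norm_powR_upper.
  apply: (le_trans (ler_sum _ (fun j _ => Hj j))).
  rewrite !big_split/= -/(lsum b y) -lnorm_pow// eN; apply: lerD.
    rewrite lerD2l /D /dotv mulr_sumr; apply: ler_sum => j _.
    rewrite mxE eN.
    have e3 : N `^ (b - 2) * N `^ (2 - b) = 1.
      by rewrite -powRD ?Nn0 ?implybT// (_ : b - 2 + (2 - b) = 0) ?powRr0//; ring.
    rewrite [leRHS](_ : _ = N `^ (b - 2) * N `^ (2 - b)
      * (b * spow b (y ord0 j) * h ord0 j)); last by ring.
    by rewrite e3 mul1r.
  rewrite -mulr_sumr ler_wpM2l//; first by rewrite mulr_ge0//; slra.
  pose w : 'rV[R]_n := \row_j (`|y ord0 j| + `|h ord0 j|).
  have wj j : 0 <= w ord0 j by rewrite mxE addr_ge0.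
  have i2b : 0 < 2 / b <= 1 by rewrite divr_gt0// ler_pdivrMr//; slra.
  have b2b : b * (2 / b) = 2 by rewrite mulrCA mulfV ?mulr1// gt_eqF.
  have e2 : b * (1 - 2 / b) = b - 2 by rewrite mulrBr b2b mulr1.
  (* Hoelder with weights 2/b and 1 - 2/b on the remainder of [norm_powR_upper]. *)
  have h1 : \sum_j h ord0 j ^+ 2 * (`|y ord0 j| + `|h ord0 j|) `^ (b - 2)
      <= M ^+ 2 * lnorm b w `^ (b - 2).
    have -> : M ^+ 2 = lsum b h `^ (2 / b).
      by rewrite -lnorm_pow// -powRrM b2b eM powR_mulrn.
    have -> : lnorm b w `^ (b - 2) = lsum b w `^ (1 - 2 / b).
      by rewrite -e2 powRrM lnorm_pow.
    apply: (le_trans _ (sum_hoelder i2b (fun=> powR_ge0 _ _) (fun=> powR_ge0 _ _))).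
    apply: ler_sum => j _.
    rewrite -!powRrM b2b e2 powR_mulrn// real_normK ?num_real//.
    by rewrite (ger0_norm (wj j)) mxE.
  have wNM : lnorm b w <= N + M.
    rewrite -eN -eM; apply: lnorm_triangle => [|j]; first exact: ltW.
    by apply/andP; split; [exact: wj|rewrite mxE].
  by apply: (le_trans h1); apply: (ler_wpM2l (sqr_ge0 M)); exact: (powR_le_mono b20 (lnorm_ge0 _ _) wNM).
have s01 : 0 <= 2 / b <= 1 by rewrite divr_ge0// ?ler_pdivrMr//; slra.
have Nb : 0 < N `^ b by rewrite powR_gt0.
(* The squared norm is the power 2/b of [lsum b]; its tangent at N^b converts the bound [key] on the
   sum into one on the squared norm. *)
have := powR_concave_tangent s01 Nb (lsum_ge0 b (y + h)).
have b2b : b * (2 / b) = 2 by rewrite mulrCA mulfV ?mulr1// gt_eqF.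
rewrite -!(powRrM N) b2b powR_mulrn// (mulrBr b) b2b mulr1.
have -> : lsum b (y + h) `^ (2 / b) = lnorm b (y + h) ^+ 2.
  by rewrite -lnorm_pow// -powRrM b2b powR_mulrn ?lnorm_ge0.
move=> h2.
have c0 : 0 <= 2 / b * N `^ (2 - b) by rewrite mulr_ge0 ?powR_ge0// divr_ge0//; slra.
have h3 := le_trans h2 (lerD (lexx (N ^+ 2)) (ler_wpM2l c0 (lerB key (lexx (N `^ b))))).
have e3 : N `^ (2 - b) * N `^ (b - 2) = 1.
  by rewrite -powRD ?Nn0 ?implybT// (_ : 2 - b + (b - 2) = 0) ?powRr0//; ring.
(* Since M <= N / b, the ratio (1 + M/N)^(b-2) is at most exp((b-2)/b) <= e <= 3, uniformly in b. *)
have h4 : N `^ (2 - b) * (N + M) `^ (b - 2) <= 3.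
  have -> : N + M = N * (1 + M / N) by rewrite mulrDr mulr1 mulrCA mulfV// mulr1.
  have MN0 : 0 <= M / N by rewrite divr_ge0.
  rewrite powRM//; last by slra.
  rewrite mulrA e3 mul1r.
  apply: (@le_trans _ _ (expR (b * b^-1))); last first.
    by rewrite mulfV ?gt_eqF// expR_le3.
  have hx : 1 + M / N <= expR (b^-1).
    apply: le_trans (expR_ge1Dx _); rewrite lerD2l ler_pdivrMr// mulrC//.
  apply: (@le_trans _ _ (expR b^-1 `^ (b - 2))).
    by rewrite powR_le_mono//; slra.
  by rewrite -expRM ler_expR mulrC ler_wpM2r ?invr_ge0//; slra.
have h5 : 2 / b * N `^ (2 - b) * (N `^ b + b * N `^ (b - 2) * D +
     b * (b - 1) * (M ^+ 2 * (N + M) `^ (b - 2)) - N `^ b)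
   = 2 * D + 2 * (b - 1) * M ^+ 2 * (N `^ (2 - b) * (N + M) `^ (b - 2)).
  have -> : 2 * D = 2 * (N `^ (2 - b) * N `^ (b - 2)) * D by rewrite e3 mulr1.
  by field; rewrite gt_eqF.
rewrite h5 in h3.
have : (b - 1) * M ^+ 2 * (N `^ (2 - b) * (N + M) `^ (b - 2))
    <= (b - 1) * M ^+ 2 * 3.
  by rewrite ler_wpM2l// mulr_ge0 ?sqr_ge0//; slra.
have : 0 <= (b - 1) * M ^+ 2 by rewrite mulr_ge0 ?sqr_ge0//; slra.
move: h3; clear; set X := _ `^ _ * _ `^ _; slra.
Qed.

Transparent lnorm.

Lemma lnorm_le_l2norm b x : 2 <= b -> lnorm b x <= l2norm x.
Proof.
move=> b2; have b0 : 0 < b by slra.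
have L0 := l2norm_ge0 x.
apply: (@le_trans _ _ ((l2norm x `^ b) `^ b^-1)); last first.
  by rewrite -powRrM mulfV ?gt_eqF// powRr1.
apply: powR_le_mono; rewrite ?invr_ge0 ?lsum_ge0//; first by slra.
have -> : l2norm x `^ b = l2norm x ^+ 2 * l2norm x `^ (b - 2).
  rewrite -powR_mulrn// -powRD; first by rewrite subrKC.
  by rewrite subrKC gt_eqF.
rewrite l2normE mulr_suml; apply: ler_sum => j _.
rewrite -[_ * x ord0 j]expr2 -real_normK ?num_real//.
have -> : `|x ord0 j| `^ b = `|x ord0 j| ^+ 2 * `|x ord0 j| `^ (b - 2).
  by rewrite -powR_mulrn// -powRD ?subrKC// gt_eqF.
rewrite ler_wpM2l ?sqr_ge0// powR_le_mono//; first by slra.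
exact: norm_le_l2norm.
Qed.

End smoothness.

(** * The gradient of the squared l_a norm for 1 < a <= 2 *)

Section gradients.
Context {R : realType} {n : nat}.
Implicit Types (x y z v h : 'rV[R]_n) (a b c r : R).

(** A quantitative bound on difference quotients stands in for differentiation rules, both for the
    squared norm and for the objective. *)
Lemma derive_of_bound (f : 'rV[R]_n -> R) x v (l : R) (w : R -> R) :
  (forall s, s != 0 -> `|s^-1 * (f (s *: v + x) - f x) - l| <= w s) ->
  w s @[s --> 0] --> 0 -> 'D_v f x = l.
Proof.
move=> fw w0; apply: cvg_lim => //; apply/cvgrPdist_le => e e0.
have w0' : w s @[s --> 0^'] --> 0 by apply: cvg_within_filter w0.
move/cvgrPdist_le : w0' => /(_ _ e0) we; near=> s.
have sn0 : s != 0 by near: s; exact: nbhs_dnbhs_neq.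
rewrite distrC; apply: (le_trans (fw s sn0)).
have : `|0 - w s| <= e by near: s.
by rewrite sub0r normrN; apply: le_trans; exact: ler_norm.
Unshelve. all: by end_near. Qed.

Lemma norm_powR_continuous r : 0 <= r -> continuous (fun x : R => `|x| `^ r).
Proof.
rewrite le_eqVlt => /predU1P[<-|r0] x.
  by under eq_fun do rewrite powRr0; exact: cvg_cst.
have [->|xn0] := eqVneq x 0.
  apply/cvgrPdist_lt => e e0; near=> t.
  rewrite normr0 powR0 ?gt_eqF// sub0r normrN ger0_norm ?powR_ge0//.
  have -> : e = (e `^ r^-1) `^ r by rewrite -powRrM mulVf ?gt_eqF// powRr1// ltW.
  rewrite gt0_ltr_powR ?nnegrE ?powR_ge0//.
  have : `|0 - t| < e `^ r^-1.
    by near: t; apply: cvgr_dist_lt; rewrite ?powR_gt0//; exact: cvg_id.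
  by rewrite sub0r normrN.
have H : {for `|x|, continuous (fun k : R => k `^ r)}.
  apply: differentiable_continuous; apply/derivable1_diffP.
  by apply: derivable_powR; rewrite in_itv/= andbT normr_gt0.
exact: (cvg_comp _ _ (@norm_continuous _ _ x) H).
Unshelve. all: by end_near. Qed.

Lemma cvg_powR_ge0 (f : R -> R) (t l r : R) : 0 <= r -> (forall s, 0 <= f s) ->
  0 <= l -> f s @[s --> t] --> l -> f s `^ r @[s --> t] --> l `^ r.
Proof.
move=> r0 f0 l0 fl; rewrite -(ger0_norm l0).
under eq_fun => s do rewrite -(ger0_norm (f0 s)).
exact: (cvg_comp _ _ fl (@norm_powR_continuous _ r0 _)).
Qed.

Lemma spow_continuous a : 1 < a -> continuous (@spow R a).
Proof.
move=> a1 x; have a10 : 0 <= a - 1 by lra.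
have [->|xn0] := eqVneq x 0.
  apply/cvgrPdist_lt => e e0.
  have /cvgrPdist_lt/(_ _ e0) := @norm_powR_continuous (a - 1) a10 (0 : R).
  rewrite normr0 powR0; last by rewrite gt_eqF//; lra.
  apply: filterS => t; rewrite !sub0r !normrN => h.
  rewrite {1}/spow sgr0 mul0r sub0r normrN norm_spow//.
  by move: h; rewrite ger0_norm ?powR_ge0.
have sgc : Num.sg t @[t --> x] --> Num.sg x.
  have [x0|x0] := ltP 0 x.
    apply: near_cst_continuous; near=> t.
    by rewrite !gtr0_sg//; near: t; apply: lt_nbhsr.
  have x00 : x < 0 by rewrite lt_neqAle xn0.
  apply: near_cst_continuous; near=> t.
  by rewrite !ltr0_sg//; near: t; apply: lt_nbhsl.
by apply: cvgM => //; exact: norm_powR_continuous.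
Unshelve. all: by end_near. Qed.

Lemma dual_map_cvg a z (j : 'I_n) : 1 < a -> a <= 2 ->
  dual_map a (s *: delta_mx ord0 j + z) ord0 j @[s --> 0] --> dual_map a z ord0 j.
Proof.
move=> a1 a2; under eq_fun do rewrite mxE; rewrite mxE.
have c0 (i : 'I_n) : (s *: delta_mx ord0 j + z) ord0 i @[s --> 0] --> z ord0 i.
  under eq_fun do rewrite !mxE.
  pose k : R := ((ord0 == ord0 :> 'I_1) && (i == j))%:R.
  suff : s * k + z ord0 i @[s --> 0] --> 0 * k + z ord0 i by rewrite mul0r add0r.
  by apply: cvgD; [apply: cvgM; [exact: cvg_id|exact: cvg_cst]|exact: cvg_cst].
apply: cvgM; last first.
  exact: (cvg_comp _ _ (c0 j) (@spow_continuous _ a1 _)).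
have csum : lsum a (s *: delta_mx ord0 j + z) @[s --> 0] --> lsum a z.
  apply: (cvg_big (op := +%R)) => [|i _]; first exact: add_continuous.
  have a0 : 0 <= a by lra.
  exact: (cvg_comp _ _ (c0 i) (@norm_powR_continuous _ a0 _)).
have ia0 : 0 <= a^-1 by rewrite invr_ge0; lra.
have a20 : 0 <= 2 - a by lra.
apply: (cvg_powR_ge0 a20 (fun s => lnorm_ge0 _ _) (lnorm_ge0 _ _)).
exact: (cvg_powR_ge0 ia0 (fun s => lsum_ge0 _ _) (lsum_ge0 _ _) csum).
Qed.

(** Hoelder gives <dual_map x, x + h> <= |x| |x + h|, and the square of |x + h| - |x| finishes. *)
Lemma lnorm_sqr_convex a b x h : 1 < a -> a^-1 + b^-1 = 1 ->
  2^-1 * lnorm a x ^+ 2 + dotv (dual_map a x) h <= 2^-1 * lnorm a (x + h) ^+ 2.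
Proof.
move=> a1 ab; have := dotv_le_lnorm (x + h) (dual_map a x) a1 ab.
rewrite (lnorm_dual_map _ a1 ab) dotvDl [dotv x _]dotvC [dotv h _]dotvC.
rewrite dotv_dual_map// => h1.
have := sqr_ge0 (lnorm a (x + h) - lnorm a x).
by slra.
Qed.

Lemma dotv_delta x (s : R) j : dotv x (s *: delta_mx ord0 j) = s * x ord0 j.
Proof.
rewrite /dotv (bigD1 j)//= big1 ?addr0 => [|i ij].
  by rewrite !mxE !eqxx mulr1 mulrC.
by rewrite !mxE (negPf ij) mulr0 mulr0.
Qed.

(** J and K are subgradients at the two ends of the increment: for a convex function the difference
    quotient lies between them. *)
Lemma slope_between (A B J K s : R) : s != 0 ->
  A + s * J <= B -> B - s * K <= A -> `|s^-1 * (B - A) - J| <= `|K - J|.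
Proof.
move=> s0 h1 h2; have hB1 : s * J <= B - A by lra.
have hB2 : B - A <= s * K by lra.
have [sp|sp] := ltP 0 s.
  have e1 : J <= s^-1 * (B - A) by rewrite mulrC ler_pdivlMr// mulrC.
  have e2 : s^-1 * (B - A) <= K by rewrite mulrC ler_pdivrMr// mulrC.
  by rewrite !ger0_norm; lra.
have sn : s < 0 by rewrite lt_neqAle s0.
have e1 : s^-1 * (B - A) <= J by rewrite mulrC ler_ndivrMr// mulrC.
have e2 : K <= s^-1 * (B - A) by rewrite mulrC ler_ndivlMr// mulrC.
by rewrite !ler0_norm; lra.
Qed.

(** A convex function with a continuous subgradient selection is differentiated by it. This treats
    the origin and zero coordinates like all other points, where a chain rule through powers would
    not. *)
Lemma grad_lnorm_sqr a b c z : 1 < a -> a <= 2 -> a^-1 + b^-1 = 1 ->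
  grad (fun x => c * (2^-1 * lnorm a x ^+ 2)) z = c *: dual_map a z.
Proof.
move=> a1 a2 ab; apply/rowP => j; rewrite [LHS]mxE [RHS]mxE.
apply: (@derive_of_bound _ z _ _ (fun s => `|c|
  * `|dual_map a (s *: delta_mx ord0 j + z) ord0 j - dual_map a z ord0 j|)).
  move=> s s0; rewrite -mulrBr mulrCA -mulrBr normrM ler_wpM2l//.
  have h1 := lnorm_sqr_convex z (s *: delta_mx ord0 j) a1 ab.
  have h2 := lnorm_sqr_convex (z + s *: delta_mx ord0 j)
    (- (s *: delta_mx ord0 j)) a1 ab.
  rewrite dotv_delta in h1; rewrite addrK dotvNr dotv_delta in h2.
  by rewrite (addrC (s *: delta_mx ord0 j) z); exact: (slope_between s0 h1 h2).
set J := dual_map a z ord0 j.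
suff : `|c| * `|dual_map a (s *: delta_mx ord0 j + z) ord0 j - J| @[s --> 0]
    --> `|c| * `|J - J| by rewrite subrr normr0 mulr0.
apply: cvgM; first exact: cvg_cst.
by apply: cvg_norm; apply: cvgB; [exact: dual_map_cvg|exact: cvg_cst].
Qed.

End gradients.

(** * Mirror maps and Bregman divergences *)

Section mirror_map.
Context {R : realType} {n : nat} (a b c : R).
Hypotheses (a1 : 1 < a) (a2 : a <= 2) (b2 : 2 <= b).
Hypotheses (ab : a^-1 + b^-1 = 1) (c0 : 0 < c).
Implicit Types (x y z u v h g : 'rV[R]_n).

Let b1 : 1 < b. Proof. by apply: lt_le_trans b2; rewrite ltr1n. Qed.
Let ba : b^-1 + a^-1 = 1. Proof. by rewrite addrC. Qed.

Definition potential x : R := c * (2^-1 * lnorm a x ^+ 2).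
(** The convex conjugate of [potential]; [mirror] and [comirror] are the gradients of the two, hence
    mutually inverse. *)
Definition copotential y : R := c^-1 * (2^-1 * lnorm b y ^+ 2).
Definition mirror z := c *: dual_map a z.
Definition comirror y := c^-1 *: dual_map b y.
Definition divergence z x : R := potential x - potential z - dotv (mirror z) (x - z).

Lemma grad_potential z : grad potential z = mirror z.
Proof. exact: (grad_lnorm_sqr c z a1 a2 ab). Qed.

Lemma mirrorK : cancel mirror comirror.
Proof.
move=> z; rewrite /comirror /mirror (dual_mapZ _ b1 c0) (dual_mapK a1 ab).
by rewrite scalerA mulVf ?scale1r// gt_eqF.
Qed.

Lemma comirrorK : cancel comirror mirror.
Proof.
have c0' : 0 < c^-1 by rewrite invr_gt0.
move=> z; rewrite /comirror /mirror (dual_mapZ _ a1 c0') (dual_mapK b1 ba).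
by rewrite scalerA mulfV ?scale1r// gt_eqF.
Qed.

(** In this form z enters only through [mirror z], so a step of the method is an increment of the
    argument of [copotential]. *)
Lemma divergenceE z u :
  divergence z u = potential u + copotential (mirror z) - dotv (mirror z) u.
Proof.
rewrite /divergence /copotential /mirror !dotvE dotv_dual_map//.
rewrite (lnormZ _ _ (lt_trans ltr01 b1)) (lnorm_dual_map _ a1 ab) gtr0_norm//.
rewrite exprMn /potential; hide_sums; field.
by rewrite gt_eqF.
Qed.

Lemma divergencexx z : divergence z z = 0.
Proof. by rewrite /divergence !subrr add0r -(scale0r z) dotvZr mul0r oppr0. Qed.

Lemma fenchel_young y u : dotv y u <= potential u + copotential y.
Proof.
apply: (le_trans (dotv_le_lnorm y u b1 ba)); rewrite /potential /copotential.
generalize (lnorm b y) (lnorm a u) => l l0.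
have : 0 <= 2^-1 * c^-1 * (l - c * l0) ^+ 2.
  by rewrite mulr_ge0 ?sqr_ge0// mulr_ge0 ?invr_ge0 ?(ltW c0).
rewrite (_ : _ * _ ^+ 2 = c * (2^-1 * l0 ^+ 2) + c^-1 * (2^-1 * l ^+ 2) - l * l0).
  by rewrite subr_ge0.
by field; rewrite gt_eqF.
Qed.

Lemma copotential_smooth y h :
  copotential (y + h) <= copotential y + dotv (comirror y) h
    + 9 / 2 * ((b - 1) / c) * lnorm b h ^+ 2.
Proof.
have c0' : 0 < c^-1 by rewrite invr_gt0.
have := ler_wpM2l (ltW c0') (lnorm_sqr_smooth y h b2).
rewrite /copotential /comirror !dotvE => /le_trans; apply.
by hide_sums; lra.
Qed.

(** Smoothness of the conjugate implies strong convexity: insert [mirror z] + h into Fenchel-Young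
    and let h be proportional to u - z. The Euclidean norm enters because it dominates the
    b-norm. *)
Lemma l2norm_divergence z u : (b - 1) / c <= 1 ->
  l2norm (u - z) ^+ 2 <= 18 * divergence z u.
Proof.
move=> bc; rewrite divergenceE; set y := mirror z.
(* The factor 1/9 maximises s - 9 s^2 / 2, with value 1/18. *)
pose h := 9^-1 *: (u - z).
have F := fenchel_young (y + h) u.
have S := copotential_smooth y h.
rewrite mirrorK in S.
have Q : 9 / 2 * ((b - 1) / c) * lnorm b h ^+ 2 <= 9 / 2 * (81^-1 * l2norm (u - z) ^+ 2).
  have -> : 81^-1 * l2norm (u - z) ^+ 2 = l2norm h ^+ 2.
    rewrite !l2normE /h dotvZl dotvZr mulrA; congr (_ * _).
    by rewrite -invfM -natrM.
  have := ler_sqr_ge0 (lnorm_ge0 _ _) (lnorm_le_l2norm h b2).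
  have : 0 <= (b - 1) / c by rewrite divr_ge0 ?subr_ge0 ?(ltW b1) ?(ltW c0).
  move: bc; set k := (b - 1) / c => k1 k0 hh.
  rewrite -mulrA ler_wpM2l//.
  by apply: (le_trans (ler_wpM2l k0 hh)); rewrite ler_piMl// sqr_ge0.
have E : dotv h u - dotv z h = 9^-1 * l2norm (u - z) ^+ 2.
  by rewrite l2normE /h !dotvE (dotvC z u); ring.
rewrite dotvDl in F; move: F S Q E; clear.
set p := potential u; set p1 := copotential y; set p2 := copotential (y + h).
clearbody p p1 p2; set k := _ * lnorm b h ^+ 2; clearbody k; clearbody y.
by move=> F S Q E; slra.
Qed.

(** Up to a constant the prox objective is the divergence from w, the candidate point, where it
    vanishes; by strong convexity any minimizer coincides with w. *)
Lemma prox_step_eq z g (s : R) x' : (b - 1) / c <= 1 ->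
  is_minimizer (fun y => s * dotv g (y - z) + divergence z y) x' ->
  x' = comirror (mirror z - s *: g).
Proof.
move=> bc /(_ (comirror (mirror z - s *: g))).
set y' := mirror z - s *: g; set w := comirror y' => H.
have Gw : mirror w = y' by rewrite comirrorK.
have E u : s * dotv g (u - z) + divergence z u =
    divergence w u + (copotential (mirror z) - copotential y' - s * dotv g z).
  rewrite !divergenceE Gw /y' !dotvE.
    generalize (potential u) (copotential (mirror z)) (copotential (mirror z - s *: g)).
    by hide_sums => p q r; ring.
rewrite !E lerD2r divergencexx in H.
have := l2norm_divergence w x' bc => L.
have : dotv (x' - w) (x' - w) <= 0 by rewrite -l2normE; apply: le_trans L _; nra.
move=> D0; apply/rowP => j; apply/eqP; rewrite -subr_eq0.
have := norm_le_l2norm (x' - w) j; rewrite !mxE => N.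
rewrite -normr_eq0 eq_le normr_ge0 andbT (le_trans N)//.
have : l2norm (x' - w) ^+ 2 <= 0 by rewrite l2normE.
rewrite le_eqVlt ltNge sqr_ge0 orbF sqrf_eq0 => /eqP ->; exact: lexx.
Qed.

(** Smoothness of [copotential] at [mirror z] for the increment -s g, where its gradient is z
    itself. *)
Lemma divergence_step z g u (s : R) :
  divergence (comirror (mirror z - s *: g)) u <=
  divergence z u - s * dotv g (z - u)
    + 9 / 2 * ((b - 1) / c) * (s ^+ 2 * lnorm b g ^+ 2).
Proof.
rewrite !divergenceE comirrorK.
have := copotential_smooth (mirror z) (- (s *: g)); rewrite mirrorK lnormN.
rewrite (lnormZ _ _ (lt_trans ltr01 b1)) exprMn real_normK ?num_real//.
rewrite !dotvE (dotvC z g).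
set k := 9 / 2 * ((b - 1) / c); set p := copotential _; set q := copotential _.
set r := potential u; clearbody k p q r.
by move=> H; slra.
Qed.

End mirror_map.

(** * The parameters of the two prox-functions *)

Section prox_parameters.
Context {R : realType} {n : nat}.

(** The value 3/2 matters in [sup_weight], where 6 (l + 1) <= 16 l - 8 requires l >= 7/5. *)
Lemma ln_ge32 : (8 <= n)%N -> 3 / 2 <= ln n%:R :> R.
Proof.
move=> n8; rewrite -[3 / 2]expRK.
rewrite ler_ln ?posrE ?expR_gt0 ?ltr0n//; last exact: leq_trans n8.
apply: (@le_trans _ _ 8); last by rewrite ler_nat.
have -> : expR (3 / 2) = expR 2^-1 ^+ 3 :> R.
  by rewrite -expRM_natl; congr expR; lra.
have : expR 2^-1 ^+ 2 <= 3 :> R.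
  by apply: le_trans expR_le3; rewrite -expRM_natl mulfV.
by have := expR_gt0 (2^-1 : R); set y := expR _; clearbody y; nra.
Qed.

Lemma lnorm2E (x : 'rV[R]_n) : lnorm 2 x = l2norm x.
Proof.
rewrite /lnorm powR12_sqrt; last exact: lsum_ge0.
congr Num.sqrt; apply: eq_bigr => j _.
by rewrite powR_mulrn// real_normK// num_real.
Qed.

Lemma prox2E : prox 2 = potential 2 1 :> ('rV[R]_n -> R).
Proof. by apply/funext => x; rewrite /prox/= /potential lnorm2E mul1r. Qed.

Definition prox1_coef : R :=
  expR 1 * n%:R `^ ((prox_kappa n - 1) * (2 - prox_kappa n) / prox_kappa n) * ln n%:R.

Lemma prox1E : prox 1 = potential (prox_kappa n) prox1_coef :> ('rV[R]_n -> R).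
Proof.
apply/funext => x; rewrite /prox/= /potential /prox1_coef; move: (lnorm _ _) => l.
by set k := _ `^ _; ring.
Qed.

Lemma conj_exp_prox1 : (8 <= n)%N -> (prox_kappa n)^-1 + (1 + ln n%:R)^-1 = 1 :> R.
Proof.
move=> /ln_ge32; rewrite /prox_kappa; set l := ln _; clearbody l => l0.
have -> : 1 + l^-1 = (l + 1) / l by field; rewrite gt_eqF//; lra.
by rewrite invf_div; field; rewrite gt_eqF//; lra.
Qed.

Lemma prox1_coef_gt0 : (8 <= n)%N -> 0 < prox1_coef.
Proof.
move=> n8; have := ln_ge32 n8 => l0; have n0 : (0 < n)%N by exact: leq_trans n8.
rewrite /prox1_coef !mulr_gt0 ?expR_gt0 ?powR_gt0 ?ltr0n//; lra.
Qed.

(** The prefactor of the prox-function is calibrated for this. With b = 1 + ln n one has |e|_b^2 <=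
    n^(2/b) |e|_oo^2, so (b - 1) / c |e|_b^2 is at most the squared sup norm. *)
Lemma prox1_coefE : (8 <= n)%N -> ln n%:R / prox1_coef * n%:R `^ (2 / (1 + ln n%:R)) = 1.
Proof.
move=> n8; have := ln_ge32 n8 => l0; have n0 : (0 < n)%N by exact: leq_trans n8.
have nR : 0 < n%:R :> R by rewrite ltr0n.
have -> : prox1_coef = ln n%:R * n%:R `^ (2 / (1 + ln n%:R)).
  rewrite /prox1_coef mulrC; congr (_ * _).
  (* Writing e as n^(1 / ln n) merges it into the power of n: the exponents add up to 2 / (1 + ln
     n). *)
  have -> : expR 1 = n%:R `^ (ln n%:R)^-1 :> R.
    by rewrite /powR gt_eqF// mulVf// gt_eqF//; lra.
  rewrite -powRD ?(gt_eqF nR) ?implybT//; congr (_ `^ _).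
  rewrite /prox_kappa; move: l0; set l := ln _; clearbody l => l0.
  by field; rewrite !gt_eqF//; lra.
by field; rewrite !gt_eqF// ?powR_gt0//; lra.
Qed.

Lemma prox1_coef_le1 : (8 <= n)%N -> ln n%:R / prox1_coef <= 1.
Proof.
move=> n8; have := ln_ge32 n8 => l0; have n0 : (0 < n)%N by exact: leq_trans n8.
have c0 := prox1_coef_gt0 n8.
rewrite -[leRHS](prox1_coefE n8) ler_peMr ?divr_ge0 ?(ltW c0)//; first by lra.
rewrite -[leLHS](powRr0 n%:R) ler_powR ?ler1n// divr_ge0//; lra.
Qed.

End prox_parameters.

(** * Measurability and integration of row vectors *)

Section rV_measurability.
Context {d d' : measure_display} {S : measurableType d'} {T : measurableType d}.
Context {n : nat}.

Lemma measurable_rV_coord (j : 'I_n) :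
  measurable_fun setT (fun x : 'rV[T]_n => x ord0 j).
Proof.
move=> _ Y mY; rewrite setTI; apply: sub_sigma_algebra => /=.
rewrite -bigcup_seq/=; exists j => /=; first by rewrite mem_index_enum.
by exists Y => //; rewrite setTI.
Qed.

Lemma measurable_fun_rV (f : S -> 'rV[T]_n) :
  (forall j, measurable_fun setT (fun s => f s ord0 j)) -> measurable_fun setT f.
Proof.
move=> mf; have : g_sigma_preimage (fun j => @rV_coord _ T n j \o f)
    `<=` measurable.
  apply: smallest_sub; first exact: sigma_algebra_measurable.
  rewrite -bigcup_seq/=; apply: bigcup_sub => j _ A [B mB <-].
  exact: (mf j measurableT).
rewrite g_sigma_preimage_comp => H _ A mA.
by rewrite setTI; apply: H; exists A => //; rewrite setTI.
Qed.

End rV_measurability.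

Section rV_measurable_ops.
Context {R : realType} {d : measure_display} {S : measurableType d} {n : nat}.
Implicit Types f g : S -> 'rV[R]_n.

Lemma measurable_coord f j : measurable_fun setT f ->
  measurable_fun setT (fun s => f s ord0 j).
Proof.
by move=> mf; exact: (measurableT_comp (measurable_rV_coord j) mf).
Qed.

Lemma measurable_rV_add f g : measurable_fun setT f -> measurable_fun setT g ->
  measurable_fun setT (fun s => f s + g s).
Proof.
move=> mf mg; apply: measurable_fun_rV => j; under eq_fun do rewrite mxE.
by apply: measurable_funD; exact: measurable_coord.
Qed.

Lemma measurable_rV_scale (c : S -> R) g : measurable_fun setT c ->
  measurable_fun setT g -> measurable_fun setT (fun s => c s *: g s).
Proof.
move=> mc mg; apply: measurable_fun_rV => j; under eq_fun do rewrite mxE.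
by apply: measurable_funM => //; exact: measurable_coord.
Qed.

Lemma measurable_rV_opp g : measurable_fun setT g ->
  measurable_fun setT (fun s => - g s).
Proof.
move=> mg; under eq_fun do rewrite -scaleN1r.
by apply: measurable_rV_scale => //; exact: measurable_cst.
Qed.

Lemma measurable_rV_sub f g : measurable_fun setT f -> measurable_fun setT g ->
  measurable_fun setT (fun s => f s - g s).
Proof. by move=> mf mg; apply: measurable_rV_add => //; exact: measurable_rV_opp. Qed.

Lemma measurable_rV_sum (I : Type) (r : seq I) (f : I -> S -> 'rV[R]_n) :
  (forall i, measurable_fun setT (f i)) ->
  measurable_fun setT (fun s => \sum_(i <- r) f i s).
Proof.
move=> mf; apply: measurable_fun_rV => j; under eq_fun do rewrite summxE.
by apply: measurable_sum => i; exact: measurable_coord.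
Qed.

Lemma measurable_dotv f g : measurable_fun setT f -> measurable_fun setT g ->
  measurable_fun setT (fun s => dotv (f s) (g s)).
Proof.
move=> mf mg; apply: measurable_sum => j.
by apply: measurable_funM; exact: measurable_coord.
Qed.

Lemma measurable_l2norm_sqr f : measurable_fun setT f ->
  measurable_fun setT (fun s => l2norm (f s) ^+ 2).
Proof. by move=> mf; under eq_fun do rewrite l2normE; exact: measurable_dotv. Qed.

Lemma measurable_powR_comp (r : R) (h : S -> R) : measurable_fun setT h ->
  measurable_fun setT (fun s => h s `^ r).
Proof. by move=> mh; exact: (measurableT_comp (measurable_powR r) mh). Qed.

Lemma measurable_lnorm (a : R) f : measurable_fun setT f ->
  measurable_fun setT (fun s => lnorm a (f s)).
Proof.
move=> mf; apply: measurable_powR_comp; apply: measurable_sum => j.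
apply: measurable_powR_comp; apply: measurableT_comp => //.
exact: measurable_coord.
Qed.

Lemma measurable_sgr : measurable_fun setT (@Num.sg R).
Proof.
rewrite (_ : Num.sg = fun x : R => \1_`]0, +oo[ x - \1_`]-oo, 0[ x).
  by apply: measurable_funB; exact: measurable_indic.
apply/funext => x; rewrite !indicE !mem_setE !in_itv/= andbT.
by case: sgrP => /= _; rewrite ?subrr ?subr0 ?sub0r.
Qed.

Lemma measurable_dual_map (a : R) f : measurable_fun setT f ->
  measurable_fun setT (fun s => dual_map a (f s)).
Proof.
move=> mf; apply: measurable_fun_rV => j; under eq_fun do rewrite mxE.
apply: measurable_funM; first exact/measurable_powR_comp/measurable_lnorm.
have mj := measurable_coord j mf.
apply: measurable_funM; first exact: measurableT_comp measurable_sgr mj.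
by apply: measurable_powR_comp; exact: measurableT_comp.
Qed.

Lemma measurable_mulmx_rV (Q : 'M[R]_n) :
  measurable_fun setT (fun x : 'rV[R]_n => x *m Q).
Proof.
apply: measurable_fun_rV => j; under eq_fun do rewrite mxE.
apply: measurable_sum => i; apply: measurable_funM => //.
exact: measurable_rV_coord.
Qed.

End rV_measurable_ops.

Lemma Rintegral_probability_cst {R : realType} {d : measure_display}
  {T : measurableType d} (P : probability T R) (k : R) : \int[P]_x k = k.
Proof.
rewrite Rintegral_cst// -[RHS]mulr1; congr (_ * _).
by have /= -> := @probability_setT _ _ _ P.
Qed.

Section almost_everywhere.
Context {R : realType} {d : measure_display} {T : measurableType d}.
Variable mu : {measure set T -> \bar R}.
Implicit Types f g : T -> R.

(** Passes through max(f, g), which dominates f everywhere and equals g almost everywhere. *)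
Lemma le_Rintegral_ae f g : mu.-integrable setT (EFin \o f) ->
  mu.-integrable setT (EFin \o g) -> {ae mu, forall x, f x <= g x} ->
  \int[mu]_x f x <= \int[mu]_x g x.
Proof.
move=> fi gi fg.
have mf : measurable_fun setT f by exact/measurable_EFinP/(measurable_int mu fi).
have mg : measurable_fun setT g by exact/measurable_EFinP/(measurable_int mu gi).
have mm : measurable_fun setT (fun x => Num.max (f x) (g x)).
  exact: measurable_maxr.
have ae : ae_eq mu setT (EFin \o (fun x => Num.max (f x) (g x))) (EFin \o g).
  by apply: filterS fg => x fg _ /=; rewrite max_r.
have mi : mu.-integrable setT (EFin \o (fun x => Num.max (f x) (g x))).
  apply: (@le_integrable _ _ _ mu setT measurableT _
    (fun x => (`|f x| + `|g x|)%:E)).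
  - exact/measurable_EFinP.
  - move=> x _ /=; rewrite lee_fin [leRHS]ger0_norm ?addr_ge0//.
    by rewrite /Order.max; case: ifP => _; rewrite ?lerDl ?lerDr.
  - have := integrableD measurableT (integrable_norm fi) (integrable_norm gi).
    exact: eq_integrable.
apply: (@le_trans _ _ (\int[mu]_x Num.max (f x) (g x))).
  by apply: le_Rintegral => // x _; rewrite le_max lexx.
rewrite /Rintegral (@ae_eq_integral _ _ _ mu setT (EFin \o g))//.
- by apply/measurable_EFinP.
- by apply/measurable_EFinP.
Qed.

Lemma le_integrable_ae f g : measurable_fun setT f ->
  mu.-integrable setT (EFin \o g) -> {ae mu, forall x, `|f x| <= g x} ->
  mu.-integrable setT (EFin \o f).
Proof.
move=> mf gi fg.
have mg : measurable_fun setT g by exact/measurable_EFinP/(measurable_int mu gi).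
apply/integrableP; split; first exact/measurable_EFinP.
have /integrableP[_] := gi; apply: le_lt_trans.
apply: ae_ge0_le_integral => //.
- by apply: measurableT_comp => //; exact/measurable_EFinP.
- by apply: measurableT_comp => //; exact/measurable_EFinP.
by apply: filterS fg => x fg _ /=; rewrite lee_fin (le_trans fg)// ler_norm.
Qed.

Lemma integrable_sumR (I : Type) (r : seq I) (f : I -> T -> R) :
  (forall i, mu.-integrable setT (EFin \o f i)) ->
  mu.-integrable setT (EFin \o (fun x => \sum_(i <- r) f i x)).
Proof.
move=> fi; have := @integrable_sum _ _ _ mu _ measurableT _ r xpredT
  (fun i => EFin \o f i) (fun i _ => fi i).
by apply: eq_integrable => // x _ /=; rewrite sumEFin.
Qed.

Lemma Rintegral_sum (I : Type) (r : seq I) (f : I -> T -> R) :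
  (forall i, mu.-integrable setT (EFin \o f i)) ->
  \int[mu]_x (\sum_(i <- r) f i x) = \sum_(i <- r) \int[mu]_x f i x.
Proof.
move=> fi; elim: r => [|i r IH].
  by rewrite big_nil; under eq_Rintegral do rewrite big_nil; rewrite Rintegral_cst// mul0r.
rewrite big_cons; under eq_Rintegral do rewrite big_cons.
by rewrite RintegralD// ?IH//; exact: integrable_sumR.
Qed.

End almost_everywhere.

(** * Moments of the uniform distribution on the sphere *)

Section reflections.
Context {R : realType} {n : nat}.
Implicit Types (x u v w : 'rV[R]_n).

(** Besides the identity, these Householder matrices are the only orthogonal ones needed: along e_i
    they flip a sign, along e_i - e_k they swap two coordinates, along u - e_j they exchange the
    unit vector u with e_j. *)
Definition reflection w : 'M[R]_n := 1%:M - (2 / dotv w w) *: (w^T *m w).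

Lemma mulmx_dotv x w : x *m w^T = (dotv x w)%:M.
Proof.
apply/rowP => j; rewrite !mxE !ord1 mulr1n.
by apply: eq_bigr => k _; rewrite mxE.
Qed.

Lemma mul_reflection x w : x *m reflection w = x - (2 * dotv x w / dotv w w) *: w.
Proof.
rewrite mulmxBr mulmx1 -scalemxAr mulmxA mulmx_dotv mul_scalar_mx scalerA.
by rewrite mulrAC.
Qed.

Lemma dotv_neq0 w : w != 0 -> dotv w w != 0.
Proof.
move=> w0; rewrite -l2normE sqrf_eq0; apply: contraNneq w0 => l0.
apply/eqP/rowP => j; rewrite [RHS]mxE; apply/eqP.
by rewrite -normr_le0 -l0; exact: norm_le_l2norm.
Qed.

Lemma reflection_orthogonal w : w != 0 -> reflection w *m (reflection w)^T = 1%:M.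
Proof.
move=> w0; have ww := dotv_neq0 w0.
have -> : (reflection w)^T = reflection w.
  by rewrite /reflection !linearB/= trmx1 linearZ/= trmx_mul trmxK.
apply/row_matrixP => i; rewrite rowE mulmxA row1 !mul_reflection.
set v := delta_mx 0 i; set k := 2 * dotv v w / dotv w w.
have -> : 2 * dotv (v - k *: w) w / dotv w w = - k.
  by rewrite !dotvE /k; field.
by rewrite scaleNr opprK subrK.
Qed.

Lemma dotv_delta1 x j : dotv x (delta_mx ord0 j) = x ord0 j.
Proof. by rewrite -[delta_mx _ _]scale1r dotv_delta mul1r. Qed.

Lemma unit_coordinate u j : l2norm u = 1 -> exists2 Q : 'M[R]_n,
  Q *m Q^T = 1%:M & forall x, (x *m Q) ord0 j = dotv u x.
Proof.
move=> u1; pose e := delta_mx ord0 j : 'rV[R]_n.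
have [->|ue] := eqVneq u e.
  by exists 1%:M => [|x]; rewrite ?trmx1 ?mulmx1// dotvC dotv_delta1.
have w0 : u - e != 0 by rewrite subr_eq0.
exists (reflection (u - e)) => [|x]; first exact: reflection_orthogonal.
have uu : dotv u u = 1 by rewrite -l2normE u1 expr1n.
have ww : dotv (u - e) (u - e) = 2 * (1 - u ord0 j).
  rewrite !dotvE uu dotv_delta1 (dotvC e) dotv_delta1 dotv_delta1 mxE !eqxx.
  by rewrite /=; ring.
have wn := dotv_neq0 w0.
rewrite mul_reflection 3!mxE.
have -> : 2 * dotv x (u - e) / dotv (u - e) (u - e) * (u - e) ord0 j
    = - dotv x (u - e).
  have -> : (u - e) ord0 j = - (dotv (u - e) (u - e) / 2).
    by rewrite ww !mxE !eqxx/=; field.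
  by move: (dotv x (u - e)) => k; field.
by rewrite opprK dotvDr dotvNr dotv_delta1 (dotvC u) addrC subrK.
Qed.

Lemma reflection_flip x i j :
  (x *m reflection (delta_mx ord0 i)) ord0 j = if j == i then - x ord0 j else x ord0 j.
Proof.
rewrite mul_reflection !dotv_delta1 !mxE !eqxx divr1/=.
by case: eqVneq => [->|_] /=; ring.
Qed.

Lemma reflection_swap x i k j : i != k ->
  (x *m reflection (delta_mx ord0 i - delta_mx ord0 k)) ord0 j = x ord0 (tperm i k j).
Proof.
move=> ik; rewrite mul_reflection.
set w := delta_mx ord0 i - delta_mx ord0 k.
have ww : dotv w w = 2.
  rewrite /w dotvDr dotvNr !dotv_delta1 !mxE !eqxx/= (negPf ik) eq_sym (negPf ik).
  by rewrite /=; ring.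
have xw : dotv x w = x ord0 i - x ord0 k by rewrite dotvDr dotvNr !dotv_delta1.
rewrite ww xw mulrAC mulfV// mul1r 3!mxE !mxE eqxx/=.
case: tpermP => [->|->|/eqP/negPf-> /eqP/negPf->].
- by rewrite eqxx (negPf ik)/=; ring.
- by rewrite eqxx eq_sym (negPf ik)/=; ring.
- by rewrite /=; ring.
Qed.

End reflections.

Section uniform_sphere.
Context {R : realType} {n : nat} (mu : probability 'rV[R]_n R).
Hypothesis umu : uniform_on_sphere mu.
Implicit Types (x s t : 'rV[R]_n) (h : 'rV[R]_n -> R).

Lemma measurable_sphere : measurable [set x : 'rV[R]_n | l2norm x = 1].
Proof.
rewrite (_ : [set x | _] = (fun x : 'rV[R]_n => dotv x x) @^-1` [set 1]).
  rewrite -[X in measurable X]setTI.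
  have m : measurable_fun setT (fun x : 'rV[R]_n => dotv x x).
    by apply: measurable_dotv; exact: measurable_id.
  by apply: m => //; exact: measurable_set1.
apply/seteqP; split => x /=; rewrite -l2normE; first by move=> ->; rewrite expr1n.
move=> /eqP; rewrite sqrf_eq1 => /orP[/eqP//|/eqP l].
by have := l2norm_ge0 x; rewrite l; lra.
Qed.

Lemma sphere_ae : {ae mu, forall x, l2norm x = 1}.
Proof.
exists (~` [set x | l2norm x = 1]); split => //.
  exact: measurableC measurable_sphere.
by have := probability_setC mu measurable_sphere; rewrite umu.1 subee.
Qed.

Lemma sphere_integrable h (M : R) : measurable_fun setT h ->
  (forall x, l2norm x = 1 -> `|h x| <= M) -> mu.-integrable setT (EFin \o h).
Proof.
move=> mh hM; apply: (@le_integrable_ae _ _ _ mu _ (cst M)) => //.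
  exact: finite_measure_integrable_cst.
by apply: filterS sphere_ae => x; exact: hM.
Qed.

Lemma sphere_invariant (Q : 'M[R]_n) h : Q *m Q^T = 1%:M -> measurable_fun setT h ->
  \int[mu]_x h (x *m Q) = \int[mu]_x h x.
Proof.
move=> QQ mh.
pose f : {mfun 'rV[R]_n >-> 'rV[R]_n} :=
  HB.pack (fun x => x *m Q) (isMeasurableFun.Build _ _ _ _ _ (measurable_mulmx_rV Q)).
have E (k : 'rV[R]_n -> \bar R) : measurable_fun setT k -> (forall x, 0 <= k x)%E ->
    (\int[mu]_x k (x *m Q) = \int[mu]_x k x)%E.
  move=> mk k0; rewrite -[LHS](@ge0_integral_distribution _ _ _ _ _ mu f)//.
  by apply: eq_measure_integral => A mA _; exact: umu.2.
rewrite /Rintegral; congr fine.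
have mE : measurable_fun setT (EFin \o h) by exact/measurable_EFinP.
rewrite -[LHS]/(\int[mu]_x ((EFin \o h) \o (fun x => x *m Q)) x)%E.
rewrite [LHS]integralE [RHS]integralE; congr (_ - _)%E.
  under eq_integral do rewrite funepos_comp/=.
  exact: (E (EFin \o h)^\+%E (measurable_funepos mE) (fun x => funepos_ge0 _ x)).
under eq_integral do rewrite funeneg_comp/=.
exact: (E (EFin \o h)^\-%E (measurable_funeneg mE) (fun x => funeneg_ge0 _ x)).
Qed.

End uniform_sphere.

(** * Second moments against an invariant weight, and even moments of one coordinate *)

Section sphere_moments.
Context {R : realType} {n : nat} (mu : probability 'rV[R]_n R).
Hypothesis umu : uniform_on_sphere mu.
Implicit Types (x s t : 'rV[R]_n) (A B : R) (i j k : 'I_n) (r : nat).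

(* An integrable majorant of a squared norm on the sphere: for it the second
   moments are explicit, unlike for the norm itself. *)
Definition weight A B r x : R := A + B * \sum_j (x ord0 j ^+ 2) ^+ r.

Lemma weight_ge0 A B r x : 0 <= A -> 0 <= B -> 0 <= weight A B r x.
Proof.
move=> A0 B0; rewrite addr_ge0// mulr_ge0// sumr_ge0// => j _.
by rewrite exprn_ge0// sqr_ge0.
Qed.

Lemma measurable_weight A B r : measurable_fun setT (weight A B r).
Proof.
apply: measurable_funD => //; apply: measurable_funM => //.
apply: measurable_sum => j; apply: measurable_funX; apply: measurable_funX.
exact: measurable_rV_coord.
Qed.

Lemma unit_coord_le1 x j : l2norm x = 1 -> `|x ord0 j| <= 1.
Proof. by move=> <-; exact: norm_le_l2norm. Qed.

Lemma weight_bound A B r x : l2norm x = 1 ->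
  `|weight A B r x| <= `|A| + `|B| * n%:R.
Proof.
move=> x1; rewrite (le_trans (ler_normD _ _))// lerD2l normrM ler_wpM2l//.
rewrite (le_trans (ler_norm_sum _ _ _))//.
rewrite -[n in n%:R]card_ord -sum1_card natr_sum ler_sum// => j _.
by rewrite !normrX exprn_ile1// ?exprn_ge0// exprn_ile1// unit_coord_le1.
Qed.

Lemma weight_integrable A B r : mu.-integrable setT (EFin \o weight A B r).
Proof.
apply: (sphere_integrable umu (M := `|A| + `|B| * n%:R)).
  exact: measurable_weight.
exact: weight_bound.
Qed.

Lemma coord2_weight_measurable A B r i k :
  measurable_fun setT (fun x => x ord0 i * x ord0 k * weight A B r x).
Proof.
apply: measurable_funM; last exact: measurable_weight.
by apply: measurable_funM; exact: measurable_rV_coord.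
Qed.

Lemma coord2_weight_integrable A B r i k :
  mu.-integrable setT (EFin \o (fun x => x ord0 i * x ord0 k * weight A B r x)).
Proof.
apply: (sphere_integrable umu (M := `|A| + `|B| * n%:R)).
  exact: coord2_weight_measurable.
move=> x x1; rewrite normrM -[leRHS]mul1r ler_pM//; last exact: weight_bound.
by rewrite normrM mulr_ile1// unit_coord_le1.
Qed.

(** Flipping the sign of coordinate i keeps the weight and negates the integrand, so the integral is
    its own opposite. *)
Lemma coord2_weight_off A B r i k : i != k ->
  \int[mu]_x (x ord0 i * x ord0 k * weight A B r x) = 0.
Proof.
move=> ik; set I := LHS.
have d0 : delta_mx ord0 i != 0 :> 'rV[R]_n.
  by apply/eqP => /rowP/(_ i); rewrite !mxE !eqxx => /eqP; rewrite oner_eq0.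
have := sphere_invariant umu (reflection_orthogonal d0)
  (coord2_weight_measurable A B r i k).
rewrite (_ : Rintegral _ _ _ = - I) => [|]; first by rewrite -/I; lra.
rewrite -mulN1r -RintegralZl//; last exact: coord2_weight_integrable.
apply: eq_Rintegral => x _; rewrite !reflection_flip eqxx eq_sym (negPf ik).
have -> : weight A B r (x *m reflection (delta_mx ord0 i)) = weight A B r x.
  congr (_ + _ * _); apply: eq_bigr => j _; rewrite reflection_flip.
  by case: ifP => _; rewrite ?sqrrN.
ring.
Qed.

Lemma coord2_weight_diag A B r i k :
  \int[mu]_x (x ord0 i * x ord0 i * weight A B r x) =
  \int[mu]_x (x ord0 k * x ord0 k * weight A B r x).
Proof.
have [->//|ik] := eqVneq i k.
have w0 : delta_mx ord0 i - delta_mx ord0 k != 0 :> 'rV[R]_n.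
  apply/eqP => /rowP/(_ i); rewrite !mxE !eqxx (negPf ik) subr0 => /eqP.
  by rewrite oner_eq0.
rewrite -(sphere_invariant umu (reflection_orthogonal w0)
  (coord2_weight_measurable A B r i i)).
apply: eq_Rintegral => x _; rewrite !reflection_swap// tpermL.
congr (_ * (_ + _ * _)); rewrite [RHS](reindex_inj (@perm_inj _ (tperm i k))).
by apply: eq_bigr => j _; rewrite reflection_swap.
Qed.

(** Sign flips and swaps make the weighted second-moment matrix a multiple of the identity. Its
    trace is the mean of the weight, because |x| = 1 almost surely. *)
Lemma sphere_bilinear A B r s t :
  \int[mu]_x (dotv s x * dotv t x * weight A B r x) =
  dotv s t / n%:R * \int[mu]_x weight A B r x.
Proof.
have [n0|n0] := eqVneq n 0%N.
  have z (u v : 'rV[R]_n) : dotv u v = 0.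
    by rewrite /dotv big1// => j; have /leq_trans/(_ (eq_leq n0)) := ltn_ord j.
  under eq_Rintegral => x _ do rewrite z !mul0r.
  by rewrite z !mul0r Rintegral_cst// mul0r.
have nR : n%:R != 0 :> R by rewrite pnatr_eq0.
pose m i k := \int[mu]_x (x ord0 i * x ord0 k * weight A B r x).
have mii i : m i i = (\int[mu]_x weight A B r x) / n%:R.
  apply: (mulIf nR); rewrite divfK//.
  transitivity (\sum_(k < n) m k k).
    rewrite (eq_bigr (fun=> m i i)) => [|k _]; last exact: coord2_weight_diag.
    by rewrite sumr_const card_ord mulr_natr.
  rewrite -Rintegral_sum; last by move=> k; exact: coord2_weight_integrable.
  rewrite /Rintegral; congr fine; apply: ae_eq_integral => //.
  - apply/measurable_EFinP; apply: measurable_sum => k.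
    exact: coord2_weight_measurable.
  - by apply/measurable_EFinP; exact: measurable_weight.
  apply: filterS (sphere_ae umu) => x x1 _; congr EFin.
  rewrite -mulr_suml (_ : \sum_(i0 < n) _ = dotv x x)//.
  by rewrite -l2normE x1 expr1n mul1r.
transitivity (\sum_(i < n) \sum_(k < n) (s ord0 i * t ord0 k) * m i k).
  under eq_bigr => i _ do under eq_bigr => k _ do
    rewrite -RintegralZl ?coord2_weight_integrable//.
  have ik_int i k : mu.-integrable setT (EFin \o (fun x : 'rV[R]_n => s ord0 i * t ord0 k *
      (x ord0 i * x ord0 k * weight A B r x))).
    have := integrableZl measurableT (s ord0 i * t ord0 k)
      (coord2_weight_integrable A B r i k).
    by apply: eq_integrable.
  under eq_bigr => i _ do rewrite -Rintegral_sum//.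
  rewrite -Rintegral_sum; last by move=> i; exact: integrable_sumR.
  apply: eq_Rintegral => x _; rewrite /dotv big_distrlr/= mulr_suml.
  apply: eq_bigr => i _; rewrite mulr_suml; apply: eq_bigr => k _; ring.
rewrite mulr_suml mulr_suml; apply: eq_bigr => i _.
rewrite (bigD1 i)//= mii big1 ?addr0 => [|k ki]; first by field.
by rewrite /m coord2_weight_off ?mulr0// eq_sym.
Qed.

Lemma poly_eq_horner (p q : {poly R}) : (forall t : R, p.[t] = q.[t]) -> p = q.
Proof.
move=> pq; apply: subr0_eq.
apply: (@roots_geq_poly_eq0 R _ [seq l%:R | l <- iota 0 (size (p - q))]).
- by apply/allP => t _; rewrite rootE !hornerE pq subrr.
- rewrite map_inj_uniq ?iota_uniq// => a b /eqP.
  by rewrite eqr_nat => /eqP.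
- by rewrite size_map size_iota.
Qed.

Lemma coef2_1DX2 r : (((1 + 'X^2) ^+ r : {poly R})`_2 = r%:R)
  /\ (((1 + 'X^2) ^+ r : {poly R})`_0 = 1).
Proof.
elim: r => [|r [IH2 IH0]]; first by rewrite expr0 !coefE.
rewrite exprSr mulrDr mulr1 !coefD !coefMXn/= IH2 IH0.
by rewrite -natr1 addr0.
Qed.

Definition sphere_moment i r : R := \int[mu]_x (x ord0 i ^+ 2) ^+ r.

Lemma coord_pow_integrable i k a b :
  mu.-integrable setT (EFin \o (fun x => x ord0 i ^+ a * x ord0 k ^+ b)).
Proof.
apply: (sphere_integrable umu (M := 1)).
  by apply: measurable_funM; apply: measurable_funX; exact: measurable_rV_coord.
move=> x x1; rewrite normrM !normrX mulr_ile1 ?exprn_ge0//.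
  by rewrite exprn_ile1// unit_coord_le1.
by rewrite exprn_ile1// unit_coord_le1.
Qed.

(** The form x_i + t x_k is sqrt(1 + t^2) times a coordinate of an orthogonally transformed x. *)
Lemma sphere_moment_rotate i k r (t : R) : i != k ->
  \int[mu]_x (x ord0 i + t * x ord0 k) ^+ (2 * r) =
  (1 + t ^+ 2) ^+ r * sphere_moment i r.
Proof.
move=> ik; pose c := Num.sqrt (1 + t ^+ 2).
have t1 : 0 < 1 + t ^+ 2 by rewrite ltr_wpDr// sqr_ge0.
have c0 : c != 0 by rewrite gt_eqF// sqrtr_gt0.
have c2 : c ^+ 2 = 1 + t ^+ 2 by rewrite sqr_sqrtr// ltW.
pose w : 'rV[R]_n := delta_mx ord0 i + t *: delta_mx ord0 k.
have dw x : dotv w x = x ord0 i + t * x ord0 k.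
  by rewrite dotvC dotvDr dotvZr !dotv_delta1.
have ww : dotv w w = c ^+ 2.
  rewrite dw !mxE !eqxx (negPf ik) eq_sym (negPf ik) c2/=; ring.
have u1 : l2norm (c^-1 *: w) = 1.
  have : l2norm (c^-1 *: w) ^+ 2 = 1.
    by rewrite l2normE dotvZl dotvZr ww; field.
  move=> /eqP; rewrite sqrf_eq1 => /orP[/eqP//|/eqP l].
  by have := l2norm_ge0 (c^-1 *: w); rewrite l; lra.
have [Q QQ Qi] := unit_coordinate i u1.
have mi : measurable_fun setT (fun x : 'rV[R]_n => (x ord0 i ^+ 2) ^+ r).
  by do 2 apply: measurable_funX; exact: measurable_rV_coord.
rewrite /sphere_moment -(sphere_invariant umu QQ mi) -RintegralZl//.
  apply: eq_Rintegral => x _; rewrite Qi dotvZl dw -c2 exprM -exprMn.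
  by congr (_ ^+ r); field.
apply: (sphere_integrable umu (M := 1)).
  exact: (measurableT_comp mi (measurable_mulmx_rV Q)).
move=> x x1; rewrite !normrX exprn_ile1// ?exprn_ge0// exprn_ile1//.
apply: unit_coord_le1.
have : l2norm (x *m Q) ^+ 2 = 1.
  have -> : l2norm (x *m Q) ^+ 2 = ((x *m Q) *m (x *m Q)^T) ord0 ord0.
    by rewrite mulmx_dotv l2normE mxE eqxx.
  by rewrite trmx_mul mulmxA -(mulmxA x) QQ mulmx1 mulmx_dotv -l2normE x1 expr1n mxE.
move=> /eqP; rewrite sqrf_eq1 => /orP[/eqP//|/eqP l].
by have := l2norm_ge0 (x *m Q); rewrite l; lra.
Qed.

(** Both sides of [sphere_moment_rotate] at r + 1 are polynomials in t. Comparing the coefficients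
    of t^2 gives the claim, since C(2r+2, 2) = (r+1)(2r+1). *)
Lemma sphere_moment_mixed i k r : i != k ->
  (2 * r + 1)%:R * \int[mu]_x (x ord0 i ^+ (2 * r) * x ord0 k ^+ 2) =
  sphere_moment i r.+1.
Proof.
move=> ik; pose N l := \int[mu]_x (x ord0 i ^+ (2 * r.+1 - l) * x ord0 k ^+ l).
pose p := \poly_(l < (2 * r.+1).+1) ('C(2 * r.+1, l)%:R * N l).
pose q : {poly R} := sphere_moment i r.+1 *: (1 + 'X^2) ^+ r.+1.
have pq : p = q.
  apply: poly_eq_horner => t; rewrite /q hornerE horner_exp !hornerE.
  rewrite mulrC -(sphere_moment_rotate _ _ ik) horner_poly.
  under [RHS]eq_Rintegral do rewrite exprDn.
  rewrite Rintegral_sum => [|l]; last first.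
    have := integrableZl measurableT ('C(2 * r.+1, l)%:R * t ^+ l)
      (coord_pow_integrable i k (2 * r.+1 - l) l).
    apply: eq_integrable => // x _ /=; rewrite -EFinM; congr EFin.
    by rewrite exprMn -mulr_natl; ring.
  apply: eq_bigr => l _; rewrite mulrAC -RintegralZl//; last first.
    exact: coord_pow_integrable.
  by apply: eq_Rintegral => x _; rewrite exprMn -mulr_natl; ring.
have := congr1 (fun u : {poly R} => u`_2) pq.
rewrite coef_poly coefZ (coef2_1DX2 r.+1).1 mulnS ltnS leq_addr.
rewrite /N mulnS addKn => H.
have C2 : 'C(2 + 2 * r, 2)%:R = r.+1%:R * (2 * r + 1)%:R :> R.
  have /(congr1 (fun a : nat => a%:R : R)) := bin_ffact (2 + 2 * r) 2.
  rewrite /= !ffactnS ffactn0 muln1 [2`!]/= !natrM add2n/= => h.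
  have e1 : (2 * r).+2%:R = 2 * r.+1%:R :> R by rewrite -natrM mulnS.
  have e2 : (2 * r + 1)%:R = (2 * r).+1%:R :> R by rewrite addn1.
  rewrite e1 in h; rewrite e2; nra.
move: H; rewrite C2 [RHS]mulrC -mulrA => /mulfI; apply.
by rewrite pnatr_eq0.
Qed.

Lemma sphere_moment_ge0 i r : 0 <= sphere_moment i r.
Proof. by apply: Rintegral_ge0 => x _; rewrite exprn_ge0 ?sqr_ge0. Qed.

(** Multiply the moment of order r by |x|^2 = 1 and expand over k. Each term with k different from i
    is the next moment divided by 2r + 1, and the term k = i is larger still. *)
Lemma sphere_momentS i r :
  n%:R * sphere_moment i r.+1 <= (2 * r + 1)%:R * sphere_moment i r.
Proof.
have P0 : 0 < (2 * r + 1)%:R :> R by rewrite ltr0n addn1.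
have -> : sphere_moment i r =
    \sum_k \int[mu]_x (x ord0 i ^+ (2 * r) * x ord0 k ^+ 2).
  rewrite -Rintegral_sum; last by move=> k; exact: coord_pow_integrable.
  rewrite /sphere_moment /Rintegral; congr fine; apply: ae_eq_integral => //.
  - by apply/measurable_EFinP; do 2 apply: measurable_funX; exact: measurable_rV_coord.
  - apply/measurable_EFinP; apply: measurable_sum => k.
    by apply: measurable_funM; apply: measurable_funX; exact: measurable_rV_coord.
  apply: filterS (sphere_ae umu) => x x1 _; congr EFin.
  rewrite -mulr_sumr -exprM (_ : \sum_(i0 < n) _ = dotv x x)//.
  by rewrite -l2normE x1 expr1n mulr1.
rewrite mulr_sumr -[n in n%:R]card_ord -sum1_card natr_sum mulr_suml.
apply: ler_sum => k _; rewrite mul1r.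
have [<-|ik] := eqVneq i k; last by rewrite sphere_moment_mixed.
under [X in _ <= _ * X]eq_Rintegral do rewrite -exprD -[(2 * r + 2)%N]mulnSr exprM.
by rewrite -/(sphere_moment i r.+1) ler_peMl ?sphere_moment_ge0// ler1n addn1.
Qed.

(** Induction through [sphere_momentS]: one needs (2r+1) r^r <= (r+1)^(r+1), which holds because (1
    + 1/r)^r >= 2 by Bernoulli. *)
Lemma sphere_moment_bound i r : (0 < n)%N ->
  sphere_moment i r <= (r%:R / n%:R) ^+ r.
Proof.
move=> n0; have nR : 0 < n%:R :> R by rewrite ltr0n.
elim: r => [|r IH].
  rewrite /sphere_moment; under eq_Rintegral do rewrite expr0.
  by rewrite Rintegral_probability_cst expr0.
have := sphere_momentS i r; rewrite mulrC -ler_pdivlMr// => /le_trans; apply.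
have c0 : 0 <= (2 * r + 1)%:R / n%:R :> R by rewrite divr_ge0.
rewrite mulrAC; apply: (le_trans (ler_wpM2l c0 IH)).
have -> : (2 * r + 1)%:R / n%:R * (r%:R / n%:R) ^+ r
    = (2 * r + 1)%:R * r%:R ^+ r * n%:R^-1 ^+ r.+1 :> R.
  by rewrite exprMn exprS; ring.
rewrite exprMn ler_wpM2r ?exprn_ge0 ?invr_ge0//.
have [->|r0] := posnP r; first by rewrite expr0 expr1 muln0 mulr1.
have rR : 0 < r%:R :> R by rewrite ltr0n.
have bern : 1 + r%:R * r%:R^-1 <= (1 + r%:R^-1) ^+ r :> R.
  have h : forall (l : nat) (t : R), 0 <= t -> 1 + l%:R * t <= (1 + t) ^+ l.
    move=> l t t0; elim: l => [|l IHl]; first by rewrite expr0 mul0r addr0.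
    rewrite exprS -natr1; have := ler_wpM2l (_ : 0 <= 1 + t) IHl.
    rewrite addr_ge0// => /(_ erefl); apply: le_trans.
    have : 0 <= l%:R * t * t by rewrite !mulr_ge0.
    nra.
  by apply: h; rewrite invr_ge0 ltW.
rewrite mulfV ?gt_eqF// in bern.
have -> : r.+1%:R ^+ r.+1 = r.+1%:R * (r%:R ^+ r * (1 + r%:R^-1) ^+ r) :> R.
  by rewrite exprS -exprMn mulrDr mulr1 mulfV ?gt_eqF// natr1.
rewrite [leLHS]mulrC [leRHS]mulrCA ler_wpM2l ?exprn_ge0//.
apply: (@le_trans _ _ (r.+1%:R * (1 + 1))); last by rewrite ler_wpM2l.
by rewrite -natr1 natrD natrM; lra.
Qed.

End sphere_moments.

(** * The mean of the squared sup norm on the sphere, and the data of both proximal setups *)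

Section prox_setup.
Context {R : realType} {n : nat}.
Hypothesis n8 : (8 <= n)%N.

Let n0 : (0 < n)%N. Proof. exact: leq_trans n8. Qed.
Let nR : 0 < n%:R :> R. Proof. by rewrite ltr0n. Qed.

Lemma rho1E : rho n 1 = (16 * ln n%:R - 8) / n%:R :> R.
Proof.
rewrite /rho /conj_exp hoelder_conjugate1 invey mulr0 sub0r powR_inv1; last first.
  exact: ltW.
by rewrite addye// mineC /mine ltry.
Qed.

Lemma rho2E : rho n 2 = 1 :> R.
Proof.
rewrite /rho /conj_exp hoelder_conjugate2 inver pnatr_eq0/=.
rewrite mulfV// subrr powRr0 mulr1.
have := @ln_ge32 R _ n8; move: (ln _) => l hl.
rewrite /mine -EFinB lte_fin ifT/=; lra.
Qed.

(* A polynomial majorant of the squared sup norm: [x_j ^ 2 <= A] or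
   [x_j ^ 2 <= (x_j ^ 2) ^ r / A ^ (r - 1)], with [r] of order [ln n] and
   [A = 3 r / n]. *)
Lemma sup_weight : exists A B : R, exists r : nat,
  [/\ 0 <= A, 0 <= B,
      forall (x : 'rV[R]_n) j, x ord0 j ^+ 2 <= weight A B r x
    & forall mu : probability 'rV[R]_n R, uniform_on_sphere mu ->
        \int[mu]_x weight A B r x <= (16 * ln n%:R - 8) / n%:R].
Proof.
have l32 := @ln_ge32 R _ n8; set l := ln n%:R in l32 *.
pose r := (Num.truncn l).+1.
have l0 : 0 <= l by lra.
have rl : r%:R <= l + 1 by rewrite /r -natr1 lerD2r truncn_le.
have lr : l <= r%:R by rewrite ltW// truncnS_gt.
have r0 : 0 < r%:R :> R by rewrite ltr0n.
pose A : R := 3 * r%:R / n%:R.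
have A0 : 0 < A by rewrite !mulr_gt0// invr_gt0.
exists A, (A ^- r.-1), r; split; first exact: ltW.
- by rewrite invr_ge0 exprn_ge0// ltW.
- move=> x j; have [xA|xA] := leP (x ord0 j ^+ 2) A.
    apply: (le_trans xA); rewrite lerDl mulr_ge0//.
      by rewrite invr_ge0 exprn_ge0// ltW.
    by apply: sumr_ge0 => i _; rewrite exprn_ge0// sqr_ge0.
  apply: (@le_trans _ _ (A ^- r.-1 * \sum_j (x ord0 j ^+ 2) ^+ r)); last first.
    by rewrite lerDr ltW.
  rewrite mulrC ler_pdivlMr ?exprn_gt0//.
  apply: (@le_trans _ _ ((x ord0 j ^+ 2) ^+ r)).
    rewrite [in leRHS]/r (exprS (x ord0 j ^+ 2)) ler_wpM2l ?sqr_ge0//=.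
    by rewrite lerXn2r ?nnegrE ?sqr_ge0// ltW.
  rewrite (bigD1 j)//= lerDl sumr_ge0// => i _.
  by rewrite exprn_ge0// sqr_ge0.
move=> mu umu.
have ci j : mu.-integrable setT (EFin \o (fun x : 'rV[R]_n => (x ord0 j ^+ 2) ^+ r)).
  have := coord_pow_integrable umu j j (2 * r) 0.
  by apply: eq_integrable => // x _ /=; rewrite expr0 mulr1 exprM.
have cs := integrable_sumR (index_enum 'I_n) ci.
have cz := integrableZl measurableT (A ^- r.-1) cs.
have -> : \int[mu]_x weight A (A ^- r.-1) r x
    = A + A ^- r.-1 * \sum_j sphere_moment mu j r.
  have i1 : mu.-integrable setT (EFin \o cst A).
    exact: finite_measure_integrable_cst.
  rewrite /weight (RintegralD measurableT i1 cz) Rintegral_probability_cst.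
  by rewrite RintegralZl// Rintegral_sum.
have S : \sum_j sphere_moment mu j r <= n%:R * (r%:R / n%:R) ^+ r.
  rewrite -[n in n%:R * _]card_ord -sum1_card natr_sum mulr_suml.
  by apply: ler_sum => j _; rewrite mul1r; exact: sphere_moment_bound.
(* This is why A carries the factor 3 and r is at least ln n: r/n = A/3, and n = e^l <= e^r <=
   3^r. *)
have S2 : n%:R * (r%:R / n%:R) ^+ r <= A ^+ r.
  have -> : r%:R / n%:R = A / 3 by rewrite /A; field; rewrite gt_eqF.
  rewrite expr_div_n mulrCA ler_piMr ?exprn_ge0// ?(ltW A0)//.
  rewrite ler_pdivrMr ?exprn_gt0// mul1r.
  apply: (@le_trans _ _ (expR r%:R)).
    by rewrite -[leLHS]lnK ?posrE// ler_expR.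
  rewrite -[r%:R]mulr1 expRM_natl lerXn2r ?nnegrE ?expR_ge0//; exact: expR_le3.
have i0 : 0 <= A ^- r.-1 by rewrite invr_ge0 exprn_ge0// ltW.
have := ler_wpM2l i0 (le_trans S S2).
have -> : A ^- r.-1 * A ^+ r = A.
  by rewrite [in X in _ * X]/r exprS mulrCA mulVf ?mulr1// expf_neq0// gt_eqF.
(* Both parts of the weight contribute at most A, and 2 A = 6 r / n <= (16 l - 8) / n since r <= l +
   1. *)
move=> H; apply: (@le_trans _ _ (A + A)); first by rewrite lerD2l.
rewrite /A -mulrDl ler_wpM2r ?invr_ge0 ?(ltW nR)//.
by clear -rl l32; clearbody l r; lra.
Qed.

(** Collects what the analysis of a run uses about p, so that both values are then treated together.
    For p = 2 the weight is the constant 1; for p = 1 it is the one of [sup_weight]. *)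
Lemma prox_setup p : p = 1%N \/ p = 2%N ->
  exists a b c A B : R, exists r : nat,
  [/\ 1 < a, a <= 2, 2 <= b, a^-1 + b^-1 = 1 & 0 < c] /\
  [/\ (b - 1) / c <= 1, prox p = potential a c :> ('rV[R]_n -> R),
      0 <= A /\ 0 <= B,
      forall e : 'rV[R]_n, l2norm e = 1 ->
        (b - 1) / c * lnorm b e ^+ 2 <= weight A B r e
    & forall mu : probability 'rV[R]_n R, uniform_on_sphere mu ->
        \int[mu]_x weight A B r x <= rho n p].
Proof.
case=> ->; last first.
  exists 2, 2, 1, 1, 0, 0%N; split; first by split=> //; lra.
  split; first by lra.
  - exact: prox2E.
  - by split; lra.
  - by move=> e e1; rewrite /weight mul0r addr0 lnorm2E e1; lra.
  - move=> mu umu; under eq_Rintegral do rewrite /weight mul0r addr0.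
    by rewrite Rintegral_probability_cst rho2E.
have l32 := @ln_ge32 R _ n8.
have [A [B [r [A0 B0 AB AE]]]] := sup_weight.
exists (prox_kappa n), (1 + ln n%:R), (@prox1_coef R n), A, B, r.
have kE : prox_kappa n = 1 + (ln n%:R)^-1 :> R by [].
split; split.
- by rewrite kE ltrDl invr_gt0; lra.
- have : (ln n%:R)^-1 <= 1 :> R by rewrite invf_le1; lra.
  by rewrite kE; lra.
- lra.
- exact: conj_exp_prox1.
- exact: prox1_coef_gt0.
- by rewrite addrAC subrr add0r prox1_coef_le1.
- exact: prox1E.
- by [].
- move=> e e1; rewrite addrAC subrr add0r.
  set b := 1 + ln n%:R; have b0 : 0 < b by rewrite /b; lra.
  have W0 : 0 <= weight A B r e.
    by apply: le_trans (AB e (Ordinal n0)); exact: sqr_ge0.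
  have H : lnorm b e ^+ 2 <= n%:R `^ (2 / b) * weight A B r e.
    have -> : lnorm b e ^+ 2 = lsum b e `^ (2 / b).
      rewrite -lnorm_pow// -powRrM mulrCA mulfV ?gt_eqF// mulr1 powR_mulrn//.
      exact: lnorm_ge0.
    have -> : n%:R `^ (2 / b) * weight A B r e
        = (n%:R * weight A B r e `^ (b / 2)) `^ (2 / b).
      rewrite powRM ?powR_ge0 ?(ltW nR)// -powRrM.
      rewrite (_ : b / 2 * (2 / b) = 1) ?powRr1//; field.
      by rewrite gt_eqF.
    apply: powR_le_mono; rewrite ?divr_ge0 ?(ltW b0) ?lsum_ge0//.
    rewrite -[n in n%:R]card_ord -sum1_card natr_sum mulr_suml.
    apply: ler_sum => j _; rewrite mul1r.
    have -> : `|e ord0 j| `^ b = (e ord0 j ^+ 2) `^ (b / 2).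
      rewrite -real_normK ?num_real// -powR_mulrn// -powRrM.
      by congr (_ `^ _); field.
    by apply: powR_le_mono; rewrite ?sqr_ge0 ?divr_ge0 ?(ltW b0).
  have k0 : 0 <= ln n%:R / @prox1_coef R n.
    by rewrite divr_ge0// ?(ltW (prox1_coef_gt0 n8))//; lra.
  apply: (le_trans (ler_wpM2l k0 H)).
  by rewrite mulrA prox1_coefE// mul1r.
- by move=> mu umu; rewrite rho1E; exact: AE.
Qed.

End prox_setup.

(** * Independence and integration *)

Section independence_of_algebras.
Context {d : measure_display} {T : measurableType d} {R : realType}.
Variables (Pr : probability T R) (I : finType) (G : I -> set (set T)).
Hypotheses (Gm : forall i, G i `<=` measurable) (GI : forall i, setI_closed (G i))
  (GT : forall i, G i setT).

(* generates the sigma-algebra of the events decided by the draws in [J] *)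
Definition joint_draws (J : {set I}) : set (set T) :=
  [set A | exists2 i, i \in J & G i A].

Lemma joint_draws_measurable (J : {set I}) : <<s joint_draws J >> `<=` measurable.
Proof.
apply: smallest_sub; first exact: sigma_algebra_measurable.
by move=> A [i _ /Gm].
Qed.

(** Uniqueness of measures on a pi-system: A -> Pr(A & B) and A -> Pr(A) Pr(B) are finite measures
    that agree on the finite intersections of events of single draws in J, and these generate. *)
Lemma joint_draws_independent (J : {set I}) (j : I) : mutually_independent Pr G -> j \notin J ->
  forall A B, <<s joint_draws J >> A -> G j B ->
  Pr (A `&` B) = (Pr A * Pr B)%E.
Proof.
move=> ind jJ A B sA GB; have mB := Gm GB.
pose Pi : set (set T) := [set C | exists2 f : I -> set T,
  (forall i, i \in J -> G i (f i)) & C = \bigcap_(i in [set` J]) f i].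
have PiT : Pi setT.
  exists (fun=> setT) => [i _|]; first exact: GT.
  by apply/seteqP; split.
have PiI : setI_closed Pi.
  move=> _ _ [f fG ->] [g gG ->]; exists (fun i => f i `&` g i).
    by move=> i iJ; apply: GI; [exact: fG|exact: gG].
  by rewrite bigcapI.
have sPi C : Pi C -> measurable C.
  move=> [f fG ->]; apply: fin_bigcap_measurable => //.
  by move=> i iJ; exact: Gm (fG i iJ).
have PrB0 : 0 <= fine (Pr B) by exact: fine_ge0.
pose k := NngNum PrB0.
have kE : (k%:num%:E = Pr B)%E by rewrite fineK// fin_num_measure.
suff H : mrestr Pr mB A = mscale k Pr A.
  by move: H; rewrite /mrestr /mscale/= -/(k%:num) kE muleC.
apply: (@g_sigma_algebra_measure_unique _ _ _ Pi sPi (fun=> setT) (fun=> PiT) _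
  (mrestr Pr mB) (mscale k Pr)) => //.
- by rewrite bigcup_const//; exists 0%N.
- move=> _ [f fG ->].
  suff : (Pr (\bigcap_(i in [set` J]) f i `&` B)
      = Pr B * Pr (\bigcap_(i in [set` J]) f i))%E by rewrite -kE.
  pose f' i := if i == j then B else f i.
  have f'J i : i \in J -> f' i = f i.
    by rewrite /f'; case: eqP => // -> jj; rewrite jj in jJ.
  have E1 := ind (j |: J) f'.
  have E2 := ind J f fG.
  rewrite E2.
  have -> : \bigcap_(i in [set` J]) f i `&` B = \bigcap_(i in [set` j |: J]) f' i.
    apply/seteqP; split => [x [Hf HB] i /=|x H].
      rewrite in_setU1 => /orP[/eqP ->|iJ]; first by rewrite /f' eqxx.
      by rewrite f'J//; exact: Hf.
    split => [i /= iJ|]; first by rewrite -f'J//; apply: H; rewrite /= in_setU1 iJ orbT.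
    by have := H j; rewrite /f' eqxx; apply; rewrite /= setU11.
  rewrite E1 => [|i]; last first.
    rewrite in_setU1 => /orP[/eqP ->|iJ]; first by rewrite /f' eqxx.
    by rewrite f'J//; exact: fG.
  rewrite big_setU1//= {1}/f' eqxx; congr (_ * _)%E.
  by apply: eq_bigr => i iJ; rewrite f'J.
- by move=> _; rewrite /= /mrestr setTI ltey_eq fin_num_measure.
- have sub : <<s joint_draws J >> `<=` <<s Pi >>; last exact: sub sA.
  apply: smallest_sub; first exact: smallest_sigma_algebra.
  move=> C [i iJ GC]; apply: sub_sigma_algebra.
  exists (fun l => if l == i then C else setT) => [l lJ|].
    by case: eqP => // ->.
  apply/seteqP; split => [x Cx l _|x /(_ i iJ)]; last by rewrite eqxx.
  by case: eqP.
Qed.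

End independence_of_algebras.

Section independent_fubini.
Context {d d' : measure_display} {Om : measurableType d} {T : measurableType d'}.
Context {R : realType} (Pr : probability Om R) (S : set (set Om)).
Variable Z : {RV Pr >-> T}.
Hypothesis Sm : <<s S >> `<=` measurable.
Hypothesis ind : forall A B, <<s S >> A -> measurable B ->
  Pr (A `&` Z @^-1` B) = (Pr A * Pr (Z @^-1` B))%E.

(** The same sample space with only the events decided by S: measurability of a function on it
    expresses dependence on those draws alone. *)
Local Notation OmS := (g_sigma_algebraType S).

Lemma measurable_coarse : measurable_fun setT (id : Om -> OmS).
Proof. by move=> _ A mA; rewrite setTI; exact: Sm. Qed.

Lemma measurable_coarse_pair :
  measurable_fun setT (fun w => (w, Z w) : OmS * T).
Proof.
by apply: measurable_fun_pair; [exact: measurable_coarse|exact: measurable_funPT].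
Qed.

Let cmap : {RV Pr >-> OmS} :=
  HB.pack (id : Om -> OmS) (isMeasurableFun.Build _ _ _ _ _ measurable_coarse).
Let pmap : {RV Pr >-> (OmS * T)%type} :=
  HB.pack (fun w => (w, Z w) : OmS * T)
    (isMeasurableFun.Build _ _ _ _ _ measurable_coarse_pair).

Let joint A : measurable A ->
  (distribution Pr cmap \x distribution Pr Z)%E A = distribution Pr pmap A.
Proof.
apply: product_measure_unique => A1 A2 mA1 mA2.
by rewrite /= /distribution /= /pushforward/= -ind.
Qed.

(** Takes the place of a conditional expectation: under the product law of (w, Z w) the draw Z is
    integrated out with w frozen. *)
Lemma independent_fubini_tonelli (h : OmS * T -> \bar R) :
  measurable_fun setT h -> (forall z, 0 <= h z)%E ->
  (\int[Pr]_w h (w, Z w) = \int[Pr]_w \int[distribution Pr Z]_z h (w, z))%E.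
Proof.
move=> mh h0.
rewrite -[LHS](@ge0_integral_distribution _ _ _ _ _ Pr pmap h)//.
transitivity (\int[distribution Pr cmap \x distribution Pr Z]_z h z)%E.
  by apply: eq_measure_integral => A mA _; exact/esym/joint.
rewrite fubini_tonelli1//.
rewrite (@ge0_integral_distribution _ _ _ _ _ Pr cmap)//.
  exact: measurable_fun_fubini_tonelli_F.
by move=> y; exact: integral_ge0.
Qed.

Lemma independent_fubini (h : OmS * T -> R) :
  measurable_fun setT h ->
  Pr.-integrable setT (fun w => (h (w, Z w))%:E) ->
  (\int[Pr]_w (h (w, Z w))%:E
    = \int[Pr]_w \int[distribution Pr Z]_z (h (w, z))%:E)%E.
Proof.
move=> mh ih; have mhE : measurable_fun setT (EFin \o h) by exact/measurable_EFinP.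
have ip : (distribution Pr cmap \x distribution Pr Z)%E.-integrable setT (EFin \o h).
  apply/integrable12ltyP => //.
  have := @independent_fubini_tonelli (abse \o (EFin \o h)).
  have mha : measurable_fun setT (abse \o (EFin \o h)) by exact: measurableT_comp.
  move=> /(_ mha (fun=> abse_ge0 _)) E.
  rewrite (@ge0_integral_distribution _ _ _ _ _ Pr cmap)//; last 2 first.
  - exact: (measurable_fun_fubini_tonelli_F (abse \o (EFin \o h)) mha (fun=> abse_ge0 _)).
  - by move=> y; exact: integral_ge0.
  by move: E => /= <-; have /integrableP[] := ih.
transitivity (\int[distribution Pr cmap \x distribution Pr Z]_z (h z)%:E)%E.
  rewrite -[LHS](@integral_distribution _ _ _ _ _ Pr pmap (EFin \o h))//.
  by apply: eq_measure_integral => A mA _; exact/esym/joint.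
rewrite -(integral12_prod_meas1 ip).
have iF := integrable_fubini_F ip.
have /integrableP[mF iFoo] := iF.
rewrite (@integral_distribution _ _ _ _ _ Pr cmap)//.
apply/integrableP; split; first exact: (measurableT_comp mF measurable_coarse).
by rewrite -(@ge0_integral_distribution _ _ _ _ _ Pr cmap
  (fun y => `|_ y|%E))//; exact: measurableT_comp.
Qed.

End independent_fubini.

(** * The stochastic objective *)

Section quadratic_bound.
Context {R : realType} {n : nat}.
Implicit Types (x y v : 'rV[R]_n).

Lemma dotv_le_l2norm x y : dotv x y <= l2norm x * l2norm y.
Proof.
rewrite -!lnorm2E; apply: dotv_le_lnorm; first by rewrite ltr1n.
by have := splitr (1 : R); rewrite !div1r.
Qed.

Lemma norm_dotv_le x y : `|dotv x y| <= l2norm x * l2norm y.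
Proof.
rewrite ler_norml dotv_le_l2norm andbT lerNl -dotvNl.
by apply: (le_trans (dotv_le_l2norm _ _)); rewrite -!lnorm2E lnormN.
Qed.

Lemma l2normZ (k : R) x : l2norm (k *: x) = `|k| * l2norm x.
Proof. by rewrite -!lnorm2E lnormZ. Qed.

Lemma derive_gradient (f : 'rV[R]_n -> R) x g v : has_gradient f x g ->
  'D_v f x = dotv g v.
Proof.
move=> [df <-]; rewrite deriveE// {1}(row_sum_delta v) linear_sum.
apply: eq_bigr => j _; rewrite linearZ/= -deriveE// mxE mulrC//.
Qed.

Lemma is_derive_along (f : 'rV[R]_n -> R) x v g (s : R) :
  has_gradient f (s *: v + x) g ->
  is_derive s 1 (fun r : R => f (r *: v + x)) (dotv g v).
Proof.
move=> hg; have [df _] := hg.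
have E : (fun h : R => h^-1 *: (f ((h *: (1 : R) + s) *: v + x) - f (s *: v + x)))
    = (fun h : R => h^-1 *: (f (h *: v + (s *: v + x)) - f (s *: v + x))).
  by apply/funext => h; rewrite [h *: 1]mulr1 scalerDl addrA.
apply: DeriveDef.
  by rewrite /derivable/= E; exact: diff_derivable.
by rewrite /derive/= E; exact: derive_gradient.
Qed.

(** The mean value theorem for f minus the quadratic, whose derivative is nonpositive on [0, 1]. The
    bound is one-sided, so it is applied below to F and to -F. *)
Lemma scalar_quadratic_bound (f df : R -> R) (K : R) :
  (forall s : R, is_derive s 1 f (df s)) ->
  (forall s, 0 <= s -> s <= 1 -> df s - df 0 <= K * s) ->
  f 1 - f 0 - df 0 <= K / 2.
Proof.
move=> fd dfK; pose p : {poly R} := (df 0) *: 'X + (K / 2) *: 'X^2.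
pose h s := f s - p.[s].
have hd (s : R) : is_derive s 1 h (df s - p^`().[s]).
  exact: is_deriveB.
have hc : {within `[0 : R, 1], continuous h}.
  apply: continuous_subspaceT => s; apply: differentiable_continuous.
  by apply/derivable1_diffP; have [] := hd s.
have [c] := @MVT_segment R h _ 0 1 ler01 (fun s _ => hd s) hc.
rewrite in_itv/= => /andP[c0 c1]; rewrite /h /p subr0 mulr1.
rewrite derivD !derivZ derivX derivXn !hornerE/=.
by have := dfK c c0 c1; lra.
Qed.

Lemma gradient_quadratic_bound (F : 'rV[R]_n -> R) (g : 'rV[R]_n -> 'rV[R]_n)
    (L : R) :
  (forall x, has_gradient F x (g x)) ->
  (forall x y, l2norm (g x - g y) <= L * l2norm (x - y)) ->
  forall x y, `|F y - F x - dotv (g x) (y - x)| <= L / 2 * l2norm (y - x) ^+ 2.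
Proof.
move=> Fg gL x y; set v := y - x.
have D (s : R) : is_derive s 1 (fun r : R => F (r *: v + x)) (dotv (g (s *: v + x)) v).
  exact: is_derive_along.
have B (s : R) : 0 <= s -> `|dotv (g (s *: v + x)) v - dotv (g x) v|
    <= L * l2norm v ^+ 2 * s.
  move=> s0; rewrite -dotvNl -dotvDl (le_trans (norm_dotv_le _ _))//.
  have := gL (s *: v + x) x; rewrite addrK l2normZ ger0_norm// => h.
  by apply: (le_trans (ler_wpM2r (l2norm_ge0 v) h)); slra.
have e0 : 0 *: v + x = x by rewrite scale0r add0r.
have e1 : 1 *: v + x = y by rewrite scale1r /v subrK.
have U := @scalar_quadratic_bound _ _ (L * l2norm v ^+ 2) D.
have V := @scalar_quadratic_bound (fun r : R => - F (r *: v + x))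
  (fun s => - dotv (g (s *: v + x)) v) (L * l2norm v ^+ 2) (fun s => is_deriveN (D s)).
rewrite /= e0 e1 in U V.
rewrite ler_norml; apply/andP; split.
  have {}V : - F y - - F x - - dotv (g x) v <= L * l2norm v ^+ 2 / 2.
    apply: V => s s0 s1; have := B s s0; rewrite ler_norml => /andP[+ _].
    slra.
  by move: V; slra.
have {}U : F y - F x - dotv (g x) v <= L * l2norm v ^+ 2 / 2.
  by apply: U => s s0 s1; have := B s s0; rewrite ler_norml => /andP[].
by move: U; slra.
Qed.

End quadratic_bound.

(** * The objective inherits smoothness from its samples *)

Section stochastic_objective.
Context {R : realType} {n : nat} {d : measure_display} {X : measurableType d}.
Variable P : probability X R.

Lemma measurable_param_integral d' (S : measurableType d') (h : S * X -> R) :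
  measurable_fun setT h ->
  measurable_fun setT (fun s => \int[P]_u h (s, u)).
Proof.
move=> mh; have mhE : measurable_fun setT (EFin \o h) by exact/measurable_EFinP.
rewrite /Rintegral; apply: measurableT_comp => //.
rewrite (_ : (fun s => _) = (fun s => \int[P]_u (EFin \o h)^\+ (s, u)
    - \int[P]_u (EFin \o h)^\- (s, u))%E); last first.
  apply/funext => s; rewrite integralE; congr (_ - _)%E.
    by under eq_integral do rewrite (funepos_comp (EFin \o h) (pair s))/=.
  by under eq_integral do rewrite (funeneg_comp (EFin \o h) (pair s))/=.
apply: emeasurable_funB.
  apply: (measurable_fun_fubini_tonelli_F (EFin \o h)^\+%E) => //.
  exact: measurable_funepos.
apply: (measurable_fun_fubini_tonelli_F (EFin \o h)^\-%E) => //.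
exact: measurable_funeneg.
Qed.

Variables (F : 'rV[R]_n -> X -> R) (g : 'rV[R]_n -> X -> 'rV[R]_n) (L : X -> R).
Variables (L2 sigma : R).
Hypothesis hF : stochastic_problem P F g L L2 sigma.
Hypothesis n0 : (0 < n)%N.

Local Notation f := (objective P F).
Implicit Types (x y v : 'rV[R]_n).

Lemma objectiveE x : f x = \int[P]_u F x u.
Proof. by rewrite /objective unlock. Qed.

Lemma measurable_objective : measurable_fun setT f.
Proof.
rewrite (_ : f = (fun x => \int[P]_u (fun z => F z.1 z.2) (x, u))).
  exact: measurable_param_integral (sp_measF hF).
by apply/funext => x; rewrite objectiveE.
Qed.

Lemma measurable_sample_gradient x : measurable_fun setT (g x).
Proof.
exact: (measurableT_comp (sp_measg hF) (pair1_measurable x)).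
Qed.

Lemma lipschitz_ge0 : {ae P, forall u, 0 <= L u}.
Proof.
apply: filterS (sp_lip hF) => u /(_ (delta_mx ord0 (Ordinal n0)) 0).
set x := delta_mx _ _; rewrite subr0.
have -> : l2norm x = 1.
  have : l2norm x ^+ 2 = 1 by rewrite l2normE dotv_delta1 mxE !eqxx.
  move=> /eqP; rewrite sqrf_eq1 => /orP[/eqP//|/eqP l].
  by have := l2norm_ge0 x; rewrite l; lra.
by rewrite mulr1; apply: le_trans; exact: l2norm_ge0.
Qed.

Lemma integrable_ge0_bound (h : X -> R) (K : R) : measurable_fun setT h ->
  (forall u, 0 <= h u) -> (\int[P]_u (h u)%:E <= K%:E)%E ->
  P.-integrable setT (EFin \o h) /\ \int[P]_u h u <= K.
Proof.
move=> mh h0 hK; have i : P.-integrable setT (EFin \o h).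
  apply/integrableP; split; first exact/measurable_EFinP.
  under eq_integral do rewrite /= ger0_norm//.
  by rewrite (le_lt_trans hK)// ltry.
split => //; rewrite -lee_fin /Rintegral fineK//.
exact: (integrable_fin_num measurableT i).
Qed.

Lemma lipschitz_sqr : P.-integrable setT (EFin \o (fun u => L u ^+ 2)) /\
  \int[P]_u (L u ^+ 2) <= L2 ^+ 2.
Proof.
apply: integrable_ge0_bound; first exact: measurable_funX (sp_measL hF).
  by move=> u; exact: sqr_ge0.
have := sp_L2 hF; rewrite unlock; have l0 := sp_L2_gt0 hF.
have : (0 <= \int[P]_u (L u ^+ 2)%:E)%E.
  by apply: integral_ge0 => u _; rewrite lee_fin sqr_ge0.
case: (integral _ _ _) => [r| |]//= r0.
rewrite !lee_fin => h; rewrite -(sqr_sqrtr r0); exact: ler_sqr_ge0.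
Qed.

(** The pointwise inequality L <= L^2 / (2 L2) + L2 / 2 gives integrability and the bound
    together. *)
Lemma lipschitz_mean : P.-integrable setT (EFin \o L) /\ \int[P]_u L u <= L2.
Proof.
have [i2 e2] := lipschitz_sqr; have l0 := sp_L2_gt0 hF.
pose k u := (2 * L2)^-1 * L u ^+ 2 + L2 / 2.
have i1 : P.-integrable setT (EFin \o (fun u => (2 * L2)^-1 * L u ^+ 2)).
  by have := integrableZl measurableT (2 * L2)^-1 i2; apply: eq_integrable.
have ic : P.-integrable setT (EFin \o (fun=> L2 / 2) : X -> \bar R).
  exact: finite_measure_integrable_cst.
have ik : P.-integrable setT (EFin \o k).
  by have := integrableD measurableT i1 ic; apply: eq_integrable.
have kL u : L u <= k u.
  have : 0 <= (2 * L2)^-1 * (L u - L2) ^+ 2.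
    by rewrite mulr_ge0 ?sqr_ge0// invr_ge0 mulr_ge0// ltW.
  rewrite (_ : _ * _ = k u - L u) ?subr_ge0// /k.
  by field; rewrite gt_eqF.
have iL : P.-integrable setT (EFin \o L).
  apply: (le_integrable_ae (sp_measL hF) ik).
  by apply: filterS lipschitz_ge0 => u u0; rewrite ger0_norm.
split => //; apply: (@le_trans _ _ (\int[P]_u k u)).
  by apply: le_Rintegral => // u _; exact: kL.
rewrite /k (RintegralD measurableT i1 ic) (RintegralZl (2 * L2)^-1 measurableT i2).
rewrite (Rintegral_probability_cst P (L2 / 2)).
have i0 : 0 <= (2 * L2)^-1 by rewrite invr_ge0 mulr_ge0// ltW.
have := ler_wpM2l i0 e2.
rewrite (_ : (2 * L2)^-1 * L2 ^+ 2 = L2 / 2); first by lra.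
by field; rewrite gt_eqF.
Qed.

Definition grad_noise x u := g x u - grad f x.

Lemma measurable_grad_noise x : measurable_fun setT (grad_noise x).
Proof.
apply: measurable_rV_sub; first exact: measurable_sample_gradient.
exact: measurable_cst.
Qed.

Lemma grad_noise_var x :
  P.-integrable setT (EFin \o (fun u => l2norm (grad_noise x u) ^+ 2)) /\
  \int[P]_u (l2norm (grad_noise x u) ^+ 2) <= sigma ^+ 2.
Proof.
apply: integrable_ge0_bound.
- by apply: measurable_l2norm_sqr; exact: measurable_grad_noise.
- by move=> u; exact: sqr_ge0.
- by have := sp_var hF x; rewrite unlock.
Qed.

Lemma grad_noise_integrable x j :
  P.-integrable setT (EFin \o (fun u => grad_noise x u ord0 j)).
Proof.
have [i _] := grad_noise_var x.
have ic : P.-integrable setT (EFin \o cst 1 : X -> \bar R).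
  exact: finite_measure_integrable_cst.
have i2 := integrableD measurableT ic i.
apply: (@le_integrable_ae _ _ _ P _ (fun u => 1 + l2norm (grad_noise x u) ^+ 2)).
- by apply: measurable_coord; exact: measurable_grad_noise.
- by apply: eq_integrable i2.
apply: aeW => u; rewrite (le_trans (norm_le_l2norm _ _))//.
have := sqr_ge0 (l2norm (grad_noise x u) - 1); have := l2norm_ge0 (grad_noise x u).
by set l := l2norm _; clearbody l; nra.
Qed.

(** The variance condition centres g at [grad f x], whatever that vector is. Hence g is integrable
    before its mean G is known to be the gradient of f. *)
Lemma sample_gradient_integrable x j :
  P.-integrable setT (EFin \o (fun u => g x u ord0 j)).
Proof.
have ic : P.-integrable setT (EFin \o cst (grad f x ord0 j) : X -> \bar R).
  exact: finite_measure_integrable_cst.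
have := integrableD measurableT (grad_noise_integrable x j) ic.
by apply: eq_integrable => // u _ /=; rewrite -EFinD !mxE subrK.
Qed.

Let G x : 'rV[R]_n := \row_j \int[P]_u (g x u ord0 j).

Lemma dotv_sample_gradient x v :
  P.-integrable setT (EFin \o (fun u => dotv (g x u) v)) /\
  \int[P]_u dotv (g x u) v = dotv (G x) v.
Proof.
have i j : P.-integrable setT (EFin \o (fun u => g x u ord0 j * v ord0 j)).
  have := integrableZr measurableT (v ord0 j) (sample_gradient_integrable x j).
  by apply: eq_integrable.
split; first exact: integrable_sumR.
rewrite Rintegral_sum//; apply: eq_bigr => j _.
by rewrite RintegralZr ?mxE//; exact: sample_gradient_integrable.
Qed.

(** The quadratic bound of almost every sample, integrated; no differentiation under the integral
    sign is involved. *)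
Lemma objective_quadratic_G x y :
  `|f y - f x - dotv (G x) (y - x)| <= L2 / 2 * l2norm (y - x) ^+ 2.
Proof.
have [iL eL] := lipschitz_mean; have [ig eg] := dotv_sample_gradient x (y - x).
set k := l2norm (y - x) ^+ 2; have k0 : 0 <= k by exact: sqr_ge0.
pose r u := F y u - F x u - dotv (g x u) (y - x).
have iF := sp_int hF.
have iFF : P.-integrable setT (EFin \o (fun u => F y u - F x u)).
  by have := integrableB measurableT (iF y) (iF x); apply: eq_integrable.
have ir : P.-integrable setT (EFin \o r).
  by have := integrableB measurableT iFF ig; apply: eq_integrable.
have er : \int[P]_u r u = f y - f x - dotv (G x) (y - x).
  by rewrite /r RintegralB// RintegralB ?iF// eg !objectiveE.
have ik : P.-integrable setT (EFin \o (fun u => k / 2 * L u)).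
  by have := integrableZl measurableT (k / 2) iL; apply: eq_integrable.
have rb : {ae P, forall u, `|r u| <= k / 2 * L u}.
  apply: filterS2 (sp_grad hF) (sp_lip hF) => u hg hl.
  have := gradient_quadratic_bound hg hl x y; rewrite -/(r u) -/k => /le_trans; apply.
  by rewrite (_ : L u / 2 * k = k / 2 * L u)//; ring.
have ek : \int[P]_u (k / 2 * L u) <= L2 / 2 * k.
  rewrite RintegralZl//; have := ler_wpM2l (_ : 0 <= k / 2) eL.
  by rewrite divr_ge0// => /(_ erefl) /le_trans; apply; rewrite mulrAC [k * _]mulrC mulrAC.
rewrite -er ler_norml; apply/andP; split.
  have inr : P.-integrable setT (EFin \o (fun u => - 1 * r u)).
    by have := integrableZl measurableT (- 1) ir; apply: eq_integrable.
  have := @le_Rintegral_ae _ _ _ P (fun u => - 1 * r u) _ inr ik.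
  rewrite (RintegralZl (- 1) measurableT ir) mulN1r => h; rewrite lerNl; apply: (le_trans _ ek); apply: h.
  by apply: filterS rb => u; rewrite mulN1r; apply: le_trans; rewrite -normrN ler_norm.
apply: (le_trans _ ek); apply: le_Rintegral_ae => //.
by apply: filterS rb => u; apply: le_trans; rewrite ler_norm.
Qed.

(** By the quadratic bound, difference quotients at increment s are within L2 |s| / 2 of the
    coordinates of G. *)
Lemma grad_objective x : grad f x = G x.
Proof.
apply/rowP => j; rewrite [LHS]mxE.
apply: (@derive_of_bound _ _ _ _ _ _ (fun s => L2 / 2 * `|s|)).
  move=> s s0; have := objective_quadratic_G x (s *: delta_mx ord0 j + x).
  rewrite addrK dotv_delta l2normZ exprMn.
  have -> : l2norm (delta_mx ord0 j : 'rV[R]_n) ^+ 2 = 1.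
    by rewrite l2normE dotv_delta1 mxE !eqxx.
  rewrite mulr1; set a := f _; set b := f x; set c := G x ord0 j => h.
  have -> : s^-1 * (a - b) - c = s^-1 * (a - b - s * c) by field.
  rewrite normrM normfV ler_pdivrMl ?normr_gt0//.
  by apply: (le_trans h); rewrite expr2 mulrCA.
have : L2 / 2 * `|s| @[s --> (0 : R)] --> L2 / 2 * `|0 : R|.
  apply: cvgM; first exact: cvg_cst.
  by apply: cvg_norm; exact: cvg_id.
by rewrite normr0 mulr0.
Qed.

Lemma objective_quadratic x y :
  `|f y - f x - dotv (grad f x) (y - x)| <= L2 / 2 * l2norm (y - x) ^+ 2.
Proof. by rewrite grad_objective; exact: objective_quadratic_G. Qed.

Lemma measurable_grad_objective : measurable_fun setT (grad f).
Proof.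
apply: measurable_fun_rV => j.
rewrite (_ : (fun _ => _) = (fun x => \int[P]_u (fun z => g z.1 z.2 ord0 j) (x, u))).
  exact: (measurable_param_integral (measurable_coord j (sp_measg hF))).
by apply/funext => x; rewrite grad_objective mxE.
Qed.

Lemma grad_noise_mean x v :
  P.-integrable setT (EFin \o (fun u => dotv (grad_noise x u) v)) /\
  \int[P]_u dotv (grad_noise x u) v = 0.
Proof.
have [i e] := dotv_sample_gradient x v.
have ic : P.-integrable setT (EFin \o (fun=> dotv (grad f x) v) : X -> \bar R).
  exact: finite_measure_integrable_cst.
have E u : dotv (grad_noise x u) v = dotv (g x u) v - dotv (grad f x) v.
  by rewrite /grad_noise dotvDl dotvNl.
split.
  by have := integrableB measurableT i ic; apply: eq_integrable => // u _ /=; rewrite E.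
under eq_Rintegral do rewrite E.
rewrite (RintegralB measurableT i ic) e (Rintegral_probability_cst P).
by rewrite grad_objective subrr.
Qed.

Lemma objective_convex (t : R) x y : 0 <= t <= 1 ->
  f (t *: x + (1 - t) *: y) <= t * f x + (1 - t) * f y.
Proof.
move=> /andP[t0 t1].
have [_ cv] := sp_convex hF.
have := cv (Itv01 t0 t1) x y; rewrite !in_setT => /(_ isT isT).
by rewrite !convRE.
Qed.

(** Convexity on a short segment from x towards y, compared with the quadratic bound, leaves an
    error s k that vanishes with s. *)
Lemma gradient_inequality x y : f x - f y <= dotv (grad f x) (x - y).
Proof.
set D := dotv _ _; set k := L2 / 2 * l2norm (y - x) ^+ 2.
have k0 : 0 <= k by rewrite mulr_ge0 ?sqr_ge0// divr_ge0// ltW// (sp_L2_gt0 hF).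
have H s : 0 < s -> s <= 1 -> f x - f y <= D + s * k.
  move=> s0 s1; have c := @objective_convex s y x; rewrite (ltW s0) s1 in c.
  have {c} := c isT; set z := _ + _ => c.
  have zx : z - x = s *: (y - x).
    by apply/rowP => j; rewrite !mxE; ring.
  have := objective_quadratic x z; rewrite zx l2normZ dotvZr exprMn.
  rewrite real_normK ?num_real// (_ : dotv _ (y - x) = - D); last first.
    by rewrite /D !dotvE; ring.
  rewrite (_ : L2 / 2 * _ = s ^+ 2 * k); last by rewrite /k; ring.
  rewrite ler_norml => /andP[h _].
  have : s * (f x - f y) <= s * (D + s * k).
    by move: h c; rewrite expr2; clear; nra.
  by rewrite ler_pM2l.
apply/ler_addgt0Pr => e e0.
(* Small enough for s k <= e; the 1 added to k covers k = 0. *)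
pose s := Num.min 1 (e / (k + 1)).
have ek : 0 < e / (k + 1) by rewrite divr_gt0// ltr_wpDl.
have s0 : 0 < s by rewrite lt_min ltr01.
have s1 : s <= 1 by rewrite ge_min lexx.
apply: (le_trans (H s s0 s1)); rewrite lerD2l.
have : s <= e / (k + 1) by rewrite ge_min lexx orbT.
rewrite ler_pdivlMr ?ltr_wpDl// => h; apply: le_trans h.
by rewrite ler_wpM2l ?(ltW s0)// lerDl.
Qed.

(** A gradient step of length 1 / L2 lowers f by at least |grad f x|^2 / (2 L2), and cannot go below
    the minimum. *)
Lemma gradient_sqr_bound xs x : is_minimizer f xs ->
  l2norm (grad f x) ^+ 2 <= 2 * L2 * (f x - f xs).
Proof.
move=> hm; have l0 := sp_L2_gt0 hF.
have := objective_quadratic x (x - L2^-1 *: grad f x); set z := x - _.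
have -> : z - x = - L2^-1 *: grad f x by rewrite /z scaleNr addrAC subrr add0r.
rewrite l2normZ dotvZr -l2normE ler_norml => /andP[_].
rewrite exprMn real_normK ?num_real//.
have := hm z; set q := l2norm _ ^+ 2; set a := f z; set b := f x; set c := f xs.
move=> ca h.
have : b - c >= q / (2 * L2).
  have e : L2 / 2 * ((- L2^-1) ^+ 2 * q) = q / (2 * L2).
    by field; rewrite gt_eqF.
  have e2 : - L2^-1 * q = - (2 * (q / (2 * L2))) by field; rewrite gt_eqF.
  by move: h; rewrite e e2; lra.
by rewrite ler_pdivrMr ?mulr_gt0// mulrC.
Qed.

Lemma objective_mean (N : nat) (x : nat -> 'rV[R]_n) : (0 < N)%N ->
  f (N%:R^-1 *: \sum_(k < N) x k) <= N%:R^-1 * \sum_(k < N) f (x k).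
Proof.
case: N => // N _; elim: N => [|N IH].
  by rewrite !big_ord1 invr1 scale1r mul1r.
set t := (N.+1%:R / N.+2%:R : R).
have N1 : 0 < N.+1%:R :> R by rewrite ltr0n.
have N2 : 0 < N.+2%:R :> R by rewrite ltr0n.
have N12 : N.+2%:R = N.+1%:R + 1 :> R by rewrite natr1.
have t01 : 0 <= t <= 1.
  by rewrite divr_ge0 ?(ltW N1) ?(ltW N2)//= ler_pdivrMr// mul1r ler_nat.
have t1 : 1 - t = N.+2%:R^-1 by rewrite /t N12; field.
have tN : t / N.+1%:R = N.+2%:R^-1 by rewrite /t; field; rewrite !gt_eqF.
rewrite big_ord_recr [in leRHS]big_ord_recr/=.
have := objective_convex (N.+1%:R^-1 *: \sum_(k < N.+1) x k) (x N.+1) t01.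
rewrite scalerA t1 tN -scalerDr => /le_trans; apply.
rewrite mulrDr lerD2r -tN -[leRHS]mulrA.
by case/andP: t01 => t0 _; exact: ler_wpM2l.
Qed.

End stochastic_objective.

(** * Expectations with one independent draw integrated out *)

Section independent_expectations.
Context {d d' : measure_display} {Om : measurableType d} {T : measurableType d'}.
Context {R : realType} (Pr : probability Om R) (S : set (set Om)).
Variable Z : {RV Pr >-> T}.
Hypothesis Sm : <<s S >> `<=` measurable.
Hypothesis ind : forall A B, <<s S >> A -> measurable B ->
  Pr (A `&` Z @^-1` B) = (Pr A * Pr (Z @^-1` B))%E.
Local Notation OmS := (g_sigma_algebraType S).

Lemma measurable_independent_pair (h : OmS * T -> R) : measurable_fun setT h ->
  measurable_fun setT (fun w : Om => h (w, Z w)).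
Proof. by move=> mh; exact: (measurableT_comp mh (measurable_coarse_pair Z Sm)). Qed.

(** Nonnegativity lets Tonelli deliver integrability along with the bound; q majorises the
    conditional expectation. *)
Lemma independent_le (h : OmS * T -> R) (q : Om -> R) :
  measurable_fun setT h -> (forall z, 0 <= h z) ->
  Pr.-integrable setT (EFin \o q) ->
  (forall w, \int[distribution Pr Z]_z (h (w, z))%:E <= (q w)%:E)%E ->
  Pr.-integrable setT (EFin \o (fun w => h (w, Z w))) /\
  \int[Pr]_w h (w, Z w) <= \int[Pr]_w q w.
Proof.
move=> mh h0 iq hq.
have mhE : measurable_fun setT (EFin \o h) by exact/measurable_EFinP.
have h0E z : (0 <= (EFin \o h) z)%E by rewrite lee_fin.
have mw : measurable_fun setT (fun w : Om => h (w, Z w)).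
  exact: measurable_independent_pair.
have E := independent_fubini_tonelli Sm ind mhE h0E.
have mq : measurable_fun setT (EFin \o q) by exact: measurable_int iq.
have le : (\int[Pr]_w (h (w, Z w))%:E <= \int[Pr]_w (q w)%:E)%E.
  rewrite [leLHS]E; apply: ge0_le_integral => //.
  - by move=> w _; exact: integral_ge0.
  - have mF := measurable_fun_fubini_tonelli_F (m2 := distribution Pr Z) _ mhE h0E.
    exact: (measurableT_comp mF (measurable_coarse Sm)).
  - by move=> w _; exact: hq.
have iw : Pr.-integrable setT (EFin \o (fun w => h (w, Z w))).
  apply/integrableP; split; first exact/measurable_EFinP.
  under eq_integral do rewrite /= ger0_norm//.
  by apply: (le_lt_trans le); exact: integrable_lty.
split => //; rewrite /Rintegral fine_le//.
- exact: (integrable_fin_num measurableT iw).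
- exact: (integrable_fin_num measurableT iq).
Qed.

Lemma independent_eq (h : OmS * T -> R) (q : Om -> R) :
  measurable_fun setT h ->
  Pr.-integrable setT (EFin \o (fun w => h (w, Z w))) ->
  (forall w, \int[distribution Pr Z]_z (h (w, z))%:E = (q w)%:E)%E ->
  \int[Pr]_w h (w, Z w) = \int[Pr]_w q w.
Proof.
move=> mh ih hq; rewrite /Rintegral (independent_fubini Sm ind mh ih).
by congr fine; apply: eq_integral => w _; exact: hq.
Qed.

End independent_expectations.

Section weighted_quadratic.
Context {d : measure_display} {Om : measurableType d} {R : realType} {n : nat}.
Context (Pr : probability Om R) (S : set (set Om)).
Variable Z : {RV Pr >-> 'rV[R]_n}.
Hypothesis Sm : <<s S >> `<=` measurable.
Hypothesis ind : forall A B, <<s S >> A -> measurable B ->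
  Pr (A `&` Z @^-1` B) = (Pr A * Pr (Z @^-1` B))%E.
Hypothesis uZ : uniform_on_sphere (distribution Pr Z).
Local Notation OmS := (g_sigma_algebraType S).
Implicit Types (s v : OmS -> 'rV[R]_n).

Lemma sphere_bilinear_integrable A B r (s t : 'rV[R]_n) :
  (distribution Pr Z).-integrable setT
    (EFin \o (fun x => dotv s x * dotv t x * weight A B r x)).
Proof.
apply: (sphere_integrable uZ (M := l2norm s * l2norm t * (`|A| + `|B| * n%:R))).
  apply: measurable_funM; last exact: measurable_weight.
  by apply: measurable_funM; apply: measurable_dotv => //; exact: measurable_cst.
move=> x x1; rewrite normrM ler_pM//; last exact: weight_bound.
rewrite normrM ler_pM// (le_trans (norm_dotv_le _ _))// x1 mulr1//.
Qed.

Lemma sphere_bilinear_EFin A B r (s t : 'rV[R]_n) :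
  (\int[distribution Pr Z]_x (dotv s x * dotv t x * weight A B r x)%:E =
   (dotv s t / n%:R * \int[distribution Pr Z]_x weight A B r x)%:E)%E.
Proof.
rewrite -(sphere_bilinear uZ) /Rintegral fineK//.
exact: (integrable_fin_num measurableT (sphere_bilinear_integrable A B r s t)).
Qed.

(** With the coarse events frozen s is a fixed vector, and the inner integral is [sphere_bilinear]
    with both vectors equal to it. *)
Lemma weighted_quadratic_le A B r (rho : R) s : 0 <= A -> 0 <= B ->
  \int[distribution Pr Z]_x weight A B r x <= rho ->
  measurable_fun setT s ->
  Pr.-integrable setT (EFin \o (fun w => l2norm (s w) ^+ 2)) ->
  Pr.-integrable setT
    (EFin \o (fun w => dotv (s w) (Z w) ^+ 2 * weight A B r (Z w))) /\
  \int[Pr]_w (dotv (s w) (Z w) ^+ 2 * weight A B r (Z w)) <=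
  rho / n%:R * \int[Pr]_w (l2norm (s w) ^+ 2).
Proof.
move=> A0 B0 W ms i2; rewrite -RintegralZl//.
pose h (z : OmS * 'rV[R]_n) := dotv (s z.1) z.2 ^+ 2 * weight A B r z.2.
have w0 x : 0 <= weight A B r x :> R by exact: weight_ge0.
apply: (@independent_le _ _ _ _ _ Pr S Z Sm ind h (fun w => rho / n%:R * l2norm (s w) ^+ 2)).
- apply: measurable_funM.
    apply: measurable_funX; apply: measurable_dotv => //.
    exact: (measurableT_comp ms measurable_fst).
  exact: (measurableT_comp (measurable_weight A B r) measurable_snd).
- by move=> z; rewrite mulr_ge0// sqr_ge0.
- by have := integrableZl measurableT (rho / n%:R) i2; apply: eq_integrable.
- move=> w; rewrite /h/=; under eq_integral do rewrite expr2.
  rewrite sphere_bilinear_EFin lee_fin l2normE [leRHS]mulrC -mulrA.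
  rewrite ler_wpM2l//; first by rewrite -l2normE sqr_ge0.
  by rewrite mulrC ler_wpM2r// invr_ge0.
Qed.

Lemma quadratic_le s : measurable_fun setT s ->
  Pr.-integrable setT (EFin \o (fun w => l2norm (s w) ^+ 2)) ->
  Pr.-integrable setT (EFin \o (fun w => dotv (s w) (Z w) ^+ 2)) /\
  \int[Pr]_w (dotv (s w) (Z w) ^+ 2) <= n%:R^-1 * \int[Pr]_w (l2norm (s w) ^+ 2).
Proof.
move=> ms i2; have w1 y : weight 1 0 0 y = 1 :> R by rewrite /weight mul0r addr0.
have W1 : \int[distribution Pr Z]_y weight 1 0 0 y <= 1 :> R.
  by under eq_Rintegral do rewrite w1; rewrite Rintegral_probability_cst.
have E : (fun w => dotv (s w) (Z w) ^+ 2 * weight 1 0 0 (Z w))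
    = (fun w => dotv (s w) (Z w) ^+ 2) by apply/funext => w; rewrite w1 mulr1.
by have := weighted_quadratic_le ler01 (lexx 0) W1 ms i2; rewrite E div1r.
Qed.

Lemma bilinear_eq s v : measurable_fun setT s -> measurable_fun setT v ->
  Pr.-integrable setT (EFin \o (fun w => dotv (s w) (Z w) * dotv (v w) (Z w))) ->
  \int[Pr]_w (dotv (s w) (Z w) * dotv (v w) (Z w)) =
  \int[Pr]_w (dotv (s w) (v w) / n%:R).
Proof.
move=> ms mv ih.
pose h (z : OmS * 'rV[R]_n) := dotv (s z.1) z.2 * dotv (v z.1) z.2.
apply: (@independent_eq _ _ _ _ _ Pr S Z Sm ind h) => //.
  apply: measurable_funM; apply: measurable_dotv => //.
    exact: (measurableT_comp ms measurable_fst).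
  exact: (measurableT_comp mv measurable_fst).
move=> w; have := sphere_bilinear_EFin 1 0 0 (s w) (v w).
have w1 x : weight 1 0 0 x = 1 :> R by rewrite /weight mul0r addr0.
under eq_integral do rewrite w1 mulr1.
by move=> ->; under eq_Rintegral do rewrite w1; rewrite Rintegral_probability_cst mulr1.
Qed.

End weighted_quadratic.

Section integrability_tools.
Context {d : measure_display} {T : measurableType d} {R : realType}.
Variable mu : {measure set T -> \bar R}.
Implicit Types h k : T -> R.

Lemma integrable_scale (a : R) h : mu.-integrable setT (EFin \o h) ->
  mu.-integrable setT (EFin \o (fun x => a * h x)).
Proof. by move=> i; have := integrableZl measurableT a i; apply: eq_integrable. Qed.

Lemma integrable_add h k : mu.-integrable setT (EFin \o h) ->
  mu.-integrable setT (EFin \o k) ->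
  mu.-integrable setT (EFin \o (fun x => h x + k x)).
Proof. by move=> i j; have := integrableD measurableT i j; apply: eq_integrable. Qed.

Lemma integrable_sub h k : mu.-integrable setT (EFin \o h) ->
  mu.-integrable setT (EFin \o k) ->
  mu.-integrable setT (EFin \o (fun x => h x - k x)).
Proof. by move=> i j; have := integrableB measurableT i j; apply: eq_integrable. Qed.

Lemma integrable_mul_sqr (a b c : T -> R) :
  measurable_fun setT a -> measurable_fun setT b -> measurable_fun setT c ->
  (forall x, 0 <= c x) ->
  mu.-integrable setT (EFin \o (fun x => a x ^+ 2 * c x)) ->
  mu.-integrable setT (EFin \o (fun x => b x ^+ 2 * c x)) ->
  mu.-integrable setT (EFin \o (fun x => a x * b x * c x)).
Proof.
move=> ma mb mc c0 ia ib.
apply: (le_integrable_ae _ (integrable_add ia ib)).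
  by apply: measurable_funM => //; exact: measurable_funM.
apply: aeW => x; rewrite -mulrDl normrM (ger0_norm (c0 x)) ler_wpM2r// normrM.
rewrite -[a x ^+ 2]real_normK ?num_real// -[b x ^+ 2]real_normK ?num_real//.
have := normr_ge0 (a x); have := normr_ge0 (b x).
by move: `|a x| `|b x| => u v; nra.
Qed.

Lemma integrable_mul (a b : T -> R) :
  measurable_fun setT a -> measurable_fun setT b ->
  mu.-integrable setT (EFin \o (fun x => a x ^+ 2)) ->
  mu.-integrable setT (EFin \o (fun x => b x ^+ 2)) ->
  mu.-integrable setT (EFin \o (fun x => a x * b x)).
Proof.
move=> ma mb ia ib; apply: (le_integrable_ae _ (integrable_add ia ib)).
  exact: measurable_funM.
apply: aeW => x; rewrite normrM.
rewrite -[a x ^+ 2]real_normK ?num_real// -[b x ^+ 2]real_normK ?num_real//.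
have := normr_ge0 (a x); have := normr_ge0 (b x).
by move: `|a x| `|b x| => u v; nra.
Qed.

Definition has_mean h (k : R) :=
  mu.-integrable setT (EFin \o h) /\ \int[mu]_x h x = k.

Lemma has_mean_int h : mu.-integrable setT (EFin \o h) ->
  has_mean h (\int[mu]_x h x).
Proof. by []. Qed.

Lemma has_meanD h k (a b : R) : has_mean h a -> has_mean k b ->
  has_mean (fun x => h x + k x) (a + b).
Proof.
move=> [ih eh] [ik ek]; split; first exact: integrable_add.
by rewrite RintegralD// eh ek.
Qed.

Lemma has_meanB h k (a b : R) : has_mean h a -> has_mean k b ->
  has_mean (fun x => h x - k x) (a - b).
Proof.
move=> [ih eh] [ik ek]; split; first exact: integrable_sub.
by rewrite RintegralB// eh ek.
Qed.

Lemma has_meanZ h (l a : R) : has_mean h a -> has_mean (fun x => l * h x) (l * a).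
Proof.
move=> [ih eh]; split; first exact: integrable_scale.
by rewrite RintegralZl// eh.
Qed.

Lemma has_mean_sum (I : Type) (r : seq I) (h : I -> T -> R) (a : I -> R) :
  (forall i, has_mean (h i) (a i)) ->
  has_mean (fun x => \sum_(i <- r) h i x) (\sum_(i <- r) a i).
Proof.
move=> ha; have i i0 := (ha i0).1; split; first exact: integrable_sumR.
by rewrite Rintegral_sum//; apply: eq_bigr => i0 _; exact: (ha i0).2.
Qed.

End integrability_tools.

Lemma ae_distribution {d d' : measure_display} {Om : measurableType d}
  {T : measurableType d'} {R : realType} (Pr : probability Om R)
  (Z : {RV Pr >-> T}) (P : {measure set T -> \bar R}) (Q : T -> Prop) :
  (forall A, measurable A -> distribution Pr Z A = P A) ->
  {ae P, forall u, Q u} -> {ae Pr, forall w, Q (Z w)}.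
Proof.
move=> ZP [A [mA A0 QA]]; exists (Z @^-1` A); split.
- by rewrite -[X in measurable X]setTI; exact: (measurable_funPT Z).
- by have := ZP A mA; rewrite A0.
- by move=> w /= nQ; apply: QA.
Qed.

Lemma Rintegral_distribution {d d' : measure_display} {Om : measurableType d}
  {T : measurableType d'} {R : realType} (Pr : probability Om R)
  (Z : {RV Pr >-> T}) (P : {measure set T -> \bar R}) (h : T -> R) :
  (forall A, measurable A -> distribution Pr Z A = P A) ->
  measurable_fun setT h -> (forall u, 0 <= h u) ->
  P.-integrable setT (EFin \o h) ->
  Pr.-integrable setT (EFin \o (h \o Z)) /\ \int[Pr]_w h (Z w) = \int[P]_u h u.
Proof.
move=> ZP mh h0 ih.
have mhE : measurable_fun setT (EFin \o h) by exact/measurable_EFinP.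
have E : (\int[Pr]_w (h (Z w))%:E = \int[P]_u (h u)%:E)%E.
  rewrite -[LHS](@ge0_integral_distribution _ _ _ _ _ Pr Z (EFin \o h))//.
  - by apply: eq_measure_integral => A mA _; exact: ZP.
split; last by rewrite /Rintegral E.
apply/integrableP; split; first exact: (measurableT_comp mhE (measurable_funPT Z)).
under eq_integral do rewrite /= ger0_norm//.
by rewrite E; exact: integrable_lty.
Qed.

(** * One step of the method *)

Section estimator.
Context {R : realType} {n : nat} {d : measure_display} {X : measurableType d}.
Variable P : probability X R.
Variables (F eta : 'rV[R]_n -> X -> R) (g : 'rV[R]_n -> X -> 'rV[R]_n).
Variables (L : X -> R) (Delta t : R).
Hypothesis t0 : 0 < t.
Implicit Types (x y e v : 'rV[R]_n).

Lemma dotv_suml (I : Type) (r : seq I) (s : I -> 'rV[R]_n) y :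
  dotv (\sum_(i <- r) s i) y = \sum_(i <- r) dotv (s i) y.
Proof.
rewrite /dotv exchange_big/=; apply: eq_bigr => j _.
by rewrite summxE mulr_suml.
Qed.

Lemma sqr_mean_le m (s : 'I_m -> R) : (0 < m)%N ->
  (\sum_i m%:R^-1 * s i) ^+ 2 <= \sum_i m%:R^-1 * s i ^+ 2.
Proof.
move=> m0; have mR : m%:R != 0 :> R by rewrite pnatr_eq0 -lt0n.
set a := \sum_i _; rewrite -subr_ge0.
have -> : \sum_i m%:R^-1 * s i ^+ 2 - a ^+ 2 = \sum_i m%:R^-1 * (s i - a) ^+ 2.
  have -> : a ^+ 2 = \sum_i (2 * a * (m%:R^-1 * s i) - m%:R^-1 * a ^+ 2).
    rewrite sumrB -mulr_sumr -/a sumr_const card_ord -[_ *+ m]mulr_natl (mulrA m%:R) mulfV//.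
    by rewrite mul1r; ring.
  by rewrite -sumrB; apply: eq_bigr => i _; ring.
by apply: sumr_ge0 => i _; rewrite mulr_ge0 ?sqr_ge0// invr_ge0.
Qed.

(** What the directional derivative leaves unexplained in a finite difference: the curvature of F
    along e and the two noise values. *)
Definition difference_error x e u :=
  (noisy F eta (x + t *: e) u - noisy F eta x u) / t - dotv (g x u) e.

(** The error is (a + c) / t with |a| <= L t^2 / 2 from smoothness and |c| <= 2 Delta from the
    noise; then (a + c)^2 <= 2 a^2 + 2 c^2. *)
Lemma difference_error_sqr x e u : l2norm e = 1 ->
  (forall y, has_gradient (F ^~ u) y (g y u)) ->
  (forall y z, l2norm (g y u - g z u) <= L u * l2norm (y - z)) ->
  (forall y, `|eta y u| <= Delta) ->
  difference_error x e u ^+ 2 <= t ^+ 2 / 2 * L u ^+ 2 + 8 * Delta ^+ 2 / t ^+ 2.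
Proof.
move=> e1 hg hl hD.
have := gradient_quadratic_bound hg hl x (x + t *: e).
rewrite (addrC x) addrK l2normZ e1 mulr1 real_normK ?num_real// dotvZr => B.
set a := F (_ + _) u - F x u - t * dotv (g x u) e in B.
pose c := eta (t *: e + x) u - eta x u.
have cD : `|c| <= 2 * Delta.
  by rewrite (le_trans (ler_normB _ _))// mulr_natl lerD.
have -> : difference_error x e u = (a + c) / t.
  rewrite /difference_error /noisy /a /c (addrC x); field.
  by rewrite gt_eqF.
have a2 : a ^+ 2 <= (L u / 2 * t ^+ 2) ^+ 2.
  by rewrite -real_normK ?num_real//; exact: ler_sqr_ge0.
have c2 : c ^+ 2 <= (2 * Delta) ^+ 2.
  by rewrite -real_normK ?num_real//; exact: ler_sqr_ge0.
rewrite expr_div_n ler_pdivrMr ?exprn_gt0//.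
rewrite mulrDl divfK ?expf_neq0 ?gt_eqF//.
apply: (@le_trans _ _ (2 * a ^+ 2 + 2 * c ^+ 2)).
  by have := sqr_ge0 (a - c); lra.
by move: a2 c2; rewrite !exprMn; lra.
Qed.

Variable m : nat.
Hypothesis m0 : (0 < m)%N.
Variables (f : 'rV[R]_n -> R) (us : 'I_m -> X).

Definition mean_noise x : 'rV[R]_n := m%:R^-1 *: \sum_i (g x (us i) - grad f x).

Definition error_bound : R :=
  \sum_i m%:R^-1 * (t ^+ 2 / 2 * L (us i) ^+ 2 + 8 * Delta ^+ 2 / t ^+ 2).

Lemma grad_approxE x e : grad_approx F eta t x e us =
  (dotv (grad f x) e + dotv (mean_noise x) e
   + \sum_i m%:R^-1 * difference_error x e (us i)) *: e.
Proof.
have -> : grad_approx F eta t x e us = (\sum_i m%:R^-1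
    * ((noisy F eta (x + t *: e) (us i) - noisy F eta x (us i)) / t)) *: e.
  rewrite /grad_approx scaler_sumr scaler_suml; apply: eq_bigr => i _.
  by rewrite scalerA.
congr (_ *: _).
have mR : m%:R != 0 :> R by rewrite pnatr_eq0 -lt0n.
have -> : dotv (grad f x) e = \sum_(i < m) m%:R^-1 * dotv (grad f x) e.
  by rewrite sumr_const card_ord -[_ *+ m]mulr_natl mulrA mulfV// mul1r.
have -> : dotv (mean_noise x) e
    = \sum_i m%:R^-1 * dotv (g x (us i) - grad f x) e.
  by rewrite /mean_noise dotvZl dotv_suml mulr_sumr.
rewrite -!big_split; apply: eq_bigr => i _ /=.
by rewrite /difference_error dotvDl dotvNl; ring.
Qed.

(** The error [th] is not centred, so its product with [ev] is split by Young with a free parameter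
    tau. In the square it is separated first, whence the factors 4, 4 and 2. *)
Lemma step_scalar (k tau gf gz th ev w T2 : R) : 0 < tau -> 0 <= k -> 0 <= w ->
  th ^+ 2 <= T2 ->
  - k * ((gf + gz + th) * ev) + 9 / 2 * (k ^+ 2 * (gf + gz + th) ^+ 2 * w) <=
  - k * (gf * ev) - k * (gz * ev) + k * (tau / 2 * T2 + (2 * tau)^-1 * ev ^+ 2)
  + 9 / 2 * k ^+ 2 * (4 * (gf ^+ 2 * w) + 4 * (gz ^+ 2 * w) + 2 * (w * T2)).
Proof.
move=> tau0 k0 w0 thT.
have h1 : - (th * ev) <= tau / 2 * T2 + (2 * tau)^-1 * ev ^+ 2.
  apply: (@le_trans _ _ (tau / 2 * th ^+ 2 + (2 * tau)^-1 * ev ^+ 2)).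
    have : 0 <= tau / 2 * (th + tau^-1 * ev) ^+ 2.
      by rewrite mulr_ge0 ?sqr_ge0// divr_ge0// ltW.
    rewrite (_ : _ * _ ^+ 2 = tau / 2 * th ^+ 2 + (2 * tau)^-1 * ev ^+ 2 + th * ev).
      by lra.
    by field; rewrite gt_eqF.
  by rewrite lerD2r ler_wpM2l// divr_ge0// ltW.
have h2 : (gf + gz + th) ^+ 2 <= 4 * gf ^+ 2 + 4 * gz ^+ 2 + 2 * T2.
  have := sqr_ge0 (gf + gz - th); have := sqr_ge0 (gf - gz); lra.
have k2w : 0 <= 9 / 2 * k ^+ 2 * w by rewrite !mulr_ge0// sqr_ge0.
have := ler_wpM2l k0 h1; have := ler_wpM2l k2w h2; lra.
Qed.

(** The centred cross term in [mean_noise] is kept exactly, because only its expectation vanishes;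
    its absolute value would not gain from averaging. *)
Lemma descent_pointwise (a b c A B : R) (r : nat) (k tau : R) (xs x e : 'rV[R]_n) :
  1 < a -> a <= 2 -> 2 <= b -> a^-1 + b^-1 = 1 -> 0 < c ->
  0 < tau -> 0 <= k -> 0 <= A -> 0 <= B ->
  (b - 1) / c * lnorm b e ^+ 2 <= weight A B r e ->
  l2norm e = 1 ->
  (forall i y, has_gradient (F ^~ (us i)) y (g y (us i))) ->
  (forall i y z, l2norm (g y (us i) - g z (us i)) <= L (us i) * l2norm (y - z)) ->
  (forall i y, `|eta y (us i)| <= Delta) ->
  divergence a c (comirror b c (mirror a c x - k *: grad_approx F eta t x e us)) xs
  <= divergence a c x xs - k * (dotv (grad f x) e * dotv (x - xs) e)
   - k * (dotv (mean_noise x) e * dotv (x - xs) e)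
   + k * (tau / 2 * error_bound + (2 * tau)^-1 * dotv (x - xs) e ^+ 2)
   + 9 / 2 * k ^+ 2 * (4 * (dotv (grad f x) e ^+ 2 * weight A B r e)
     + 4 * (dotv (mean_noise x) e ^+ 2 * weight A B r e)
     + 2 * (weight A B r e * error_bound)).
Proof.
move=> a1 a2 b2 ab c0 tau0 k0 A0 B0 We e1 hg hl hD.
apply: (le_trans (divergence_step a1 b2 ab c0 _ _ _ _)).
rewrite grad_approxE; set th := \sum_i _.
have thT : th ^+ 2 <= error_bound.
  apply: (le_trans (sqr_mean_le _ m0)); apply: ler_sum => i _.
  by rewrite ler_wpM2l ?invr_ge0//; exact: difference_error_sqr.
have w0 : 0 <= weight A B r e by exact: weight_ge0.
set gf := dotv (grad f x) e; set gz := dotv (mean_noise x) e.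
rewrite dotvZl lnormZ; last by apply: lt_le_trans b2; rewrite ltr0n.
rewrite (dotvC e) exprMn real_normK ?num_real//.
have S := step_scalar gf gz (dotv (x - xs) e) tau0 k0 w0 thT.
have Q : 9 / 2 * ((b - 1) / c) * (k ^+ 2 * ((gf + gz + th) ^+ 2 * lnorm b e ^+ 2))
    <= 9 / 2 * (k ^+ 2 * (gf + gz + th) ^+ 2 * weight A B r e).
  have k2 : 0 <= 9 / 2 * (k ^+ 2 * (gf + gz + th) ^+ 2).
    by rewrite mulr_ge0// mulr_ge0 ?sqr_ge0.
  have := ler_wpM2l k2 We; clear; set l := lnorm b e ^+ 2; set w := weight _ _ _ _.
  set s := (gf + gz + th) ^+ 2; set bc := (b - 1) / c; clearbody l w s bc.
  by lra.
move: S Q; clear.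
set w := weight A B r e; set l := 9 / 2 * ((b - 1) / c) * _.
set D := divergence _ _ _ _; set ev := dotv (x - xs) e.
move: error_bound => T2; clearbody w l D ev gf gz th.
by set gs := gf + gz + th => S Q; clearbody gs; lra.
Qed.

End estimator.

(** The growth factor after k steps is bounded by 1 + k/N, which is 2 at the end; this linear form
    keeps the induction elementary. *)
Lemma step_recursion {R : realType} (N : nat) (A phi : nat -> R) (q b : R) :
  (0 < N)%N -> 0 <= q -> 0 <= b -> (forall k, 0 <= A k) -> (forall k, 0 <= phi k) ->
  (forall k, (k < N)%N -> A k.+1 + q * phi k <= A k * (1 + (2 * N%:R)^-1) + b) ->
  q * \sum_(k < N) phi k <= 2 * (A 0%N + N%:R * b).
Proof.
move=> N0 q0 b0 A0 phi0 H; have NR : 0 < N%:R :> R by rewrite ltr0n.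
have S k : (k <= N)%N ->
    A k + q * \sum_(j < k) phi j <= (A 0%N + k%:R * b) * (1 + k%:R / N%:R).
  elim: k => [|k IH] kN; first by rewrite big_ord0 mulr0 !mul0r !addr0 mulr1.
  have {}IH := IH (ltnW kN); have Hk := H k kN.
  rewrite big_ord_recr/= mulrDr; set P := q * _ in IH *.
  have P0 : 0 <= P by rewrite mulr_ge0// sumr_ge0.
  have kR : 0 <= k%:R :> R by [].
  have kN1 : k%:R / N%:R <= 1 :> R by rewrite ler_pdivrMr// mul1r ler_nat ltnW.
  have i0 : 0 < N%:R^-1 :> R by rewrite invr_gt0.
  have e1 : k.+1%:R / N%:R = k%:R / N%:R + N%:R^-1 :> R.
    by rewrite -natr1 mulrDl mul1r.
  have e2 : (2 * N%:R)^-1 = N%:R^-1 / 2 :> R by rewrite invfM mulrC.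
  have k1 : 0 <= k%:R / N%:R :> R by rewrite divr_ge0// ltW.
  have A00 := A0 0%N; have Ak := A0 k.
  rewrite e1 -natr1; rewrite e2 in Hk.
  have kb : 0 <= k%:R * b by rewrite mulr_ge0.
  rewrite (mulrDl k%:R 1 b) mul1r.
  move: (A 0%N) (A k) (A k.+1) (phi k) P (k%:R * b) (N%:R^-1) (k%:R / N%:R)
    IH Hk P0 kN1 i0 k1 A00 Ak kb.
  clear -b0 => a0 a1 a2 p P kb i u IH Hk P0 kN1 i0 k1 A00 Ak kb0.
  have h1 : (a1 + P) * (1 + i / 2) <= (a0 + kb) * (1 + u) * (1 + i / 2).
    by rewrite ler_wpM2r//; lra.
  (* Uses u = k/N <= 1: half of 1/N pays for the growth factor, the other half for its product with
     u. *)
  have h2 : (1 + u) * (1 + i / 2) <= 1 + (u + i) by nra.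
  have h3 : (a0 + kb) * ((1 + u) * (1 + i / 2)) <= (a0 + kb) * (1 + (u + i)).
    by rewrite ler_wpM2l// addr_ge0.
  have h4 : 0 <= b * (u + i) by rewrite mulr_ge0// addr_ge0// ltW.
  have h5 : 0 <= P * (i / 2) by rewrite mulr_ge0// divr_ge0// ltW.
  nra.
have := S N (leqnn N); rewrite mulfV ?gt_eqF// -[1 + 1](natrD R 1 1)/= => SN.
by have AN := A0 N; lra.
Qed.

(** * Expectations along a run *)

Section run.
Context {R : realType} {n : nat} {d : measure_display} {X : measurableType d}.
Variable P : probability X R.
Variables (F : 'rV[R]_n -> X -> R) (g : 'rV[R]_n -> X -> 'rV[R]_n) (L : X -> R).
Variables (L2 sigma : R) (hF : stochastic_problem P F g L L2 sigma).
Variables (eta : 'rV[R]_n -> X -> R) (Delta : R) (heta : bounded_noise P eta Delta).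
Hypothesis n0 : (0 < n)%N.
Context {d' : measure_display} {Om : measurableType d'}.
Variables (Pr : probability Om R) (N m : nat).
Variables (e : 'I_N -> {RV Pr >-> 'rV[R]_n}) (xi : 'I_N -> 'I_m -> {RV Pr >-> X}).
Hypothesis hdraws : rdfds_draws P e xi.
Hypothesis m0 : (0 < m)%N.
Variables (a b c A B rho : R) (r : nat).
Hypotheses (a1 : 1 < a) (a2 : a <= 2) (b2 : 2 <= b) (ab : a^-1 + b^-1 = 1).
Hypotheses (c0 : 0 < c) (bc : (b - 1) / c <= 1) (A0 : 0 <= A) (B0 : 0 <= B).
Hypothesis hW : forall y : 'rV[R]_n, l2norm y = 1 ->
  (b - 1) / c * lnorm b y ^+ 2 <= weight A B r y.
Hypothesis hrho : forall mu : probability 'rV[R]_n R, uniform_on_sphere mu ->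
  \int[mu]_y weight A B r y <= rho.
Variable xs : 'rV[R]_n.
Hypothesis hxs : is_minimizer (objective P F) xs.
Variables (s t : R).
Hypotheses (s0 : 0 <= s) (t0 : 0 < t).
Variables (x00 : 'rV[R]_n) (x : nat -> Om -> 'rV[R]_n).
Hypothesis hx0 : forall w, x 0%N w = x00.
Hypothesis hstep : forall (k : 'I_N) w, x k.+1 w = comirror b c
  (mirror a c (x k w) - s *: grad_approx F eta t (x k w) (e k w) (fun i => xi k i w)).

Local Notation f := (objective P F).
Local Notation I := ('I_N + 'I_N * 'I_m)%type.

Let G (j : I) : set (set Om) := match j with
  | inl k => generated_by (e k)
  | inr ki => generated_by (xi ki.1 ki.2)
  end.

Local Notation alg J := (joint_draws G J).
Local Notation OmJ J := (g_sigma_algebraType (joint_draws G J)).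

Let Gm j : G j `<=` measurable.
Proof.
by case: j => [k|ki] _ [C mC <-]; [exact: (measurable_funPT (e k))|
  exact: (measurable_funPT (xi ki.1 ki.2))].
Qed.

Let GI j : setI_closed (G j).
Proof.
case: j => [k|ki] _ _ [C1 mC1 <-] [C2 mC2 <-]; exists (C1 `&` C2);
  by [exact: measurableI|rewrite !setTI preimage_setI].
Qed.

Let GT j : G j setT.
Proof. by case: j => [k|ki]; exists setT; rewrite ?preimage_setT ?setTI. Qed.

Let alg_sub (J : {set I}) : <<s alg J >> `<=` measurable.
Proof. exact: joint_draws_measurable Gm J. Qed.

Let ind_e (k : 'I_N) (J : {set I}) : inl k \notin J ->
  forall C D, <<s alg J >> C -> measurable D ->
  Pr (C `&` e k @^-1` D) = (Pr C * Pr (e k @^-1` D))%E.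
Proof.
have [_ _ ind] := hdraws; move=> kJ C D sC mD.
apply: (joint_draws_independent Gm GI GT (j := inl k) ind kJ sC).
by exists D => //; rewrite setTI.
Qed.

Let ind_xi (k : 'I_N) (i : 'I_m) (J : {set I}) : inr (k, i) \notin J ->
  forall C D, <<s alg J >> C -> measurable D ->
  Pr (C `&` xi k i @^-1` D) = (Pr C * Pr (xi k i @^-1` D))%E.
Proof.
have [_ _ ind] := hdraws; move=> kJ C D sC mD.
apply: (joint_draws_independent Gm GI GT (j := inr (k, i)) ind kJ sC).
by exists D => //; rewrite setTI.
Qed.

Let meas_e (k : 'I_N) (J : {set I}) : inl k \in J ->
  measurable_fun (setT : set (OmJ J)) (e k : OmJ J -> 'rV[R]_n).
Proof.
move=> kJ _ C mC; rewrite setTI; apply: sub_sigma_algebra.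
by exists (inl k) => //; exists C => //; rewrite setTI.
Qed.

Let meas_xi (k : 'I_N) (i : 'I_m) (J : {set I}) : inr (k, i) \in J ->
  measurable_fun (setT : set (OmJ J)) (xi k i : OmJ J -> X).
Proof.
move=> kJ _ C mC; rewrite setTI; apply: sub_sigma_algebra.
by exists (inr (k, i)) => //; exists C => //; rewrite setTI.
Qed.

Let meas_sub d3 (T : measurableType d3) (J J' : {set I}) (h : Om -> T) :
  J \subset J' -> measurable_fun (setT : set (OmJ J)) h ->
  measurable_fun (setT : set (OmJ J')) h.
Proof.
move=> JJ mh _ C mC; rewrite setTI; have := mh measurableT C mC; rewrite setTI.
apply: smallest_sub; first exact: smallest_sigma_algebra.
move=> D [j jJ GD]; apply: sub_sigma_algebra; exists j => //.
exact: (fintype.subsetP JJ).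
Qed.

Let meas_Om d3 (T : measurableType d3) (J : {set I}) (h : Om -> T) :
  measurable_fun (setT : set (OmJ J)) h -> measurable_fun (setT : set Om) h.
Proof.
move=> mh _ C mC; rewrite setTI; apply: (alg_sub (J := J)).
by have := mh measurableT C mC; rewrite setTI.
Qed.

Let iteration (j : I) : nat := match j with inl k => k | inr ki => ki.1 end.
(** The draws with index k produce [x k.+1], so [x k] depends only on strictly smaller indices. *)
Let past (k : nat) : {set I} := [set j | (iteration j < k)%N].

Let measurable_joint d3 (S : measurableType d3) (h : 'rV[R]_n -> X -> R)
    (y : S -> 'rV[R]_n) (u : S -> X) :
  measurable_fun setT (fun z : 'rV[R]_n * X => h z.1 z.2) ->
  measurable_fun setT y -> measurable_fun setT u ->
  measurable_fun setT (fun w => h (y w) (u w)).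
Proof.
by move=> mh my mu; exact: (measurableT_comp mh (measurable_fun_pair my mu)).
Qed.

Lemma run_measurable k : (k <= N)%N ->
  measurable_fun (setT : set (OmJ (past k))) (x k).
Proof.
elim: k => [|k IH] kN.
  rewrite (_ : x 0%N = cst x00); first exact: measurable_cst.
  by apply/funext => w; rewrite hx0.
have {}IH := IH (ltnW kN).
pose k' := Ordinal kN.
have sub : past k \subset past k.+1.
  by apply/fintype.subsetP => j; rewrite !inE; exact: ltnW.
have mx : measurable_fun (setT : set (OmJ (past k.+1))) (x k) by exact: meas_sub IH.
have me : measurable_fun (setT : set (OmJ (past k.+1))) (e k').
  by apply: meas_e; rewrite inE/=.
have mxi i : measurable_fun (setT : set (OmJ (past k.+1))) (xi k' i).
  by apply: meas_xi; rewrite inE/=.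
rewrite (_ : x k.+1 = (fun w => comirror b c (mirror a c (x k w)
    - s *: grad_approx F eta t (x k w) (e k' w) (fun i => xi k' i w)))); last first.
  by apply/funext => w; exact: (hstep k').
rewrite /comirror /mirror /grad_approx.
apply: measurable_rV_scale; first exact: measurable_cst.
apply: measurable_dual_map; apply: measurable_rV_sub.
  apply: measurable_rV_scale; first exact: measurable_cst.
  exact: measurable_dual_map.
apply: measurable_rV_scale; first exact: measurable_cst.
apply: measurable_rV_scale; first exact: measurable_cst.
apply: measurable_rV_sum => i; apply: measurable_rV_scale => //.
have mxe : measurable_fun (setT : set (OmJ (past k.+1))) (fun w => x k w + t *: e k' w).
  by apply: measurable_rV_add => //; apply: measurable_rV_scale => //; exact: measurable_cst.
apply: measurable_funM; last exact: measurable_cst.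
rewrite /oracle/= /noisy.
by apply: measurable_funB; apply: measurable_funD;
  [exact: (measurable_joint (sp_measF hF))|exact: (measurable_joint (bn_meas heta))|
   exact: (measurable_joint (sp_measF hF))|exact: (measurable_joint (bn_meas heta))].
Qed.

Let D k w := divergence a c (x k w) xs.

Lemma run_divergence_ge k w : l2norm (x k w - xs) ^+ 2 <= 18 * D k w.
Proof.
have := l2norm_divergence a1 b2 ab c0 (x k w) xs bc.
by rewrite -opprB -lnorm2E lnormN lnorm2E.
Qed.

Lemma run_divergence_ge0 k w : 0 <= D k w.
Proof. by have := run_divergence_ge k w; have := sqr_ge0 (l2norm (x k w - xs)); lra. Qed.

Lemma measurable_run_divergence k : (k <= N)%N -> measurable_fun (setT : set Om) (D k).
Proof.
move=> kN; have mx := meas_Om (run_measurable kN).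
have mp : measurable_fun setT (fun w => potential a c (x k w)).
  apply: measurable_funM; first exact: measurable_cst.
  apply: measurable_funM; first exact: measurable_cst.
  by apply: measurable_funX; exact: measurable_lnorm.
have mm : measurable_fun setT (fun w => mirror a c (x k w)).
  apply: measurable_rV_scale; first exact: measurable_cst.
  exact: measurable_dual_map.
have md : measurable_fun setT (fun w => dotv (mirror a c (x k w)) (xs - x k w)).
  apply: measurable_dotv => //.
  by apply: measurable_rV_sub => //; exact: measurable_cst.
have mc : measurable_fun setT (fun w : Om => potential a c xs) by exact: measurable_cst.
exact: (measurable_funB (measurable_funB mc mp) md).
Qed.

(** * Expectations of the terms in one step *)

Section one_step.
Variable k : 'I_N.
(** Integrability of the divergence controls all other terms of the step, and [run_step] returns it
    for the next iterate. *)
Hypothesis iD : Pr.-integrable setT (EFin \o D k).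

Let v w := x k w - xs.
Let gr w := grad f (x k w).
Let z i w := grad_noise P F g (x k w) (xi k i w).
Let gap w := f (x k w) - f xs.
Let W w := weight A B r (e k w).
Let bound w := error_bound L Delta t (fun i => xi k i w).
Let delta := t ^+ 2 / 2 * L2 ^+ 2 + 8 * Delta ^+ 2 / t ^+ 2.

Let past_e : inl k \notin past k. Proof. by rewrite inE ltnn. Qed.
Let past_xi i : inr (k, i) \notin past k. Proof. by rewrite inE ltnn. Qed.

Let past_x (J : {set I}) : past k \subset J -> measurable_fun (setT : set (OmJ J)) (x k).
Proof. by move=> sub; apply: meas_sub sub _; apply: run_measurable; exact: ltnW. Qed.

Let meas_v (J : {set I}) : past k \subset J -> measurable_fun (setT : set (OmJ J)) v.
Proof. by move=> /past_x mx; apply: measurable_rV_sub => //; exact: measurable_cst. Qed.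

Let meas_gr (J : {set I}) : past k \subset J -> measurable_fun (setT : set (OmJ J)) gr.
Proof.
by move=> /past_x mx; exact: (measurableT_comp (measurable_grad_objective hF n0) mx).
Qed.

Let meas_noise : measurable_fun setT (fun q : 'rV[R]_n * X => grad_noise P F g q.1 q.2).
Proof.
apply: measurable_rV_sub; first exact: sp_measg hF.
exact: (measurableT_comp (measurable_grad_objective hF n0) measurable_fst).
Qed.

Let meas_z (i : 'I_m) (J : {set I}) : past k \subset J -> inr (k, i) \in J ->
  measurable_fun (setT : set (OmJ J)) (z i).
Proof.
move=> /past_x mx /meas_xi mxi.
exact: (measurableT_comp meas_noise (measurable_fun_pair mx mxi)).
Qed.

Lemma run_sqr_integrable : Pr.-integrable setT (EFin \o (fun w => l2norm (v w) ^+ 2)).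
Proof.
apply: (le_integrable_ae _ (integrable_scale 18 iD)).
  by apply: measurable_l2norm_sqr; apply: (@meas_Om _ _ (past k)); exact: meas_v.
apply: aeW => w; rewrite ger0_norm ?sqr_ge0//; exact: run_divergence_ge.
Qed.

Lemma gap_ge0 w : 0 <= gap w.
Proof. by rewrite subr_ge0. Qed.

(** The gradient vanishes at the minimizer, so the quadratic bound there dominates the gap by |x_k -
    xs|^2. *)
Lemma gap_integrable : Pr.-integrable setT (EFin \o gap).
Proof.
apply: (le_integrable_ae _ (integrable_scale (L2 / 2) run_sqr_integrable)).
  apply: measurable_funB; last exact: measurable_cst.
  apply: (measurableT_comp (measurable_objective hF)).
  by apply: (@meas_Om _ _ (past k)); exact: past_x.
apply: aeW => w; rewrite ger0_norm ?gap_ge0//.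
have := objective_quadratic hF n0 xs (x k w).
rewrite ler_norml => /andP[_]; rewrite -/(v w) -/(gap w).
have -> : dotv (grad f xs) (v w) = 0.
  apply/eqP; rewrite -normr_le0 (le_trans (norm_dotv_le _ _))//.
  have := gradient_sqr_bound hF n0 xs hxs; rewrite subrr mulr0.
  move=> g0; have : l2norm (grad f xs) ^+ 2 == 0 by rewrite eq_le g0 sqr_ge0.
  by rewrite sqrf_eq0 => /eqP ->; rewrite mul0r.
by rewrite subr0.
Qed.

Lemma gradient_sqr_integrable :
  Pr.-integrable setT (EFin \o (fun w => l2norm (gr w) ^+ 2)) /\
  \int[Pr]_w (l2norm (gr w) ^+ 2) <= 2 * L2 * \int[Pr]_w gap w.
Proof.
have ib := integrable_scale (2 * L2) gap_integrable.
have le w : l2norm (gr w) ^+ 2 <= 2 * L2 * gap w by exact: (gradient_sqr_bound hF n0 _ hxs).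
have i2 : Pr.-integrable setT (EFin \o (fun w => l2norm (gr w) ^+ 2)).
  apply: (le_integrable_ae _ ib); last first.
    by apply: aeW => w; rewrite ger0_norm ?sqr_ge0.
  by apply: measurable_l2norm_sqr; apply: (@meas_Om _ _ (past k)); exact: meas_gr.
split=> //; rewrite -(RintegralZl (2 * L2) measurableT gap_integrable).
by apply: le_Rintegral => // w _; exact: le.
Qed.

Let unif : uniform_on_sphere (distribution Pr (e k)).
Proof. by have [+ _ _] := hdraws; apply. Qed.

Let run_rho_ge0 : 0 <= rho.
Proof.
apply: le_trans (hrho unif); apply: Rintegral_ge0 => // y _; exact: weight_ge0.
Qed.

Let law i C : measurable C -> distribution Pr (xi k i) C = P C.
Proof. by have [_ + _] := hdraws; apply. Qed.

Lemma run_quadratic :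
  Pr.-integrable setT (EFin \o (fun w => dotv (v w) (e k w) ^+ 2)) /\
  \int[Pr]_w (dotv (v w) (e k w) ^+ 2) <= 18 / n%:R * \int[Pr]_w D k w.
Proof.
have [i le] := quadratic_le (alg_sub (J := past k)) (ind_e past_e) unif
  (meas_v (subxx _)) run_sqr_integrable.
split=> //; apply: (le_trans le).
rewrite mulrAC mulrC ler_wpM2r ?invr_ge0//.
rewrite -(RintegralZl 18 measurableT iD); apply: le_Rintegral => //.
- exact: run_sqr_integrable.
- exact: integrable_scale.
- by move=> w _; exact: run_divergence_ge.
Qed.

Let meas_dot (h : Om -> 'rV[R]_n) (J : {set I}) : measurable_fun (setT : set (OmJ J)) h ->
  measurable_fun (setT : set Om) (fun w => dotv (h w) (e k w)).
Proof.
by move=> /meas_Om ms; apply: measurable_dotv => //; exact: (measurable_funPT (e k)).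
Qed.

Let meas_W : measurable_fun (setT : set Om) W.
Proof. exact: (measurableT_comp (measurable_weight A B r) (measurable_funPT (e k))). Qed.

Let W0 w : 0 <= W w.
Proof. exact: weight_ge0. Qed.

(** Averaging over the direction leaves <grad f x_k, x_k - xs> / n, and convexity bounds this below
    by the gap over n. This term drives the descent. *)
Lemma gradient_cross :
  Pr.-integrable setT (EFin \o (fun w => dotv (gr w) (e k w) * dotv (v w) (e k w))) /\
  n%:R^-1 * \int[Pr]_w gap w <= \int[Pr]_w (dotv (gr w) (e k w) * dotv (v w) (e k w)).
Proof.
have mg := meas_gr (subxx (past k)); have mv := meas_v (subxx (past k)).
have [i1 _] := quadratic_le (alg_sub (J := past k)) (ind_e past_e) unif mg
  gradient_sqr_integrable.1.
have i2 := run_quadratic.1.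
have i := integrable_mul (meas_dot mg) (meas_dot mv) i1 i2.
split=> //.
rewrite (bilinear_eq (alg_sub (J := past k)) (ind_e past_e) unif mg mv i).
have id : Pr.-integrable setT (EFin \o (fun w => dotv (gr w) (v w))).
  apply: (le_integrable_ae _ (integrable_add gradient_sqr_integrable.1 run_sqr_integrable)).
    by apply: measurable_dotv; [exact: meas_Om mg|exact: meas_Om mv].
  apply: aeW => w; rewrite (le_trans (norm_dotv_le _ _))//.
  have := l2norm_ge0 (gr w); have := l2norm_ge0 (v w).
  by move: (l2norm (gr w)) (l2norm (v w)) => p1 p2; nra.
rewrite -(RintegralZl _ measurableT gap_integrable); apply: le_Rintegral => //.
- exact: integrable_scale gap_integrable.
- have := integrable_scale n%:R^-1 id; apply: eq_integrable => // w _ /=.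
  by rewrite mulrC.
move=> w _; rewrite mulrC ler_wpM2r ?invr_ge0//.
exact: (gradient_inequality hF n0).
Qed.

Lemma gradient_weighted :
  Pr.-integrable setT (EFin \o (fun w => dotv (gr w) (e k w) ^+ 2 * W w)) /\
  \int[Pr]_w (dotv (gr w) (e k w) ^+ 2 * W w)
    <= rho / n%:R * (2 * L2 * \int[Pr]_w gap w).
Proof.
have mg := meas_gr (subxx (past k)); have [ig leg] := gradient_sqr_integrable.
have [i1 le1] := weighted_quadratic_le (alg_sub (J := past k)) (ind_e past_e) unif A0 B0
  (hrho unif) mg ig.
split=> //; apply: (le_trans le1); by rewrite ler_wpM2l// divr_ge0// run_rho_ge0.
Qed.

Lemma noise_sqr i :
  Pr.-integrable setT (EFin \o (fun w => l2norm (z i w) ^+ 2)) /\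
  \int[Pr]_w (l2norm (z i w) ^+ 2) <= sigma ^+ 2.
Proof.
have mx := past_x (subxx (past k)).
have ic : Pr.-integrable setT (EFin \o (fun=> sigma ^+ 2) : Om -> \bar R).
  exact: finite_measure_integrable_cst.
pose h (q : OmJ (past k) * X) := l2norm (grad_noise P F g (x k q.1) q.2) ^+ 2.
have mh : measurable_fun setT h.
  apply: measurable_l2norm_sqr.
  exact: (measurableT_comp meas_noise
    (measurable_fun_pair (measurableT_comp mx measurable_fst) measurable_snd)).
have := independent_le (alg_sub (J := past k)) (ind_xi (past_xi i)) mh _ ic.
rewrite Rintegral_probability_cst; apply => [q|w]; first exact: sqr_ge0.
have [ig le] := grad_noise_var hF (x k w).
rewrite (eq_measure_integral P) => [|C mC _]; last exact: law.
rewrite -lee_fin in le; apply: le_trans le; rewrite /Rintegral fineK//.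
exact: (integrable_fin_num measurableT ig).
Qed.

(** Here the direction is integrated last: sample i joins the past, so [z i] is a frozen vector when
    the sphere moment is applied. *)
Lemma noise_weighted i :
  Pr.-integrable setT (EFin \o (fun w => dotv (z i w) (e k w) ^+ 2 * W w)) /\
  \int[Pr]_w (dotv (z i w) (e k w) ^+ 2 * W w) <= rho / n%:R * sigma ^+ 2.
Proof.
pose J := inr (k, i) |: past k.
have sub : past k \subset J by exact: finset.subsetUr.
have eJ : inl k \notin J by rewrite in_setU1 (negPf past_e).
have mz : measurable_fun (setT : set (OmJ J)) (z i) by apply: meas_z => //; exact: finset.setU11.
have [iz lez] := noise_sqr i.
have [i1 le1] := weighted_quadratic_le (alg_sub (J := J)) (ind_e eJ) unif A0 B0
  (hrho unif) mz iz.
split=> //; apply: (le_trans le1); by rewrite ler_wpM2l// divr_ge0// run_rho_ge0.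
Qed.

Lemma noise_quadratic i :
  Pr.-integrable setT (EFin \o (fun w => dotv (z i w) (e k w) ^+ 2)).
Proof.
pose J := inr (k, i) |: past k.
have sub : past k \subset J by exact: finset.subsetUr.
have eJ : inl k \notin J by rewrite in_setU1 (negPf past_e).
have mz : measurable_fun (setT : set (OmJ J)) (z i) by apply: meas_z => //; exact: finset.setU11.
exact: (quadratic_le (alg_sub (J := J)) (ind_e eJ) unif mz (noise_sqr i).1).1.
Qed.

(** Here sample i is integrated last: with the direction and J frozen its noise has mean zero, and
    the factor [c1] is constant. *)
Lemma noise_orthogonal i (J : {set I}) (c1 : Om -> R) :
  past k \subset J -> inl k \in J -> inr (k, i) \notin J ->
  measurable_fun (setT : set (OmJ J)) c1 ->
  Pr.-integrable setT (EFin \o (fun w => dotv (z i w) (e k w) * c1 w)) ->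
  \int[Pr]_w (dotv (z i w) (e k w) * c1 w) = 0.
Proof.
move=> sub eJ xiJ mc ii; have mx := past_x sub; have me := meas_e eJ.
pose h (q : OmJ J * X) := dotv (grad_noise P F g (x k q.1) q.2) (e k q.1) * c1 q.1.
have mh : measurable_fun setT h.
  apply: measurable_funM; last exact: (measurableT_comp mc measurable_fst).
  apply: measurable_dotv; last exact: (measurableT_comp me measurable_fst).
  exact: (measurableT_comp meas_noise
    (measurable_fun_pair (measurableT_comp mx measurable_fst) measurable_snd)).
rewrite (independent_eq (alg_sub (J := J)) (ind_xi xiJ) (q := cst 0) mh ii).
  by rewrite Rintegral_probability_cst.
move=> w; have [ig eg] := grad_noise_mean hF n0 (x k w) (e k w).
rewrite (eq_measure_integral P) => [|C mC _]; last exact: law.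
have ih := integrable_fin_num measurableT (integrable_scale (c1 w) ig).
have H : \int[P]_u (c1 w * dotv (grad_noise P F g (x k w) u) (e k w)) = 0.
  by rewrite RintegralZl// eg mulr0.
transitivity (\int[P]_u (c1 w * dotv (grad_noise P F g (x k w) u) (e k w)))%:E.
  rewrite /Rintegral fineK//; apply: eq_integral => u _.
  by rewrite /h/= mulrC.
by rewrite H.
Qed.

Let v_dot_meas : measurable_fun (setT : set Om) (fun w => dotv (v w) (e k w)).
Proof. exact: (meas_dot (meas_v (subxx (past k)))). Qed.

Let z_dot_meas i : measurable_fun (setT : set Om) (fun w => dotv (z i w) (e k w)).
Proof.
apply: (@meas_dot _ (inr (k, i) |: past k)); apply: meas_z; last exact: finset.setU11.
exact: finset.subsetUr.
Qed.

Let zm w := mean_noise g f (fun i => xi k i w) (x k w).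

Let zmE w : dotv (zm w) (e k w) = \sum_i m%:R^-1 * dotv (z i w) (e k w).
Proof. by rewrite /zm /mean_noise dotvZl dotv_suml mulr_sumr. Qed.

Lemma mean_noise_cross :
  has_mean Pr (fun w => dotv (zm w) (e k w) * dotv (v w) (e k w)) 0.
Proof.
have H i : has_mean Pr (fun w => dotv (z i w) (e k w) * dotv (v w) (e k w)) 0.
  have ii := integrable_mul (z_dot_meas i) v_dot_meas (noise_quadratic i) run_quadratic.1.
  split=> //; pose J := inl k |: past k.
  have sub : past k \subset J by exact: finset.subsetUr.
  have eJ : inl k \in J by exact: finset.setU11.
  apply: (noise_orthogonal sub eJ _ _ ii); first by rewrite in_setU1 (negPf (past_xi i)).
  by apply: measurable_dotv; [exact: meas_v|exact: meas_e].
have := has_mean_sum (index_enum 'I_m) (fun i => has_meanZ m%:R^-1 (H i)).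
rewrite big1 => [|i _]; last by rewrite mulr0.
have -> // : (fun w => \sum_i m%:R^-1 * (dotv (z i w) (e k w) * dotv (v w) (e k w)))
  = (fun w => dotv (zm w) (e k w) * dotv (v w) (e k w)).
by apply/funext => w; rewrite zmE mulr_suml; apply: eq_bigr => i _; rewrite mulrA.
Qed.

Let W_meas (J : {set I}) : inl k \in J -> measurable_fun (setT : set (OmJ J)) W.
Proof. by move=> /meas_e me; exact: (measurableT_comp (measurable_weight A B r) me). Qed.

(* The noise of sample [i] is centred given [e k], the past and sample [j]. *)
Lemma noise_pair_orthogonal i j : i != j ->
  \int[Pr]_w (dotv (z i w) (e k w) * dotv (z j w) (e k w) * W w) = 0.
Proof.
move=> ij; pose J := inr (k, j) |: (inl k |: past k).
have sub : past k \subset J.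
  exact: (fintype.subset_trans (finset.subsetUr _ _) (finset.subsetUr _ _)).
have eJ : inl k \in J by rewrite !in_setU1 eqxx.
have xiJ : inr (k, i) \notin J.
  rewrite !in_setU1 (negPf (past_xi i)) !orbF; apply/negP => /eqP[ij'].
  by rewrite ij' eqxx in ij.
have ii := integrable_mul_sqr (z_dot_meas i) (z_dot_meas j) meas_W W0
  (noise_weighted i).1 (noise_weighted j).1.
under eq_Rintegral do rewrite -mulrA.
apply: (noise_orthogonal sub eJ xiJ).
  apply: measurable_funM; last exact: W_meas.
  by apply: measurable_dotv; [apply: meas_z => //; exact: finset.setU11|exact: meas_e].
by apply: eq_integrable ii => // w _ /=; rewrite mulrA.
Qed.

(** All samples share one direction, but off-diagonal products still vanish given it. The m diagonal
    terms, each with factor 1 / m^2, give the gain 1 / m. *)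
Lemma mean_noise_weighted :
  Pr.-integrable setT (EFin \o (fun w => dotv (zm w) (e k w) ^+ 2 * W w)) /\
  \int[Pr]_w (dotv (zm w) (e k w) ^+ 2 * W w) <= rho * sigma ^+ 2 / (n%:R * m%:R).
Proof.
have mR : 0 < m%:R :> R by rewrite ltr0n.
have H i j := has_mean_int (integrable_mul_sqr (z_dot_meas i) (z_dot_meas j) meas_W W0
  (noise_weighted i).1 (noise_weighted j).1).
have S := has_mean_sum (index_enum 'I_m) (fun i =>
  has_mean_sum (index_enum 'I_m) (fun j => has_meanZ (m%:R^-1 * m%:R^-1) (H i j))).
have E : (fun w => \sum_i \sum_j m%:R^-1 * m%:R^-1
    * (dotv (z i w) (e k w) * dotv (z j w) (e k w) * W w))
    = (fun w => dotv (zm w) (e k w) ^+ 2 * W w).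
  apply/funext => w; rewrite zmE expr2 !mulr_suml; apply: eq_bigr => i _.
  rewrite mulr_sumr mulr_suml; apply: eq_bigr => j _.
  by move: (dotv _ _) (dotv _ _) (W w) (_^-1) => p1 p2 p3 p4; ring.
rewrite E in S; have [i1 ->] := S; split=> //.
apply: (@le_trans _ _ (\sum_(i < m) m%:R^-1 * m%:R^-1 * (rho / n%:R * sigma ^+ 2))).
  apply: ler_sum => i _; rewrite (bigD1 i)//= big1 ?addr0 => [|j ji].
    rewrite ler_wpM2l ?mulr_ge0 ?invr_ge0//.
    under eq_Rintegral do rewrite -expr2.
    exact: (noise_weighted i).2.
  by rewrite noise_pair_orthogonal ?mulr0// eq_sym.
rewrite sumr_const card_ord -[_ *+ m]mulr_natl le_eqVlt; apply/orP; left.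
by apply/eqP; field; rewrite gt_eqF//= gt_eqF ?ltr0n.
Qed.

Let eb u := t ^+ 2 / 2 * L u ^+ 2 + 8 * Delta ^+ 2 / t ^+ 2.

Let eb0 u : 0 <= eb u.
Proof.
apply: addr_ge0; first by apply: mulr_ge0; rewrite ?divr_ge0 ?sqr_ge0.
by apply: divr_ge0; [apply: mulr_ge0|]; rewrite ?sqr_ge0.
Qed.

Let eb_meas : measurable_fun setT eb.
Proof.
apply: measurable_funD; last exact: measurable_cst.
apply: measurable_funM; first exact: measurable_cst.
exact: measurable_funX (sp_measL hF).
Qed.

Lemma sample_error_mean i :
  Pr.-integrable setT (EFin \o (fun w => eb (xi k i w))) /\
  \int[Pr]_w eb (xi k i w) <= delta.
Proof.
have [i2 e2] := lipschitz_sqr hF.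
have i1 := integrable_scale (t ^+ 2 / 2) i2.
have ic : P.-integrable setT (EFin \o (fun=> 8 * Delta ^+ 2 / t ^+ 2) : X -> \bar R).
  exact: finite_measure_integrable_cst.
have ie : P.-integrable setT (EFin \o eb) by exact: (integrable_add i1 ic).
have [ii ->] := Rintegral_distribution (law i) eb_meas eb0 ie.
split=> //; rewrite /eb (RintegralD measurableT i1 ic).
rewrite (RintegralZl _ measurableT i2) Rintegral_probability_cst lerD2r.
by rewrite ler_wpM2l// divr_ge0 ?sqr_ge0.
Qed.

Lemma error_bound_mean :
  Pr.-integrable setT (EFin \o bound) /\ \int[Pr]_w bound w <= delta.
Proof.
have mR : 0 < m%:R :> R by rewrite ltr0n.
have [i1 e1] := has_mean_sum (index_enum 'I_m) (fun i =>
  has_meanZ m%:R^-1 (has_mean_int (sample_error_mean i).1)).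
split; first exact: i1.
rewrite [leLHS]e1; apply: (@le_trans _ _ (\sum_(i < m) m%:R^-1 * delta)).
  by apply: ler_sum => i _; rewrite ler_wpM2l ?invr_ge0//; exact: (sample_error_mean i).2.
by rewrite sumr_const card_ord -[_ *+ m]mulr_natl mulrA mulfV ?mul1r// gt_eqF.
Qed.

(** The weight depends on the direction and the error bound on the samples, which are independent,
    so the expectation factors. *)
Lemma error_bound_weighted :
  Pr.-integrable setT (EFin \o (fun w => W w * bound w)) /\
  \int[Pr]_w (W w * bound w) <= rho * delta.
Proof.
have mR : 0 < m%:R :> R by rewrite ltr0n.
have rho0 := run_rho_ge0.
have H i : Pr.-integrable setT (EFin \o (fun w => W w * eb (xi k i w))) /\
    \int[Pr]_w (W w * eb (xi k i w)) <= rho * delta.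
  have [ii ei] := sample_error_mean i.
  pose J : {set I} := [set inr (k, i)]%SET.
  have eJ : inl k \notin J by rewrite finset.in_set1.
  have xJ : measurable_fun (setT : set (OmJ J)) (xi k i) by apply: meas_xi; rewrite finset.in_set1.
  pose h (q : OmJ J * 'rV[R]_n) := weight A B r q.2 * eb (xi k i q.1).
  have mh : measurable_fun setT h.
    apply: measurable_funM.
      exact: (measurableT_comp (measurable_weight A B r) measurable_snd).
    exact: (measurableT_comp eb_meas (measurableT_comp xJ measurable_fst)).
  have h0 q : 0 <= h q by apply: mulr_ge0; [exact: weight_ge0|exact: eb0].
  have [] := independent_le (alg_sub (J := J)) (ind_e eJ) mh h0 (integrable_scale rho ii).
    move=> w; rewrite /h/=.
    have iw := integrableZr measurableT (eb (xi k i w)) (weight_integrable unif A B r).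
    have -> : (\int[distribution Pr (e k)]_y (weight A B r y * eb (xi k i w))%:E
      = (\int[distribution Pr (e k)]_y (weight A B r y * eb (xi k i w)))%:E)%E.
      by rewrite /Rintegral fineK//; exact: (integrable_fin_num measurableT iw).
    rewrite lee_fin RintegralZr//; last exact: weight_integrable.
    exact: (ler_wpM2r (eb0 _) (hrho unif)).
  rewrite RintegralZl// => i1 e1; split=> //; apply: (le_trans e1).
  by rewrite ler_wpM2l.
have [i1 e1] := has_mean_sum (index_enum 'I_m) (fun i =>
  has_meanZ m%:R^-1 (has_mean_int (H i).1)).
have E : (fun w => \sum_i m%:R^-1 * (W w * eb (xi k i w))) = (fun w => W w * bound w).
  apply/funext => w; rewrite /bound /error_bound mulr_sumr; apply: eq_bigr => i _.
  by rewrite mulrCA.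
rewrite E in i1 e1; split=> //; rewrite e1.
apply: (@le_trans _ _ (\sum_(i < m) m%:R^-1 * (rho * delta))).
  by apply: ler_sum => i _; rewrite ler_wpM2l ?invr_ge0//; exact: (H i).2.
by rewrite sumr_const card_ord -[_ *+ m]mulr_natl mulrA mulfV ?mul1r// gt_eqF.
Qed.

(** The pointwise descent holds almost surely. As divergences are nonnegative, its integrable
    right-hand side also gives integrability of the next one. *)
Lemma run_step (tau : R) : 0 < tau ->
  Pr.-integrable setT (EFin \o D k.+1) /\
  \int[Pr]_w D k.+1 w <= \int[Pr]_w D k w - s * (n%:R^-1 * \int[Pr]_w gap w)
    + s * (tau / 2 * delta + (2 * tau)^-1 * (18 / n%:R * \int[Pr]_w D k w))
    + 9 / 2 * s ^+ 2 * (4 * (rho / n%:R * (2 * L2 * \int[Pr]_w gap w))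
      + 4 * (rho * sigma ^+ 2 / (n%:R * m%:R)) + 2 * (rho * delta)).
Proof.
move=> tau0; have tau2 : 0 <= tau / 2 by rewrite divr_ge0// ltW.
have tau1 : 0 <= (2 * tau)^-1 by rewrite invr_ge0 mulr_ge0// ltW.
have [ig eg] := gradient_cross; have [iq eq] := run_quadratic.
have [iw ew] := gradient_weighted; have [im em] := mean_noise_weighted.
have [ib eb'] := error_bound_mean; have [ie ee] := error_bound_weighted.
have := has_meanD
  (has_meanD
    (has_meanB (has_meanB (has_mean_int iD) (has_meanZ s (has_mean_int ig)))
      (has_meanZ s mean_noise_cross))
    (has_meanZ s (has_meanD (has_meanZ (tau / 2) (has_mean_int ib))
      (has_meanZ (2 * tau)^-1 (has_mean_int iq)))))
  (has_meanZ (9 / 2 * s ^+ 2) (has_meanD (has_meanD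
    (has_meanZ 4 (has_mean_int iw)) (has_meanZ 4 (has_mean_int im)))
    (has_meanZ 2 (has_mean_int ie)))).
set maj := (fun w => _) => -[iM eM].
have step : {ae Pr, forall w, D k.+1 w <= maj w}.
  have h1 : {ae Pr, forall w, forall i y, has_gradient (F ^~ (xi k i w)) y (g y (xi k i w))}.
    by apply: filter_forall => i; exact: (ae_distribution (law i) (sp_grad hF)).
  have h2 : {ae Pr, forall w, forall i y y', l2norm (g y (xi k i w) - g y' (xi k i w))
      <= L (xi k i w) * l2norm (y - y')}.
    by apply: filter_forall => i; exact: (ae_distribution (law i) (sp_lip hF)).
  have h3 : {ae Pr, forall w, forall i y, `|eta y (xi k i w)| <= Delta}.
    by apply: filter_forall => i; exact: (ae_distribution (law i) (bn_bound heta)).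
  have h4 : {ae Pr, forall w, l2norm (e k w) = 1}.
    exact: (ae_distribution (fun C mC => erefl) (sphere_ae unif)).
  apply: filterS2 (filterI h1 h2) (filterI h3 h4) => w [g1 g2] [g3 g4].
  rewrite /D hstep.
  exact: (descent_pointwise t0 m0 f xs (x k w) a1 a2 b2 ab c0 tau0 s0 A0 B0 (hW g4) g4 g1 g2 g3).
have iD1 : Pr.-integrable setT (EFin \o D k.+1).
  apply: (le_integrable_ae _ iM); first by apply: measurable_run_divergence; exact: ltn_ord.
  by apply: filterS step => w; rewrite ger0_norm// run_divergence_ge0.
split=> //; apply: (le_trans (le_Rintegral_ae iD1 iM step)); rewrite eM.
rewrite mulr0 subr0; apply: lerD; first apply: lerD.
- by rewrite lerD2l lerN2 ler_wpM2l.
- by rewrite ler_wpM2l// lerD// ler_wpM2l.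
rewrite ler_wpM2l//; first by rewrite mulr_ge0 ?sqr_ge0// divr_ge0.
by rewrite !lerD// ler_wpM2l.
Qed.

End one_step.

Lemma run_divergence_integrable k : (k <= N)%N -> Pr.-integrable setT (EFin \o D k).
Proof.
elim: k => [|k IH] kN.
  have -> : D 0%N = cst (divergence a c x00 xs) by apply/funext => w; rewrite /D hx0.
  exact: finite_measure_integrable_cst.
exact: (run_step (k := Ordinal kN) (IH (ltnW kN)) ltr01).1.
Qed.

Hypothesis N0 : (0 < N)%N.
Hypotheses (rho0 : 0 < rho) (sE : s = (48 * n%:R * rho * L2)^-1 * n%:R).
Let delta := t ^+ 2 / 2 * L2 ^+ 2 + 8 * Delta ^+ 2 / t ^+ 2.

Lemma run_mean_gap :
  N%:R^-1 * \sum_(k < N) \int[Pr]_w (f (x k w) - f xs) <=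
  384 * n%:R * rho * L2 * divergence a c x00 xs / N%:R
  + 3 / 2 * (N%:R * delta / (rho * L2)) + 3 * (sigma ^+ 2 / (L2 * m%:R))
  + 3 / 2 * (n%:R * delta / L2).
Proof.
have NR : 0 < N%:R :> R by rewrite ltr0n.
have nR : 0 < n%:R :> R by rewrite ltr0n.
have mR : 0 < m%:R :> R by rewrite ltr0n.
have l0 := sp_L2_gt0 hF.
have sE' := sE; set al := (48 * n%:R * rho * L2)^-1 in sE'.
have al0 : 0 < al by rewrite invr_gt0 !mulr_gt0.
have d0 : 0 <= delta.
  apply: addr_ge0; first by apply: mulr_ge0; rewrite ?divr_ge0 ?sqr_ge0.
  by apply: divr_ge0; [apply: mulr_ge0|]; rewrite ?sqr_ge0.
have s20 := sqr_ge0 sigma.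
pose bb := 9 * al ^+ 2 * n%:R * N%:R * delta + 18 * al ^+ 2 * n%:R * rho * sigma ^+ 2 / m%:R
  + 9 * al ^+ 2 * n%:R ^+ 2 * rho * delta.
have bb0 : 0 <= bb.
  by rewrite /bb; nneg.
have phi0 k : 0 <= \int[Pr]_w (f (x k w) - f xs).
  by apply: Rintegral_ge0 => // w _; rewrite subr_ge0.
have A0' k : 0 <= \int[Pr]_w D k w.
  by apply: Rintegral_ge0 => // w _; exact: run_divergence_ge0.
have q0 : 0 <= al / 4 by rewrite divr_ge0// ltW.
have S : al / 4 * \sum_(k < N) \int[Pr]_w (f (x k w) - f xs)
    <= 2 * (\int[Pr]_w D 0 w + N%:R * bb).
  apply: (step_recursion (A := fun k => \int[Pr]_w D k w)
    (phi := fun k => \int[Pr]_w (f (x k w) - f xs)) N0 q0 bb0 A0' phi0) => k kN.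
  (* This tau turns the Young term in the divergence into exactly 1 / (2 N) of it, as
     [step_recursion] expects. *)
  have tau0 : 0 < 18 * al * N%:R by rewrite !mulr_gt0.
  have [_] := run_step (k := Ordinal kN) (run_divergence_integrable (ltnW kN)) tau0.
  rewrite -/delta /= sE'; move: (\int[Pr]_w D k.+1 w) (\int[Pr]_w D k w).
  move: (\int[Pr]_w (f (x k w) - f xs)) => p A1 A2 le.
  have e1 : al * n%:R * (n%:R^-1 * p) = al * p by field; rewrite gt_eqF.
  have e2 : al * n%:R * (18 * al * N%:R / 2 * delta
     + (2 * (18 * al * N%:R))^-1 * (18 / n%:R * A2))
     = 9 * al ^+ 2 * n%:R * N%:R * delta + A2 * (2 * N%:R)^-1.
    by field; rewrite !gt_eqF.
  have e3 : al * (48 * n%:R * rho * L2) = 1 by rewrite mulVf// gt_eqF// !mulr_gt0.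
  (* The stepsize makes al * 48 n rho L2 equal to 1, so the gradient part costs 3/4 of al times the
     gap and leaves the coefficient al / 4. *)
  have e4 : 9 / 2 * (al * n%:R) ^+ 2 * (4 * (rho / n%:R * (2 * L2 * p))
     + 4 * (rho * sigma ^+ 2 / (n%:R * m%:R)) + 2 * (rho * delta))
     = 3 / 4 * (al * (48 * n%:R * rho * L2)) * (al * p)
     + 18 * al ^+ 2 * n%:R * rho * sigma ^+ 2 / m%:R
     + 9 * al ^+ 2 * n%:R ^+ 2 * rho * delta.
    by field; rewrite !gt_eqF.
  move: le; rewrite e1 e2 e4 e3 /bb mulr1.
  move: (9 * _ * _ * _ * delta) (18 * _ * _ * _ * _ / _) (9 * _ * _ * _ * delta).
  by move=> b1 b2' b3; move: (A2 * _^-1) (mulrDr A2 1 (2 * N%:R)^-1) => y ->; lra.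
have E0 : \int[Pr]_w D 0 w = divergence a c x00 xs.
  under eq_Rintegral do rewrite /D hx0.
  exact: Rintegral_probability_cst.
rewrite E0 in S; move: S; set Sm := \sum_(_ < N) _; set V := divergence _ _ _ _ => S.
(* Dividing by al N / 4 produces the constants 384 = 8 * 48, 3/2 = 72/48 and 3 = 144/48. *)
have c8 : 0 <= 4 / (al * N%:R) by rewrite divr_ge0// mulr_ge0// ltW.
have := ler_wpM2l c8 S.
have -> : 4 / (al * N%:R) * (al / 4 * Sm) = N%:R^-1 * Sm.
  by field; rewrite !gt_eqF.
move=> /le_trans; apply; rewrite le_eqVlt; apply/orP; left; apply/eqP.
by rewrite /bb /al; field; rewrite !gt_eqF.
Qed.

Lemma run_output_bound :
  ('E_Pr[fun w => f (rdfds_output N (fun k => x k w))] - (f xs)%:E <=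
  (384 * n%:R * rho * L2 * divergence a c x00 xs / N%:R
  + 3 / 2 * (N%:R * delta / (rho * L2)) + 3 * (sigma ^+ 2 / (L2 * m%:R))
  + 3 / 2 * (n%:R * delta / L2))%:E)%E.
Proof.
have NR : 0 < N%:R :> R by rewrite ltr0n.
pose h w := f (rdfds_output N (fun k => x k w)) - f xs.
have ig (k : 'I_N) : Pr.-integrable setT (EFin \o (fun w => f (x k w) - f xs)).
  by apply: gap_integrable; apply: run_divergence_integrable; exact: ltnW.
have [iM eM] := has_meanZ N%:R^-1 (has_mean_sum (index_enum 'I_N)
  (fun k => has_mean_int (ig k))).
have hM w : h w <= N%:R^-1 * \sum_(k < N) (f (x k w) - f xs).
  rewrite sumrB sumr_const card_ord mulrBr -[f xs *+ N]mulr_natl mulrA mulVf ?gt_eqF//.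
  by rewrite mul1r lerD2r; exact: (objective_mean hF).
have mh : measurable_fun setT (fun w => f (rdfds_output N (fun k => x k w))).
  apply: (measurableT_comp (measurable_objective hF)); apply: measurable_rV_scale.
    exact: measurable_cst.
  apply: measurable_rV_sum => k; apply: meas_Om; apply: run_measurable; exact: ltnW.
have ih : Pr.-integrable setT (EFin \o h).
  apply: (le_integrable_ae _ iM); first by apply: measurable_funB => //; exact: measurable_cst.
  by apply: aeW => w; rewrite ger0_norm// subr_ge0.
have ic : Pr.-integrable setT (EFin \o (fun=> f xs) : Om -> \bar R).
  exact: finite_measure_integrable_cst.
have io : Pr.-integrable setT (EFin \o (fun w => f (rdfds_output N (fun k => x k w)))).
  have := integrable_add ih ic; apply: eq_integrable => // w _ /=.
  by rewrite /h subrK.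
have fin := integrable_fin_num measurableT io.
rewrite unlock -[integral _ _ _]fineK// -EFinB lee_fin.
apply: le_trans run_mean_gap; rewrite -eM.
have -> : fine (\int[Pr]_w (f (rdfds_output N (fun k => x k w)))%:E) - f xs = \int[Pr]_w h w.
  by rewrite /h RintegralB// Rintegral_probability_cst.
by apply: le_Rintegral => // w _; exact: hM.
Qed.

End run.

(** * Rates *)

Lemma min_div {R : realFieldType} (q a b : R) : 0 <= q -> 0 < a -> 0 < b ->
  Num.min (q / a) (q / b) = q / Num.max a b.
Proof.
move=> q0 a0 b0; have [ab|ba] := leP a b.
  by rewrite min_r// ler_wpM2l// lef_pV2.
by rewrite min_l// ler_wpM2l// lef_pV2 ?posrE// ltW.
Qed.

(** The constants add up to 6144 + 27/2 + 3 + 27/2 = 6174. *)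
Lemma collect_bounds {R : realFieldType} (T1 T2 T3 T4 K l z : R) :
  1 <= K -> 3 / 2 <= l -> 0 <= z ->
  T1 <= 6144 * (K * l) * z -> T2 <= 9 * K ^+ 3 * z -> T3 <= K * z ->
  T4 <= 9 * K ^+ 2 * z ->
  T1 + 3 / 2 * T2 + 3 * T3 + 3 / 2 * T4 <= 6200 * (K ^+ 3 * l) * z.
Proof.
move=> K1 l1 z0 h1 h2 h3 h4; have K0 : 0 <= K by exact: le_trans K1.
have k3 : K ^+ 2 <= K ^+ 3 by rewrite ler_weXn2l.
have k1 : K <= K ^+ 3 by have := ler_weXn2l K1 (isT : (1 <= 3)%N); rewrite expr1.
have kk : K ^+ 3 <= K ^+ 3 * l by rewrite ler_peMr ?exprn_ge0//; lra.
have ke : K * l <= K ^+ 3 * l by rewrite ler_wpM2r//; lra.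
have u1 := ler_wpM2r z0 k3; have u2 := ler_wpM2r z0 k1.
have u3 := ler_wpM2r z0 kk; have u4 := ler_wpM2r z0 ke.
have u5 : 0 <= K ^+ 3 * z by nneg.
move: h1 h2 h3 h4 u1 u2 u3 u4 u5; clear.
by move: (K ^+ 2) (K ^+ 3) (K ^+ 3 * l) (K * l) => a b c d; lra.
Qed.

Section rates.
Context {R : realType} (n p : nat) (L2 Theta sigma Delta : R).
Hypotheses (n8 : (8 <= n)%N) (hp : p = 1%N \/ p = 2%N).
Hypotheses (l0 : 0 < L2) (th0 : 0 < Theta) (de0 : 0 < Delta).

Let nR : 0 < n%:R :> R. Proof. by rewrite ltr0n; exact: leq_trans n8. Qed.
Local Notation eps := (eps_Delta n L2 Theta Delta).
Local Notation S := (Num.sqrt (n%:R * L2 * Theta * Delta)).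

Let S2 : S ^+ 2 = n%:R * L2 * Theta * Delta.
Proof. by rewrite sqr_sqrtr// !mulr_ge0// ltW. Qed.

Let S0 : 0 < S. Proof. by rewrite sqrtr_gt0 !mulr_gt0. Qed.

Let nD : 0 < n%:R * Delta. Proof. exact: mulr_gt0. Qed.

Lemma eps_Delta_gt0 : 0 < eps.
Proof. by rewrite lt_max nD. Qed.

Lemma eps_Delta_ge : n%:R * Delta <= eps.
Proof. by rewrite le_max lexx. Qed.

Lemma eps_Delta_sqr_ge : n%:R * L2 * Theta * Delta <= eps ^+ 2.
Proof.
rewrite -S2; apply: lerXn2r; rewrite ?nnegrE ?(ltW S0) ?(ltW eps_Delta_gt0)//.
by rewrite le_max lexx orbT.
Qed.

Lemma m_DeltaE : m_Delta n L2 Theta sigma Delta = sigma ^+ 2 / (L2 * eps).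
Proof.
rewrite /m_Delta /eps_Delta; have -> : n%:R * L2 ^+ 3 * Theta * Delta
  = L2 ^+ 2 * (n%:R * L2 * Theta * Delta) by ring.
rewrite sqrtrM ?sqr_ge0// sqrtr_sqr gtr0_norm//.
rewrite min_div ?sqr_ge0 ?mulr_gt0//; congr (_ / _).
by rewrite maxr_pMr ?(ltW l0)//; congr Num.max; ring.
Qed.

(** The numerator that both arguments of the minimum in [N_Delta] share once their denominators are
    those of [eps]. *)
Definition scale_Delta : R := if p == 2%N then n%:R * L2 * Theta else L2 * Theta.

Lemma scale_Delta_gt0 : 0 < scale_Delta.
Proof. by rewrite /scale_Delta; case: ifP; rewrite !mulr_gt0. Qed.

Lemma N_DeltaE : N_Delta n p L2 Theta Delta = scale_Delta / eps.
Proof.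
have sq (q y : R) : 0 <= q -> q ^+ 2 / S ^+ 2 = y -> Num.sqrt y = q / S.
  by move=> q0 <-; rewrite -expr_div_n sqrtr_sqr ger0_norm// divr_ge0// ltW.
rewrite /N_Delta /scale_Delta /eps_Delta.
case: ifP => _; rewrite -min_div// ?mulr_ge0 ?(ltW nR) ?(ltW l0) ?(ltW th0)//.
  congr Num.min; first by field; rewrite !gt_eqF.
  apply: sq; first by rewrite !mulr_ge0// ltW.
  by rewrite S2; field; rewrite !gt_eqF.
congr Num.min; apply: sq; first by rewrite !mulr_ge0// ltW.
by rewrite S2; field; rewrite !gt_eqF.
Qed.

(** The product of the two quotients has denominator eps^2, a maximum of squares, so its quotient is
    again a minimum of two terms. *)
Lemma calls_DeltaE : calls_Delta n p L2 Theta sigma Delta =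
  N_Delta n p L2 Theta Delta * m_Delta n L2 Theta sigma Delta.
Proof.
have e2 : eps ^+ 2 = Num.max ((n%:R * Delta) ^+ 2) (S ^+ 2).
  rewrite /eps_Delta; have [h|h] := leP (n%:R * Delta) S.
    by rewrite max_r//; apply: lerXn2r; rewrite ?nnegrE// ltW.
  by rewrite max_l//; apply: lerXn2r; rewrite ?nnegrE ltW.
have E : N_Delta n p L2 Theta Delta * m_Delta n L2 Theta sigma Delta
    = scale_Delta * sigma ^+ 2 / L2 / eps ^+ 2.
  by rewrite N_DeltaE m_DeltaE; field; rewrite !gt_eqF// eps_Delta_gt0.
rewrite E e2 -min_div ?exprn_gt0//; last first.
  by have q0 := scale_Delta_gt0; nneg.
rewrite S2 /calls_Delta /scale_Delta; case: ifP => _; congr Num.min;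
  by field; rewrite !gt_eqF.
Qed.

Lemma rho_gt0 : 0 < rho n p :> R.
Proof.
have l32 := @ln_ge32 R _ n8.
by case: hp => ->; rewrite ?rho1E ?rho2E// divr_gt0//; lra.
Qed.

(** Together with [rho_ge], this says that [scale_Delta] is n rho L2 Theta up to a logarithm, which
    occurs only for p = 1. *)
Lemma rho_le : n%:R * rho n p * L2 * Theta <= 16 * ln n%:R * scale_Delta.
Proof.
have l32 := @ln_ge32 R _ n8; have lt0 : 0 < L2 * Theta by exact: mulr_gt0.
rewrite /scale_Delta; case: hp => ->; rewrite ?rho1E ?rho2E//=.
  rewrite (_ : n%:R * _ * L2 * Theta = (16 * ln n%:R - 8) * (L2 * Theta)).
    by rewrite ler_wpM2r ?(ltW lt0)//; lra.
  by field; rewrite gt_eqF.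
rewrite mulr1 ler_peMl ?mulr_ge0 ?(ltW nR) ?(ltW l0) ?(ltW th0)//; lra.
Qed.

Lemma rho_ge : scale_Delta <= rho n p * (n%:R * L2 * Theta).
Proof.
have l32 := @ln_ge32 R _ n8; have lt0 : 0 < L2 * Theta by exact: mulr_gt0.
rewrite /scale_Delta; case: hp => ->; rewrite ?rho1E ?rho2E//= ?mul1r//.
rewrite (_ : _ * (n%:R * L2 * Theta) = (16 * ln n%:R - 8) * (L2 * Theta)).
  by rewrite ler_peMl ?(ltW lt0)//; lra.
by field; rewrite gt_eqF.
Qed.

Lemma ratio_polylogP (C0 a b : R) : 1 <= C0 -> 0 < a -> 0 < b ->
  ratio_polylog n C0 a b ->
  a <= C0 * ln n%:R `^ C0 * b /\ b <= C0 * ln n%:R `^ C0 * a.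
Proof.
move=> C1 a0 b0; rewrite /ratio_polylog => /andP[lo up].
have l32 := @ln_ge32 R _ n8.
have k0 : 0 < C0 * ln n%:R `^ C0 by rewrite mulr_gt0 ?powR_gt0//; lra.
move: lo; rewrite powRN -invfM; move: (C0 * _) k0 up => K K0 up lo.
by split; [rewrite -ler_pdivrMr|move: lo; rewrite ler_pdivlMr// ler_pdivrMl].
Qed.

Lemma polylog_ge1 (C0 : R) : 1 <= C0 -> 1 <= C0 * ln n%:R `^ C0.
Proof.
move=> C1; have l32 := @ln_ge32 R _ n8.
have : 1 <= ln n%:R `^ C0.
  by rewrite -[leLHS](powRr0 (ln n%:R)); apply: ler_powR; lra.
move: (_ `^ C0) => y y1; nra.
Qed.

Variables (K N m t V : R).
Hypotheses (K1 : 1 <= K) (N0 : 0 < N) (m0 : 0 < m) (t0 : 0 < t) (V1 : V <= Theta).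
Hypotheses (NK : N <= K * N_Delta n p L2 Theta Delta)
  (KN : N_Delta n p L2 Theta Delta <= K * N)
  (Km : m_Delta n L2 Theta sigma Delta <= K * m)
  (tK : t <= K * t_Delta L2 Delta) (Kt : t_Delta L2 Delta <= K * t).

(** At t^2 = Delta / L2 the curvature error t^2 L2^2 and the noise error Delta^2 / t^2 balance, both
    being Delta L2. *)
Lemma smoothing_error_le :
  t ^+ 2 / 2 * L2 ^+ 2 + 8 * Delta ^+ 2 / t ^+ 2 <= 9 * K ^+ 2 * (Delta * L2).
Proof.
have td : t_Delta L2 Delta ^+ 2 = Delta / L2 by rewrite sqr_sqrtr// divr_ge0 ?ltW.
have t1 : t ^+ 2 <= K ^+ 2 * (Delta / L2).
  rewrite -td -exprMn; apply: lerXn2r tK; rewrite nnegrE ?(ltW t0)//.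
  by rewrite mulr_ge0 ?sqrtr_ge0// (le_trans _ K1).
have t2 : Delta / L2 <= K ^+ 2 * t ^+ 2.
  rewrite -td -exprMn; apply: lerXn2r Kt; rewrite nnegrE ?sqrtr_ge0//.
  by rewrite mulr_ge0 ?(ltW t0)// (le_trans _ K1).
have h1 : t ^+ 2 / 2 * L2 ^+ 2 <= K ^+ 2 / 2 * (Delta * L2).
  apply: (@le_trans _ _ (K ^+ 2 * (Delta / L2) / 2 * L2 ^+ 2)).
    by rewrite ler_wpM2r ?sqr_ge0// ler_wpM2r.
  by rewrite le_eqVlt; apply/orP; left; apply/eqP; field; rewrite gt_eqF.
have h2 : 8 * Delta ^+ 2 / t ^+ 2 <= 8 * K ^+ 2 * (Delta * L2).
  rewrite ler_pdivrMr ?exprn_gt0//.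
  have dl : 0 <= 8 * (Delta * L2) by rewrite !mulr_ge0 ?(ltW de0) ?(ltW l0).
  have := ler_wpM2l dl t2.
  have -> : 8 * (Delta * L2) * (Delta / L2) = 8 * Delta ^+ 2 by field; rewrite gt_eqF.
  by move=> /le_trans; apply; rewrite le_eqVlt; apply/orP; left; apply/eqP; ring.
have : 0 <= K ^+ 2 * (Delta * L2) by nneg.
by move: h1 h2; move: (Delta * L2) (K ^+ 2) => u v; nra.
Qed.

(** The terms decreasing in N and m use the lower bounds on them; the accumulated smoothing error
    grows with N and uses the upper bound. *)
Lemma rate_bound (delta : R) : delta <= 9 * K ^+ 2 * (Delta * L2) ->
  384 * n%:R * rho n p * L2 * V / N + 3 / 2 * (N * delta / (rho n p * L2))
    + 3 * (sigma ^+ 2 / (L2 * m)) + 3 / 2 * (n%:R * delta / L2)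
  <= 6200 * (K ^+ 3 * ln n%:R) * eps.
Proof.
move=> dK; have rr := rho_gt0; have e0 := eps_Delta_gt0; have q0 := scale_Delta_gt0.
have l32 := @ln_ge32 R _ n8.
have K0 : 0 < K by exact: lt_le_trans K1.
have T1 : 384 * n%:R * rho n p * L2 * V / N <= 6144 * (K * ln n%:R) * eps.
  rewrite ler_pdivrMr//.
  apply: (@le_trans _ _ (384 * (n%:R * rho n p * L2 * Theta))).
    have z : 0 <= n%:R * rho n p * L2 :> R by nneg.
    by have := ler_wpM2l z V1; lra.
  apply: (@le_trans _ _ (384 * (16 * ln n%:R * scale_Delta))).
    by apply: ler_wpM2l; [exact: ler0n|exact: rho_le].
  have : scale_Delta <= K * N * eps by rewrite -ler_pdivrMr// -N_DeltaE.
  have lp : 0 <= 6144 * ln n%:R :> R by apply: mulr_ge0; [exact: ler0n|lra].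
  by move=> /(ler_wpM2l lp); lra.
have T2 : N * delta / (rho n p * L2) <= 9 * K ^+ 3 * eps.
  rewrite ler_pdivrMr; last exact: mulr_gt0.
  apply: (@le_trans _ _ (N * (9 * K ^+ 2 * (Delta * L2)))).
    by rewrite ler_wpM2l// ltW.
  apply: (@le_trans _ _ (K * (scale_Delta / eps) * (9 * K ^+ 2 * (Delta * L2)))).
    by rewrite -N_DeltaE; apply: ler_wpM2r => //; nneg.
  have -> : K * (scale_Delta / eps) * (9 * K ^+ 2 * (Delta * L2))
      = 9 * K ^+ 3 * L2 * (scale_Delta * Delta / eps) by field; rewrite gt_eqF.
  have -> : 9 * K ^+ 3 * eps * (rho n p * L2) = 9 * K ^+ 3 * L2 * (rho n p * eps) by ring.
  apply: ler_wpM2l; [by nneg|rewrite ler_pdivrMr//].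
  (* The square-root part of [eps] enters here: [scale_Delta] times Delta is at most rho n L2 Theta
     Delta <= rho eps^2. *)
  apply: (@le_trans _ _ (rho n p * (n%:R * L2 * Theta) * Delta)).
    by rewrite ler_wpM2r ?(ltW de0)// rho_ge.
  rewrite -[leLHS]mulrA -[leRHS]mulrA -expr2.
  by apply: ler_wpM2l; [exact: ltW|exact: eps_Delta_sqr_ge].
have T3 : sigma ^+ 2 / (L2 * m) <= K * eps.
  have : sigma ^+ 2 <= K * m * (L2 * eps) by rewrite -ler_pdivrMr ?mulr_gt0// -m_DeltaE.
  by rewrite ler_pdivrMr ?mulr_gt0// => /le_trans; apply; lra.
have T4 : n%:R * delta / L2 <= 9 * K ^+ 2 * eps.
  rewrite ler_pdivrMr//.
  apply: (@le_trans _ _ (n%:R * (9 * K ^+ 2 * (Delta * L2)))).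
    by rewrite ler_wpM2l// ltW.
  have k2 : 0 <= 9 * K ^+ 2 * L2 by nneg.
  by have := ler_wpM2l k2 eps_Delta_ge; lra.
exact: (collect_bounds K1 l32 (ltW e0) T1 T2 T3 T4).
Qed.

End rates.

(** C exceeds both the coefficient 6200 C0^3 and the exponent 3 C0 + 1, so one number serves in both
    places. *)
Lemma polylog_absorb {R : realType} (n : nat) (C0 : R) : (8 <= n)%N -> 1 <= C0 ->
  let C := 6200 * C0 ^+ 3 + 3 * C0 + 1 in
  6200 * ((C0 * ln n%:R `^ C0) ^+ 3 * ln n%:R) <= C * ln n%:R `^ C.
Proof.
move=> n8 C1 /=; set C := _ + 1; have l32 := @ln_ge32 R _ n8.
have c3 : 0 <= C0 ^+ 3 by rewrite exprn_ge0//; lra.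
have -> : 6200 * ((C0 * ln n%:R `^ C0) ^+ 3 * ln n%:R)
    = 6200 * C0 ^+ 3 * ln n%:R `^ (3 * C0 + 1).
  rewrite powRD; last by rewrite (gt_eqF (lt_le_trans _ l32)) ?implybT//; lra.
  rewrite powRr1; last by lra.
  by rewrite mulrC [3 * C0]mulrC powRrM powR_mulrn ?powR_ge0//; ring.
have h1 : 6200 * C0 ^+ 3 <= C by rewrite /C; lra.
have h2 : ln n%:R `^ (3 * C0 + 1) <= ln n%:R `^ C.
  by apply: ler_powR; rewrite /C; lra.
have h3 : 0 <= 6200 * C0 ^+ 3 by apply: mulr_ge0; [exact: ler0n|exact: c3].
apply: ler_pM; [exact: h3|exact: powR_ge0|exact: h1|exact: h2].
Qed.

Theorem corollary2p11 (R : realType) (C0 : R) (hC0 : 1 <= C0) :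
  exists C : R, 1 <= C /\
  forall (n : nat) (hn : (8 <= n)%N) (p : nat) (hp : p = 1%N \/ p = 2%N)
    (d : measure_display) (X : measurableType d) (P : probability X R)
    (F : 'rV[R]_n -> X -> R) (g : 'rV[R]_n -> X -> 'rV[R]_n) (L : X -> R)
    (L2 sigma : R) (hF : stochastic_problem P F g L L2 sigma)
    (eta : 'rV[R]_n -> X -> R) (Delta : R) (heta : bounded_noise P eta Delta)
    (xstar : 'rV[R]_n) (hxstar : is_minimizer (objective P F) xstar)
    (x0 : 'rV[R]_n) (Theta : R) (hTheta : bregman p x0 xstar <= Theta)
    (hDelta0 : 0 < Delta)
    (hDelta : Delta <= L2 * Theta * n%:R * rho n p ^+ 2 / 2)
    (N m : nat) (t : R) (hN0 : (0 < N)%N) (hm0 : (0 < m)%N) (ht0 : 0 < t)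
    (hmD : 0 < m_Delta n L2 Theta sigma Delta)
    (hN : ratio_polylog n C0 N%:R (N_Delta n p L2 Theta Delta))
    (hm : ratio_polylog n C0 m%:R (m_Delta n L2 Theta sigma Delta))
    (ht : ratio_polylog n C0 t (t_Delta L2 Delta))
    (d' : measure_display) (Omega : measurableType d')
    (Pr : probability Omega R)
    (e : 'I_N -> {RV Pr >-> 'rV[R]_n}) (xi : 'I_N -> 'I_m -> {RV Pr >-> X})
    (hdraws : rdfds_draws P e xi)
    (x : nat -> Omega -> 'rV[R]_n)
    (hx : forall w, rdfds_run F eta p L2 t x0 (fun k => e k w)
                      (fun k i => xi k i w) (fun k => x k w)),
    ('E_Pr[fun w => objective P F (rdfds_output N (fun k => x k w))]
       - (objective P F xstar)%:E
       <= (C * ln n%:R `^ C * eps_Delta n L2 Theta Delta)%:E)%E /\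
    (forall w, size (rdfds_calls t (fun k => e k w) (fun k i => xi k i w)
                       (fun k => x k w)) = (N * m)%N) /\
    (N * m)%:R <= C * ln n%:R `^ C * calls_Delta n p L2 Theta sigma Delta.
Proof.
set C : R := 6200 * C0 ^+ 3 + 3 * C0 + 1.
have C1 : 1 <= C by rewrite /C; have : 0 <= C0 ^+ 3 by [rewrite exprn_ge0; lra]; lra.
exists C; split=> // n hn p hp d X P F g L L2 sigma hF eta Delta heta xs hxs x0 Theta.
move=> hTheta de0 hDelta N m t N0 m0 t0 mD hN hm ht d' Om Pr e xi hdraws x hx.
have l0 := sp_L2_gt0 hF; have n0 : (0 < n)%N by exact: leq_trans hn.
have nR : 0 < n%:R :> R by rewrite ltr0n.
have NR : 0 < N%:R :> R by rewrite ltr0n.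
have mR : 0 < m%:R :> R by rewrite ltr0n.
have rr := @rho_gt0 R n p hn hp.
(* The upper bound on the positive Delta forces Theta to be positive. *)
have th0 : 0 < Theta.
  have lw : 0 < L2 * n%:R * rho n p ^+ 2 / 2 by apply: divr_gt0 => //; apply: mulr_gt0; [exact: mulr_gt0|exact: exprn_gt0].
  have := lt_le_trans de0 hDelta.
  rewrite (_ : L2 * Theta * n%:R * rho n p ^+ 2 / 2 = L2 * n%:R * rho n p ^+ 2 / 2 * Theta).
    by rewrite pmulr_rgt0.
  by ring.
have e0 := eps_Delta_gt0 L2 Theta hn de0.
set K := C0 * ln n%:R `^ C0.
have K1 : 1 <= K by exact: polylog_ge1.
have ND0 : 0 < N_Delta n p L2 Theta Delta.
  by rewrite (N_DeltaE p hn l0 th0 de0) divr_gt0// scale_Delta_gt0.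
have tD0 : 0 < t_Delta L2 Delta by rewrite sqrtr_gt0 divr_gt0.
have [NK KN] := ratio_polylogP hn hC0 NR ND0 hN.
have [mK Km] := ratio_polylogP hn hC0 mR mD hm.
have [tK Kt] := ratio_polylogP hn hC0 t0 tD0 ht.
have absorb := polylog_absorb hn hC0; rewrite /= -/C -/K in absorb.
have l32 := @ln_ge32 R _ hn.
split; last split.
- have [a [b [c [A [B [r [[a1 a2 b2 ab c0] [bc proxE [A0 B0] hW hrho]]]]]]]] :=
    @prox_setup R n hn p hp.
  have bregE (z y : 'rV[R]_n) : bregman p z y = divergence a c z y.
    by rewrite /bregman proxE (grad_potential _ a1 a2 ab).
  have s0 : 0 <= @stepsize R n p L2 * n%:R.
    by apply: mulr_ge0 => //; rewrite invr_ge0; nneg.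
  have hx0 w : x 0%N w = x0 by have [] := hx w.
  have hstep (k : 'I_N) w : x k.+1 w = comirror b c (mirror a c (x k w)
      - @stepsize R n p L2 * n%:R *: grad_approx F eta t (x k w) (e k w) (fun i => xi k i w)).
    have [_ /(_ k) H] := hx w; apply: (prox_step_eq a1 b2 ab c0 bc) => y.
    by have := H y; rewrite !bregE.
  have := run_output_bound hF heta n0 hdraws m0 a1 a2 b2 ab c0 bc A0 B0 hW hrho hxs s0 t0
    hx0 hstep N0 rr erefl.
  move=> /le_trans; apply; rewrite lee_fin.
  have V1 : divergence a c x0 xs <= Theta by rewrite -bregE.
  have := rate_bound hn hp l0 th0 de0 K1 NR mR V1 NK KN Km
    (smoothing_error_le l0 de0 K1 t0 tK Kt).
  by move=> /le_trans; apply; rewrite ler_wpM2r// ltW.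
- by move=> w; rewrite /rdfds_calls size_allpairs !size_enum_ord.
- rewrite natrM (calls_DeltaE p sigma hn l0 th0 de0).
  (* The number of calls costs only K^2, which is enlarged to 6200 K^3 ln n so that the same C
     applies. *)
  apply: (@le_trans _ _ ((K * N_Delta n p L2 Theta Delta) * (K * m_Delta n L2 Theta sigma Delta))).
    by apply: ler_pM; [exact: ler0n|exact: ler0n|exact: NK|exact: mK].
  have -> : K * N_Delta n p L2 Theta Delta * (K * m_Delta n L2 Theta sigma Delta)
    = K ^+ 2 * (N_Delta n p L2 Theta Delta * m_Delta n L2 Theta sigma Delta) by ring.
  rewrite ler_wpM2r ?mulr_ge0 ?(ltW mD) ?(ltW ND0)//; apply: le_trans absorb.
  have K0 : 0 <= K by exact: le_trans K1.
  have h1 : K ^+ 2 <= K ^+ 3 by rewrite ler_weXn2l.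
  have h2 : K ^+ 3 <= K ^+ 3 * ln n%:R by rewrite ler_peMr ?exprn_ge0//; lra.
  apply: (le_trans h1); apply: (le_trans h2); apply: ler_peMl; last by rewrite ler1n.
  by apply: mulr_ge0; [exact: exprn_ge0|lra].
Qed.
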